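(* Let $G=(V,E)$ be a $5$-regular graph. Then $G$ is $\mathcal{R}_3$-independent if and only if $G$ is $3$-sparse.
   Context: Graphs are finite and simple. For a graph $G=(V,E)$ and a map $p:V\to\mathbb{R}^d$, the rigidity matrix $R_d(G,p)$ is the $|E|\times d|V|$ real matrix with rows indexed by edges and $d$-tuples of columns indexed by vertices; the row of an edge $uv$ has $p(u)-p(v)$ in the $d$ columns of $u$, $p(v)-p(u)$ in the $d$ columns of $v$, and zeros elsewhere. The map $p$ is generic if the set of coordinates of all the points $p(v)$, $v\in V$, is algebraically independent over $\mathbb{Q}$. The row matroid of $R_d(G,p)$ is the same for every generic $p$. The graph $G$ is $\mathcal{R}_d$-independent if for some (equivalently every) generic $p$ the rows of $R_d(G,p)$ are linearly independent. For $X\subseteq V$, $i(X)$ denotes the number of edges of the subgraph $G[X]$ induced by $X$. The graph $G$ is $3$-sparse if $i(X)\le 3|X|-6$ for all $X\subseteq V$ with $|X|\ge 3$. *)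

(* Defs.v *)
From HB Require Import structures.
From mathcomp Require Import all_boot all_order all_algebra.
From mathcomp Require Import reals.
(* The notations of [mpoly] clash with those of MathComp-Analysis. *)
From mathcomp Require Import -(notations) mpoly.

Set Implicit Arguments.
Unset Strict Implicit.
Unset Printing Implicit Defensive.

Import Order.TTheory GRing.Theory Num.Theory.
Local Open Scope ring_scope.

Section Genericity.
Variable R : realType.

(* Algebraic independence over Q of a finite family [x]: the variable with
   index [i] is evaluated at the [i]-th element of the enumeration of [I]. *)
Definition alg_indep (I : finType) (x : I -> R) : Prop :=
  forall q : mpoly #|I| rat,
    q != 0 -> mmap (ratr : rat -> R) (fun i => x (enum_val i)) q != 0.

Definition generic (V : finType) (d : nat) (p : V -> 'rV[R]_d) : Prop :=
  alg_indep (fun vk : V * 'I_d => p vk.1 0 vk.2).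

End Genericity.

Section Graphs.
Variables (V : finType) (e : rel V).

Definition edges : {set {set V}} :=
  [set [set uv.1; uv.2] | uv in [set uv : V * V | e uv.1 uv.2]].

Definition regular (k : nat) : Prop := forall v : V, #|[set u | e v u]| = k.

Definition induced_edges (X : {set V}) : nat :=
  #|[set a in edges | a \subset X]|.

(* The subtraction is never truncated, since 3 <= #|X|. *)
Definition three_sparse : Prop :=
  forall X : {set V}, (3 <= #|X|)%N -> (induced_edges X <= 3 * #|X| - 6)%N.

(* Columns are indexed by pairs (vertex, coordinate).  For an edge a = {w, u}
   the sum has the single index u, so that the entry is the k-th coordinate of
   p(w) - p(u); no orientation of the edges is needed. *)
Definition rigidity_matrix (R : realType) (d : nat) (p : V -> 'rV[R]_d) :
    'M[R]_(#|edges|, #|{: V * 'I_d}|) :=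
  \matrix_(i < #|edges|, j < #|{: V * 'I_d}|)
    let a : {set V} := enum_val i in
    let: (w, k) := (enum_val j : V * 'I_d) in
    if w \in a then \sum_(u in a :\ w) (p w 0 k - p u 0 k) else 0.

Definition rigidity_independent (R : realType) (d : nat) : Prop :=
  exists2 p : V -> 'rV[R]_d, generic p & row_free (rigidity_matrix p).

End Graphs.

(* Main.v *)
Require Import Defs.
From HB Require Import structures.
From mathcomp Require Import all_boot all_order all_algebra.
From mathcomp Require Import reals.
From mathcomp Require Import ring lra zify.
From mathcomp Require Import boolp.
From mathcomp Require mpoly classical_sets functions cardinality.
From mathcomp Require constructive_ereal ereal lebesgue_measure.

(** A framework is dependent if it carries a nonzero stress: a weighting of the edges
    whose forces are in equilibrium at every vertex.  Weightings and infinitesimal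
    motions are dual to each other by virtual work ([indep_strain], [resolve_load]).
    Independence is an open condition in the sense of [zopen]: if it holds at one placement
    of the vertices then it holds at almost all points of each line through it.  Finitely
    many such conditions can therefore be met at once, and it is enough to find one
    independent placement; the Gram determinant of the rigidity matrix, a polynomial with
    rational coefficients, transfers independence to generic placements
    ([generic_row_free]), which exist by [generic_exists].

    An independent graph is sparse by Maxwell's count ([indep_three_sparse]): of the
    [3 |X|] equilibrium equations at the vertices [X] six follow from the others.

    For the converse consider, more generally, sparse graphs of maximum degree five, and
    among those without an independent placement one with the fewest edges.  All smaller
    graphs of the class have independent placements, and several constructions pass them
    on.

    - A vertex with at most three neighbours can be added to an independent framework, and
      one with four neighbours if an edge between two of these is removed; the count
      allows a suitable choice of this edge ([degree4_pair]).  Hence all degrees are five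
      or zero, and the graph is connected up to isolated vertices.

    - A tight set [X], one with [3 |X| - 6] edges, is left by [12 - |X|] edges.  If it has
      five to eleven vertices then it can be exchanged for a tetrahedron, onto whose
      vertices the ends of these edges are distributed ([contraction],
      [four_groups]); only the rigid motions of [X] matter for the other edges
      ([body_substitution]).  So the only tight sets with at least four vertices that
      edges leave are tetrahedra ([minimal_no_tight], [tight_clique]).

    - Tetrahedra are excluded by special placements: if one vertex of a tetrahedron lies at
      the midpoint of its two outer neighbours then dependence of the graph implies
      dependence without one of these two edges ([midpoint_dependent]), and this is refuted
      by a placement in which two other vertices of the tetrahedron coincide
      ([tetrahedron_bodyindep]).

    - Now among any three neighbours of a vertex [v] two are not adjacent, and when [v] is
      deleted one or two edges between its neighbours may be added without leaving the
      class.  The motions of the rest are thus rich enough for the following: as the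
      framework is dependent wherever [v] is placed, its stress gives the edges at [v] the
      coefficients of the affine dependency of the five neighbours, with sum zero
      ([five_neighbours]).  By openness each placement whatsoever has a nonzero
      affine stress, one whose weights at every vertex form an affine dependency of the
      neighbours ([minimal_astress]).

    This is impossible.  In a placement where exactly one set of four vertices is coplanar
    an affine stress that vanishes on one edge at a vertex vanishes on all of them, except
    where the four other neighbours are that set.  With a suitable coplanar set of four
    neighbours of one vertex this yields a small cut of the graph ([coplanar_cut]), and two
    such cuts lead to a complete bipartite graph on five and five vertices, which is not
    sparse ([minimal_false]). *)
Set Implicit Arguments.
Unset Strict Implicit.
Unset Printing Implicit Defensive.

Import Order.TTheory GRing.Theory Num.Theory.
Local Open Scope ring_scope.

(** * Systems of linear equations indexed by finite types *)

Section LinearSystems.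
Variable F : fieldType.

Lemma mx_fredholm m n (A : 'M[F]_(m, n)) (c : 'cV[F]_m) :
  (forall w : 'rV_m, w *m A = 0 -> w *m c = 0) -> exists x : 'cV_n, A *m x = c.
Proof.
move=> h.
have hk : (cokermx A^T)^T *m A = 0.
  by apply: trmx_inj; rewrite trmx_mul trmxK mulmx_coker trmx0.
have hc : (cokermx A^T)^T *m c = 0.
  apply/row_matrixP=> i; rewrite row_mul row0; apply: h.
  by rewrite -row_mul hk row0.
have /submxP[D hD] : (c^T <= A^T)%MS.
  by rewrite submxE -[cokermx _]trmxK -trmx_mul hc trmx0.
by exists D^T; rewrite -[A]trmxK -trmx_mul -hD trmxK.
Qed.

(** The passage between functions on a finite type and vectors, whose entries are
    indexed by ordinals. *)
Lemma sum_enum (I : finType) (W : nmodType) (f : I -> W) :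
  \sum_(i < #|I|) f (enum_val i) = \sum_i f i.
Proof.
rewrite [RHS](reindex (@enum_val I I)) //=.
by exists enum_rank => i _; rewrite ?enum_valK ?enum_rankK.
Qed.

(** The Fredholm alternative.  Equations and unknowns have finite types of indices, so
    that the systems below need no numbering of vertices and bars. *)
Lemma fredholm (I J : finType) (a : I -> J -> F) (c : I -> F) :
  (forall w : I -> F, (forall j, \sum_i w i * a i j = 0) -> \sum_i w i * c i = 0) ->
  exists x : J -> F, forall i, \sum_j a i j * x j = c i.
Proof.
move=> h.
pose A : 'M[F]_(#|I|, #|J|) := \matrix_(i, j) a (enum_val i) (enum_val j).
pose C : 'cV[F]_(#|I|) := \col_i c (enum_val i).
have [w hw|x hx] := @mx_fredholm _ _ A C.
  pose w' i := w 0 (enum_rank i).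
  have sumE (f : I -> F) : \sum_i w' i * f i = \sum_i w 0 i * f (enum_val i).
    by rewrite -sum_enum; apply: eq_bigr => i _; rewrite /w' enum_valK.
  have {}h : \sum_i w' i * c i = 0.
    apply: h => j; rewrite sumE; move/rowP/(_ (enum_rank j)): hw; rewrite !mxE.
    by move=> e; rewrite -[RHS]e; apply: eq_bigr => i _; rewrite mxE enum_rankK.
  apply/rowP=> k; rewrite !mxE ord1 -[RHS]h sumE.
  by apply: eq_bigr => i _; rewrite mxE.
exists (fun j => x (enum_rank j) 0) => i.
move/colP/(_ (enum_rank i)): hx; rewrite !mxE enum_rankK => <-.
rewrite -sum_enum; apply: eq_bigr => j _.
by rewrite !mxE enum_rankK enum_valK.
Qed.

Lemma nontrivial_solution (I J : finType) (a : I -> J -> F) :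
  (#|I| < #|J|)%N ->
  exists x : J -> F, (forall i, \sum_j a i j * x j = 0) /\ (exists j, x j != 0).
Proof.
move=> ltIJ.
pose A : 'M[F]_(#|J|, #|I|) := \matrix_(j, i) a (enum_val i) (enum_val j).
have /rowV0Pn[v /sub_kermxP hv v0] : kermx A != 0.
  rewrite kermx_eq0 /row_free; apply: contraTneq ltIJ => hr.
  by rewrite -leqNgt -[leqLHS]hr rank_leq_col.
have /existsP[j hj] : [exists j, v 0 j != 0].
  apply: contraR v0; rewrite negb_exists => /forallP h.
  by apply/eqP/rowP=> j; rewrite mxE; apply/eqP; rewrite -[_ == _]negbK h.
exists (fun j => v 0 (enum_rank j)); split; last first.
  by exists (enum_val j); rewrite enum_valK.
move=> i; move/rowP/(_ (enum_rank i)): hv; rewrite !mxE => e.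
rewrite -[RHS]e -sum_enum; apply: eq_bigr => k _.
by rewrite !mxE enum_rankK enum_valK mulrC.
Qed.

Lemma square_solvable (I J : finType) (a : I -> J -> F) (c : I -> F) :
  #|I| = #|J| ->
  (forall x : J -> F, (forall i, \sum_j a i j * x j = 0) -> forall j, x j = 0) ->
  exists x : J -> F, forall i, \sum_j a i j * x j = c i.
Proof.
move=> eIJ h.
pose A : 'M[F]_(#|J|, #|I|) := \matrix_(j, i) a (enum_val i) (enum_val j).
have rfA : row_free A.
  rewrite -kermx_eq0; apply/rowV0P => v /sub_kermxP hv; apply/rowP=> k.
  rewrite mxE; have := h (fun j => v 0 (enum_rank j)) _ (enum_val k).
  rewrite enum_valK; apply=> i.
  move/rowP/(_ (enum_rank i)): hv; rewrite !mxE => e.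
  rewrite -[RHS]e -sum_enum; apply: eq_bigr => l _.
  by rewrite !mxE enum_rankK enum_valK mulrC.
have fullA : row_full A by rewrite /row_full (eqP rfA) eIJ.
have /row_fullP[B hB] := fullA.
pose C : 'rV[F]_(#|I|) := \row_i c (enum_val i).
exists (fun j => (C *m B) 0 (enum_rank j)) => i.
have : C *m B *m A = C by rewrite -mulmxA hB mulmx1.
move/rowP/(_ (enum_rank i)); rewrite [in LHS]mxE [in RHS]mxE enum_rankK => <-.
rewrite -sum_enum; apply: eq_bigr => l _.
by rewrite !mxE enum_rankK enum_valK mulrC.
Qed.

End LinearSystems.

(** * Vectors of three-space *)

Section Vectors.
Variable R : realFieldType.
Local Notation vec := 'rV[R]_3.

Definition dot (u v : vec) : R := \sum_k u 0 k * v 0 k.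

Lemma dotC u v : dot u v = dot v u.
Proof. by apply: eq_bigr => k _; rewrite mulrC. Qed.
Lemma dotDl u v w : dot (u + v) w = dot u w + dot v w.
Proof. by rewrite -big_split; apply: eq_bigr => k _; rewrite mxE mulrDl. Qed.
Lemma dotZl a u w : dot (a *: u) w = a * dot u w.
Proof. by rewrite mulr_sumr; apply: eq_bigr => k _; rewrite mxE mulrA. Qed.
Lemma dotNl u w : dot (- u) w = - dot u w.
Proof. by rewrite -scaleN1r dotZl mulN1r. Qed.
Lemma dotBl u v w : dot (u - v) w = dot u w - dot v w.
Proof. by rewrite dotDl dotNl. Qed.
Lemma dotDr u v w : dot w (u + v) = dot w u + dot w v.
Proof. by rewrite dotC dotDl !(dotC _ w). Qed.
Lemma dotZr a u w : dot w (a *: u) = a * dot w u.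
Proof. by rewrite dotC dotZl dotC. Qed.
Lemma dotNr u w : dot w (- u) = - dot w u.
Proof. by rewrite dotC dotNl dotC. Qed.
Lemma dotBr u v w : dot w (u - v) = dot w u - dot w v.
Proof. by rewrite dotDr dotNr. Qed.
Lemma dot0l w : dot 0 w = 0.
Proof. by rewrite -(scale0r 0) dotZl mul0r. Qed.
Lemma dot0r w : dot w 0 = 0.
Proof. by rewrite dotC dot0l. Qed.
Lemma dot_suml (I : finType) (P : pred I) (f : I -> vec) w :
  dot (\sum_(i | P i) f i) w = \sum_(i | P i) dot (f i) w.
Proof. by elim/big_rec2: _ => [|i x y _ <-]; rewrite ?dot0l ?dotDl. Qed.
Lemma dot_sumr (I : finType) (P : pred I) (f : I -> vec) w :
  dot w (\sum_(i | P i) f i) = \sum_(i | P i) dot w (f i).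
Proof. by rewrite dotC dot_suml; apply: eq_bigr => i _; rewrite dotC. Qed.

Lemma dot_eq0 u : dot u u = 0 -> u = 0.
Proof.
move=> h; apply/rowP=> k; rewrite mxE; apply/eqP; rewrite -sqrf_eq0 expr2.
apply/eqP; have /psumr_eq0P := h; apply=> // i _.
by rewrite -expr2 sqr_ge0.
Qed.

Definition c0 : 'I_3 := @Ordinal 3 0 isT.
Definition c1 : 'I_3 := @Ordinal 3 1 isT.
Definition c2 : 'I_3 := @Ordinal 3 2 isT.

Lemma coord3 (P : 'I_3 -> Prop) : P c0 -> P c1 -> P c2 -> forall k, P k.
Proof.
move=> h0 h1 h2 [[|[|[|//]]] hk].
- by rewrite (_ : Ordinal hk = c0) //; apply: val_inj.
- by rewrite (_ : Ordinal hk = c1) //; apply: val_inj.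
- by rewrite (_ : Ordinal hk = c2) //; apply: val_inj.
Qed.

Lemma sum3 (W : nmodType) (f : 'I_3 -> W) : \sum_k f k = f c0 + f c1 + f c2.
Proof.
rewrite !big_ord_recr big_ord0 /= add0r.
by congr (_ + _ + _); congr f; apply: val_inj.
Qed.

Lemma vec3P (u v : vec) :
  u 0 c0 = v 0 c0 -> u 0 c1 = v 0 c1 -> u 0 c2 = v 0 c2 -> u = v.
Proof. by move=> *; apply/rowP; elim/coord3. Qed.

Lemma dot3 u v : dot u v = u 0 c0 * v 0 c0 + u 0 c1 * v 0 c1 + u 0 c2 * v 0 c2.
Proof. exact: sum3. Qed.

Definition mkvec (x y z : R) : vec :=
  \row_k (if k == c0 then x else if k == c1 then y else z).
Lemma mkvecE x y z : ((mkvec x y z 0 c0 = x) * (mkvec x y z 0 c1 = y) *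
  (mkvec x y z 0 c2 = z))%type.
Proof. by rewrite !mxE. Qed.

Definition cross (u v : vec) : vec :=
  mkvec (u 0 c1 * v 0 c2 - u 0 c2 * v 0 c1)
        (u 0 c2 * v 0 c0 - u 0 c0 * v 0 c2)
        (u 0 c0 * v 0 c1 - u 0 c1 * v 0 c0).

Lemma crossE u v : ((cross u v 0 c0 = u 0 c1 * v 0 c2 - u 0 c2 * v 0 c1) *
  (cross u v 0 c1 = u 0 c2 * v 0 c0 - u 0 c0 * v 0 c2) *
  (cross u v 0 c2 = u 0 c0 * v 0 c1 - u 0 c1 * v 0 c0))%type.
Proof. by rewrite /cross !mkvecE. Qed.

Lemma coordD (u v : vec) k : (u + v) 0 k = u 0 k + v 0 k. Proof. exact: mxE. Qed.
Lemma coordN (u : vec) k : (- u) 0 k = - u 0 k. Proof. exact: mxE. Qed.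
Lemma coordZ a (u : vec) k : (a *: u) 0 k = a * u 0 k. Proof. exact: mxE. Qed.
Lemma coord0 k : (0 : vec) 0 k = 0. Proof. exact: mxE. Qed.
Definition vecE := (crossE, mkvecE, dot3, coordD, coordN, coordZ, coord0).

End Vectors.

Ltac vec_ring := rewrite ?vecE; ring.
Ltac vec3 := apply: vec3P; vec_ring.

Section CrossProducts.
Variable R : realFieldType.
Local Notation vec := 'rV[R]_3.
Implicit Types u v w : vec.

Lemma crossDr w u v : cross w (u + v) = cross w u + cross w v.
Proof. vec3. Qed.
Lemma crossZr w a u : cross w (a *: u) = a *: cross w u.
Proof. vec3. Qed.
Lemma crossNr w u : cross w (- u) = - cross w u.
Proof. vec3. Qed.
Lemma crossBr w u v : cross w (u - v) = cross w u - cross w v.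
Proof. vec3. Qed.
Lemma crossDl w u v : cross (u + v) w = cross u w + cross v w.
Proof. vec3. Qed.
Lemma crossZl w a u : cross (a *: u) w = a *: cross u w.
Proof. vec3. Qed.
Lemma crossBl w u v : cross (u - v) w = cross u w - cross v w.
Proof. vec3. Qed.
Lemma crossC u v : cross u v = - cross v u.
Proof. vec3. Qed.
Lemma crossvv u : cross u u = 0.
Proof. vec3. Qed.
Lemma cross0r u : cross u 0 = 0.
Proof. vec3. Qed.
Lemma cross0l u : cross 0 u = 0.
Proof. by rewrite crossC cross0r oppr0. Qed.
Lemma cross_sumr (I : finType) (P : pred I) (f : I -> vec) w :
  cross w (\sum_(i | P i) f i) = \sum_(i | P i) cross w (f i).
Proof. by elim/big_rec2: _ => [|i x y _ <-]; rewrite ?cross0r ?crossDr. Qed.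
Lemma dot_crossl u v : dot u (cross u v) = 0.
Proof. vec_ring. Qed.
Lemma dot_crossr u v : dot u (cross v u) = 0.
Proof. vec_ring. Qed.
Lemma dot_cross_cycle u v w : dot u (cross v w) = dot w (cross u v).
Proof. vec_ring. Qed.

(** The field of velocities of a rigid motion. *)
Definition rigid_field (c t q : vec) : vec := c + cross t q.

Lemma rigid_strain c t q r :
  dot (q - r) (rigid_field c t q - rigid_field c t r) = 0.
Proof. rewrite /rigid_field; vec_ring. Qed.

(** With [a], [b] two sides of a triangle, [al], [be] their derivatives in an
    infinitesimal isometry and [n] the normal, the angular velocity is determined by
    its inner products with [a], [b] and [n]. *)
Lemma triangle_rigid (a b al be : vec) :
  cross a b != 0 -> dot a al = 0 -> dot b be = 0 -> dot (a - b) (al - be) = 0 ->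
  exists t, cross t a = al /\ cross t b = be.
Proof.
move=> hn ha hb; rewrite !dotBl !dotBr ha hb => hab.
set n := cross a b in hn *.
have nn0 : dot n n != 0 by apply: contra_neq hn => /dot_eq0.
pose s := (dot be n) *: a - (dot al n) *: b + (dot al b) *: n.
have cramer v : dot n n *: v =
    dot v a *: cross b n + dot v b *: cross n a + dot v n *: n.
  by rewrite /n; vec3.
have nb v : dot n n *: v = 0 -> v = 0.
  by move=> h; rewrite -[v]scale1r -(mulVf nn0) -scalerA h scaler0.
have hs v : cross ((dot n n)^-1 *: s) v = (dot n n)^-1 *: cross s v.
  by rewrite crossZl.
exists ((dot n n)^-1 *: s); rewrite !hs; split.
- apply/eqP; rewrite -subr_eq0; apply/eqP/nb.
  rewrite scalerBr scalerA divff // scale1r cramer (dotC al a) ha scale0r add0r.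
  rewrite /s crossDl crossBl !crossZl crossvv scaler0 sub0r.
  by rewrite (crossC b a) -/n; vec3.
- apply/eqP; rewrite -subr_eq0; apply/eqP/nb.
  rewrite scalerBr scalerA divff // scale1r cramer (dotC be b) hb scale0r addr0.
  have -> : dot be a = - dot al b.
    rewrite (dotC be) (dotC al); lra.
  rewrite /s crossDl crossBl !crossZl crossvv scaler0 subr0 -/n.
  by vec3.
Qed.

End CrossProducts.

(** * Finite sums *)

Lemma sum_pair (I J : finType) (W : nmodType) (f : I * J -> W) :
  \sum_i f i = \sum_i \sum_j f (i, j).
Proof. by rewrite pair_bigA; apply: eq_bigr => -[]. Qed.

Section Deltas.
Variables (F : nzRingType) (I : finType).

Lemma sum_delta (W : lmodType F) (a : I) (f : I -> W) : \sum_i (i == a)%:R *: f i = f a.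
Proof. by rewrite (bigD1 a) //= eqxx scale1r big1 ?addr0 // => i /negPf ->; rewrite scale0r. Qed.
Lemma sum_deltaM (a : I) (f : I -> F) : \sum_i (i == a)%:R * f i = f a.
Proof. exact: (@sum_delta F^o). Qed.
Lemma sum_delta1 (a : I) : \sum_i (i == a)%:R = 1 :> F.
Proof. by rewrite -[RHS](sum_deltaM a (fun=> 1)); apply: eq_bigr => i _; rewrite mulr1. Qed.
Lemma sum_scaleB (W : lmodType F) (c : I -> F) (q : W) (f : I -> W) :
  \sum_i c i *: (q - f i) = (\sum_i c i) *: q - \sum_i c i *: f i.
Proof. by under eq_bigr do rewrite scalerBr; rewrite sumrB -scaler_suml. Qed.

End Deltas.

(** * Frameworks, stresses and infinitesimal motions *)

Section Frameworks.
Variables (R : realFieldType) (V : finType).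
Local Notation vec := 'rV[R]_3.
Local Notation conf := (V -> 'rV[R]_3).
Implicit Types (e : rel V) (p m : V -> 'rV[R]_3) (w : V -> V -> R).

Definition strain p m u v := dot (p u - p v) (m u - m v).
Definition motion e p m := forall u v, e u v -> strain p m u v = 0.

Definition weighting e w :=
  (forall u v, w u v = w v u) /\ (forall u v, ~~ e u v -> w u v = 0).
(** The weights are force densities: they multiply the vectors of the bars, not unit
    vectors, so that no lengths occur. *)
Definition force p w v : vec := \sum_u w v u *: (p v - p u).
Definition stress e p w := weighting e w /\ forall v, force p w v = 0.
Definition indep e p := forall w, stress e p w -> forall u v, w u v = 0.

Lemma sub_weighting e e' w :
  (forall u v, e u v -> e' u v) -> weighting e w -> weighting e' w.
Proof.
move=> sub [sw ew]; split=> // u v; apply: contraNeq => w0; apply: sub.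
by apply: contra_neqT w0 => /ew.
Qed.

Lemma sub_indep e e' p : (forall u v, e u v -> e' u v) -> indep e' p -> indep e p.
Proof. by move=> sub h w [hw hf]; apply: h; split=> //; apply: sub_weighting hw. Qed.

Lemma strainC p m u v : strain p m u v = strain p m v u.
Proof. by rewrite /strain -(opprB (p v)) -(opprB (m v)) dotNl dotNr opprK. Qed.

(** The principle of virtual work.  The factor two occurs because the sum on the right
    meets each bar in both directions. *)
Lemma virtual_work p w m : (forall u v, w u v = w v u) ->
  2 * \sum_v dot (force p w v) (m v) = \sum_v \sum_u w v u * strain p m v u.
Proof.
move=> sw.
have E1 : \sum_v dot (force p w v) (m v) =
    \sum_v \sum_u w v u * dot (p v - p u) (m v).
  apply: eq_bigr => v _; rewrite dot_suml.
  by apply: eq_bigr => u _; rewrite dotZl.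
have E2 : \sum_v dot (force p w v) (m v) =
    \sum_v \sum_u w v u * - dot (p v - p u) (m u).
  rewrite E1 exchange_big; apply: eq_bigr => v _; apply: eq_bigr => u _.
  by rewrite sw -(opprB (p v)) dotNl.
rewrite -[2]/(1 + 1) mulrDl !mul1r {1}E1 E2 -big_split; apply: eq_bigr => v _.
by rewrite -big_split; apply: eq_bigr => u _ /=; rewrite -mulrDr /strain dotBr.
Qed.

Lemma virtual_work0 e p w m :
  stress e p w -> \sum_v \sum_u w v u * strain p m v u = 0.
Proof.
case=> [[sw _] eq0]; rewrite -virtual_work // big1 ?mulr0 // => v _.
by rewrite eq0 dot0l.
Qed.

Definition velocity (x : V * 'I_3 -> R) v : vec := \row_k x (v, k).

Lemma sum_velocity (f : conf) (x : V * 'I_3 -> R) :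
  \sum_j f j.1 0 j.2 * x j = \sum_v dot (f v) (velocity x v).
Proof.
rewrite sum_pair /=.
by apply: eq_bigr => v _; apply: eq_bigr => k _; rewrite mxE.
Qed.

(** The bars are the ordered pairs here, each edge giving two of them; the first factor
    discards the pairs that are not edges. *)
Definition bar_load e p (i : V * V) v : vec :=
  (e i.1 i.2)%:R *: ((p i.1 - p i.2) *+ (v == i.1) - (p i.1 - p i.2) *+ (v == i.2)).

Lemma work_bar_load e p i m :
  \sum_v dot (bar_load e p i v) (m v) = (e i.1 i.2)%:R * strain p m i.1 i.2.
Proof.
have E z : \sum_v dot ((p i.1 - p i.2) *+ (v == z)) (m v) = dot (p i.1 - p i.2) (m z).
  by rewrite (bigD1 z) //= eqxx big1 ?addr0 // => v /negPf ->; rewrite dot0l.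
under eq_bigr do rewrite dotZl dotBl.
by rewrite -mulr_sumr sumrB !E -dotBr.
Qed.

Lemma force_bar_load e p (x : V * V -> R) v : symmetric e ->
  force p (fun u z => (e u z)%:R * (x (u, z) + x (z, u))) v = \sum_i x i *: bar_load e p i v.
Proof.
move=> es; rewrite sum_pair.
have E y z : x (y, z) *: bar_load e p (y, z) v =
    (if y == v then ((e y z)%:R * x (y, z)) *: (p y - p z) else 0) +
    (if z == v then ((e y z)%:R * x (y, z)) *: (p z - p y) else 0).
  rewrite /bar_load /= !(eq_sym v) scalerA (mulrC (x _)) scalerBr -(opprB (p y) (p z)).
  by congr (_ + _); case: (_ == v); rewrite ?scaler0 ?scalerN ?oppr0.
under [RHS]eq_bigr do (under eq_bigr do rewrite E; rewrite big_split /=).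
rewrite big_split [X in _ = _ + X]exchange_big -big_split (bigD1 v) //= -big_split /=.
rewrite [X in _ = _ + X]big1 ?addr0 => [|y /negPf yv]; last first.
  by rewrite !big1 ?addr0 // => z _; rewrite yv.
by apply: eq_bigr => u _; rewrite eqxx (es u) -scalerDl mulrDr.
Qed.

Lemma bar_weighting e (x : V * V -> R) : symmetric e ->
  weighting e (fun u z => (e u z)%:R * (x (u, z) + x (z, u))).
Proof. by move=> es; split=> [u v|u v /negPf ->]; rewrite ?mul0r // es addrC. Qed.

(** The transpose of the system which gives the strains of a motion is the system of
    equilibrium equations.  If the latter has only the zero solution then the Fredholm
    alternative gives a solution of the former. *)
Lemma indep_strain e p (c : V -> V -> R) : symmetric e -> indep e p ->
  (forall u v, c u v = c v u) ->
  exists m, forall u v, e u v -> strain p m u v = c u v.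
Proof.
move=> es ind sc.
have [x hx|x hx] := @fredholm R (V * V)%type (V * 'I_3)%type
    (fun i j => bar_load e p i j.1 0 j.2) (fun i => (e i.1 i.2)%:R * c i.1 i.2).
  pose w u v := (e u v)%:R * (x (u, v) + x (v, u)).
  have w0 : forall u v, w u v = 0.
    apply: ind; split=> [|v]; first exact: bar_weighting.
    rewrite force_bar_load //; apply/rowP=> k; rewrite summxE mxE -[RHS](hx (v, k)).
    by apply: eq_bigr => i _; rewrite mxE.
  apply: (@mulIf R 2%:R); rewrite ?pnatr_eq0 // mul0r mulrDr mulr1 sum_pair /=.
  rewrite [X in _ + X]exchange_big -big_split big1 // => u _.
  rewrite -big_split big1 // => v _ /=.
  have := w0 u v; rewrite /w (es v) (sc v) => h.
  by rewrite -mulrDl mulrA [X in X * _]mulrC h mul0r.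
exists (velocity x) => u v euv; move: (hx (u, v)).
by rewrite sum_velocity work_bar_load /= euv !mul1r.
Qed.

(** The same duality, with the roles of force densities and velocities exchanged. *)
Lemma resolve_load e p (f : conf) : symmetric e ->
  (forall m, motion e p m -> \sum_v dot (f v) (m v) = 0) ->
  exists2 w, weighting e w & forall v, force p w v = f v.
Proof.
move=> es h.
have [x hx|x hx] := @fredholm R (V * 'I_3)%type (V * V)%type
    (fun i j => bar_load e p j i.1 0 i.2) (fun i => f i.1 0 i.2).
  have E (g : conf) : \sum_i x i * g i.1 0 i.2 = \sum_v dot (g v) (velocity x v).
    by rewrite -sum_velocity; apply: eq_bigr => i _; rewrite mulrC.
  rewrite E; apply: h => u v euv; have := hx (u, v).
  by rewrite (E (fun z => bar_load e p (u, v) z)) work_bar_load /= euv mul1r.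
exists (fun u v => (e u v)%:R * (x (u, v) + x (v, u))); first exact: bar_weighting.
move=> v; rewrite force_bar_load //; apply/rowP=> k; rewrite summxE -[RHS](hx (v, k)).
by apply: eq_bigr => i _; rewrite mxE mulrC.
Qed.

End Frameworks.

(** * Properties that hold for almost all configurations *)

Section Open.
Variables (R : realFieldType) (V : finType).
Local Notation conf := (V -> 'rV[R]_3).
Implicit Types (p : V -> 'rV[R]_3) (O : (V -> 'rV[R]_3) -> Prop).

Definition line p0 p1 t : conf := fun v => p0 v + t *: (p1 v - p0 v).

Lemma line_sym p0 p1 t : line p1 p0 (1 - t) = line p0 p1 t.
Proof. by apply: funext => v; rewrite /line; apply/rowP=> k; rewrite !vecE; ring. Qed.

Definition polyline (f : conf -> R) :=
  forall p0 p1, exists P : {poly R}, forall t, f (line p0 p1 t) = P.[t].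

Lemma polyline_const c : polyline (fun=> c).
Proof. by move=> p0 p1; exists c%:P => t; rewrite hornerC. Qed.
Lemma polyline_coord v k : polyline (fun p => p v 0 k).
Proof.
move=> p0 p1; exists ((p0 v 0 k)%:P + 'X * (p1 v 0 k - p0 v 0 k)%:P) => t.
by rewrite /line !vecE hornerD hornerC hornerM hornerX hornerC.
Qed.
Lemma polylineD f g : polyline f -> polyline g -> polyline (fun p => f p + g p).
Proof.
move=> hf hg p0 p1; have [P hP] := hf p0 p1; have [Q hQ] := hg p0 p1.
by exists (P + Q) => t; rewrite hornerD hP hQ.
Qed.
Lemma polylineM f g : polyline f -> polyline g -> polyline (fun p => f p * g p).
Proof.
move=> hf hg p0 p1; have [P hP] := hf p0 p1; have [Q hQ] := hg p0 p1.
by exists (P * Q) => t; rewrite hornerM hP hQ.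
Qed.
Lemma polylineN f : polyline f -> polyline (fun p => - f p).
Proof. by move=> hf p0 p1; have [P hP] := hf p0 p1; exists (- P) => t; rewrite hornerN hP. Qed.
Lemma polylineB f g : polyline f -> polyline g -> polyline (fun p => f p - g p).
Proof. by move=> hf hg; apply/polylineD/polylineN. Qed.
Lemma polyline_eq f g : f =1 g -> polyline f -> polyline g.
Proof. by move=> fg hf p0 p1; have [P hP] := hf p0 p1; exists P => t; rewrite -fg. Qed.

(** A weak form of Zariski openness, sufficient for general position arguments:
    the property survives at all but finitely many points of every line through
    a configuration that has it. *)
Definition zopen O := forall p0, O p0 -> forall p1,
  exists P : {poly R}, P.[0] != 0 /\ forall t, P.[t] != 0 -> O (line p0 p1 t).

Lemma zopen_true : zopen (fun=> True).
Proof. by move=> p0 _ p1; exists 1; rewrite hornerC oner_eq0. Qed.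

Lemma zopen_and O1 O2 : zopen O1 -> zopen O2 -> zopen (fun p => O1 p /\ O2 p).
Proof.
move=> h1 h2 p0 [o1 o2] p1.
have [P [P0 hP]] := h1 _ o1 p1; have [Q [Q0 hQ]] := h2 _ o2 p1.
exists (P * Q); rewrite hornerM mulf_neq0 //; split=> // t.
by rewrite hornerM mulf_eq0 negb_or => /andP[/hP ? /hQ].
Qed.

Lemma zopen_in (I : eqType) (s : seq I) (O : I -> conf -> Prop) :
  (forall i, zopen (O i)) -> zopen (fun p => forall i, i \in s -> O i p).
Proof.
move=> h; elim: s => [|i s IH] p0 hp p1.
  by exists 1; rewrite hornerC oner_eq0.
have [P [P0 hP]] := @zopen_and _ _ (h i) IH p0
  (conj (hp i (mem_head _ _)) (fun j js => hp j (mem_behead js))) p1.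
exists P; split=> // t /hP[oi os] j; rewrite inE => /predU1P[->|/os] //.
Qed.

Lemma zopen_all (I : finType) (O : I -> conf -> Prop) :
  (forall i, zopen (O i)) -> zopen (fun p => forall i, O i p).
Proof.
move=> h p0 hp p1; have [|P [P0 hP]] := zopen_in (s := enum I) h (p0 := p0) _ p1.
  by [].
by exists P; split=> // t /hP ho i; apply: ho; rewrite mem_enum.
Qed.

Lemma zopen_imply (b : Prop) O : zopen O -> zopen (fun p => b -> O p).
Proof.
move=> hO p0 hp p1; have [hb|nb] := EM b.
  by have [P [P0 hP]] := hO _ (hp hb) p1; exists P; split=> // t /hP.
by exists 1; rewrite hornerC oner_eq0.
Qed.

Lemma poly_nonroot (P : {poly R}) : P != 0 -> exists t, P.[t] != 0.
Proof.
move=> P0; pose s : seq R := [seq i%:R | i <- iota 0 (size P)].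
have [/hasP[x _ hx]|/hasPn hs] := boolP (has (fun x => ~~ root P x) s).
  by exists x.
case/eqP: P0; apply: (@roots_geq_poly_eq0 _ P s).
- by apply/allP=> x /hs; rewrite negbK.
- by rewrite map_inj_uniq ?iota_uniq // => i j /eqP; rewrite eqr_nat => /eqP.
- by rewrite size_map size_iota.
Qed.

Lemma zopen_line O1 O2 p0 p1 : zopen O1 -> zopen O2 -> O1 p0 -> O2 p1 ->
  exists t, O1 (line p0 p1 t) /\ O2 (line p0 p1 t).
Proof.
move=> h1 h2 o1 o2.
have [P [P0 hP]] := h1 _ o1 p1; have [Q [Q0 hQ]] := h2 _ o2 p0.
have [|t] := @poly_nonroot (P * (Q \Po (1 - 'X))).
  rewrite mulf_neq0 //; first by apply: contraNneq P0 => ->; rewrite horner0.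
  apply: contraNneq Q0 => /(congr1 (horner^~ 1)) /eqP.
  by rewrite horner_comp hornerD hornerN hornerC hornerX subrr horner0.
rewrite hornerM mulf_eq0 negb_or horner_comp hornerD hornerN hornerC hornerX.
by move=> /andP[/hP ht /hQ]; rewrite line_sym; exists t.
Qed.

Lemma zopen_meet O1 O2 : zopen O1 -> zopen O2 ->
  (exists p, O1 p) -> (exists p, O2 p) -> exists p, O1 p /\ O2 p.
Proof.
move=> h1 h2 [p0 o1] [p1 o2]; have [t ht] := zopen_line h1 h2 o1 o2.
by exists (line p0 p1 t).
Qed.

Lemma zopen_meet_all (I : finType) (O : I -> conf -> Prop) :
  (forall i, zopen (O i)) -> (forall i, exists p, O i p) ->
  exists p, forall i, O i p.
Proof.
move=> h ex; suff: forall s : seq I, exists p, forall i, i \in s -> O i p.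
  by move/(_ (enum I)) => [p hp]; exists p => i; apply: hp; rewrite mem_enum.
elim=> [|i s IH]; first by exists (fun=> 0).
have [p [oi os]] := zopen_meet (h i) (zopen_in (s := s) h) (ex i) IH.
by exists p => j; rewrite inE => /predU1P[->|/os] //.
Qed.

(** Let [B] be a right inverse of the matrix of the system at [p0].  On a line through
    [p0] the determinant of the matrix times [B] is a polynomial, which is one at [p0],
    and where it does not vanish the system has only the zero solution. *)
Lemma zopen_system (I J : finType) (a : I -> J -> conf -> R) :
  (forall i j, polyline (a i j)) ->
  zopen (fun p => forall w : I -> R, (forall j, \sum_i w i * a i j p = 0) ->
                  forall i, w i = 0).
Proof.
move=> ha p0 h0 p1.
have [Q hQ] := choice (fun ij : I * J => ha ij.1 ij.2 p0 p1).
pose M : 'M[{poly R}]_(#|I|, #|J|) :=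
  \matrix_(i, j) Q (enum_val i, enum_val j).
have ME t i j : map_mx (horner_eval t) M i j = a (enum_val i) (enum_val j) (line p0 p1 t).
  by rewrite !mxE /horner_eval -hQ.
have rowE t (w : 'rV[R]_#|I|) : w *m map_mx (horner_eval t) M = 0 <->
    forall j, \sum_i w 0 (enum_rank i) * a i j (line p0 p1 t) = 0.
  split=> [hw j|hw].
    have /rowP/(_ (enum_rank j)) := hw; rewrite !mxE => e; rewrite -[RHS]e.
    rewrite -sum_enum; apply: eq_bigr => i _; rewrite ME.
    by rewrite enum_valK enum_rankK.
  apply/rowP=> j; rewrite !mxE -[RHS](hw (enum_val j)) -[in RHS]sum_enum.
  by apply: eq_bigr => i _; rewrite ME enum_valK.
have line0 : line p0 p1 0 = p0.
  by apply: funext => v; rewrite /line scale0r addr0.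
have : row_free (map_mx (horner_eval 0) M).
  rewrite -kermx_eq0; apply/rowV0P => w /sub_kermxP /rowE; rewrite line0 => hw.
  apply/rowP=> k; rewrite mxE; have := h0 _ hw (enum_val k).
  by rewrite enum_valK.
move/row_freeP=> [B hB].
exists (\det (M *m map_mx polyC B)).
have detE t : (\det (M *m map_mx polyC B)).[t] =
    \det (map_mx (horner_eval t) M *m B).
  rewrite -[LHS]/(horner_eval t _) -det_map_mx map_mxM; congr (\det (_ *m _)).
  by apply/matrixP=> i j; rewrite !mxE /= horner_evalE hornerC.
split; first by rewrite detE hB det1 oner_neq0.
move=> t; rewrite detE -unitfE -unitmxE => hu w hw i.
have : (\row_k w (enum_val k)) *m map_mx (horner_eval t) M = 0.
  apply/rowE => j; rewrite -[RHS](hw j); apply: eq_bigr => l _.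
  by rewrite mxE enum_rankK.
move/(congr1 (mulmx^~ (B *m invmx (map_mx (horner_eval t) M *m B)))).
rewrite mul0mx -mulmxA (mulmxA _ B) mulmxV // mulmx1 => /rowP/(_ (enum_rank i)).
by rewrite !mxE enum_rankK.
Qed.

End Open.

Section OpenFrameworks.
Variables (R : realFieldType) (V : finType).
Local Notation conf := (V -> 'rV[R]_3).
Implicit Types (e : rel V) (p : V -> 'rV[R]_3) (w : V -> V -> R).

Lemma polyline_sub (u v : V) k : polyline (fun p : conf => (p u - p v) 0 k).
Proof.
apply: (@polyline_eq _ _ (fun p => p u 0 k - p v 0 k)).
  by move=> p; rewrite !vecE.
by apply: polylineB; apply: polyline_coord.
Qed.

Lemma polyline_cross (f g : conf -> 'rV[R]_3) k :
  (forall k, polyline (fun p => f p 0 k)) -> (forall k, polyline (fun p => g p 0 k)) ->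
  polyline (fun p => cross (f p) (g p) 0 k).
Proof.
move=> hf hg; elim/coord3: k.
- apply: (@polyline_eq _ _ (fun p => f p 0 c1 * g p 0 c2 - f p 0 c2 * g p 0 c1)).
    by move=> p; rewrite !vecE.
  by apply: polylineB; apply: polylineM.
- apply: (@polyline_eq _ _ (fun p => f p 0 c2 * g p 0 c0 - f p 0 c0 * g p 0 c2)).
    by move=> p; rewrite !vecE.
  by apply: polylineB; apply: polylineM.
- apply: (@polyline_eq _ _ (fun p => f p 0 c0 * g p 0 c1 - f p 0 c1 * g p 0 c0)).
    by move=> p; rewrite !vecE.
  by apply: polylineB; apply: polylineM.
Qed.

Lemma polyline_if (b : bool) (f : conf -> R) :
  polyline f -> polyline (fun p => if b then f p else 0).
Proof. by case: b => // _; apply: polyline_const. Qed.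

(** The symmetry and the support of a weighting are further linear equations, with
    constant coefficients. *)
Lemma zopen_weighting e (J : finType) (a : J -> V -> V -> conf -> R) :
  (forall j u v, polyline (a j u v)) ->
  zopen (fun p => forall w, weighting e w ->
    (forall j, \sum_u \sum_v w u v * a j u v p = 0) -> forall u v, w u v = 0).
Proof.
move=> ha.
pose b (i : V * V) (j : V * V + (V * V + J)) (p : conf) : R :=
  match j with
  | inl j => (i == j)%:R - (i == (j.2, j.1))%:R
  | inr (inl j) => (i == j)%:R * (~~ e j.1 j.2)%:R
  | inr (inr j) => a j i.1 i.2 p
  end.
have hb i j : polyline (b i j).
  by case: j => [j|[j|j]]; rewrite /b //; apply: polyline_const.
have delta (f : V * V -> R) j c : \sum_i f i * ((i == j)%:R * c) = f j * c.
  by rewrite -(sum_deltaM j (fun i => f i * c)); apply: eq_bigr => i _; rewrite mulrCA.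
have sys1 (w : V * V -> R) p :
    (forall j, \sum_i w i * b i j p = 0) <->
    [/\ forall u v, w (u, v) = w (v, u), forall u v, ~~ e u v -> w (u, v) = 0 &
        forall j, \sum_u \sum_v w (u, v) * a j u v p = 0].
  have s1 u v : \sum_i w i * b i (inl (u, v)) p = w (u, v) - w (v, u).
    rewrite /b /=; under eq_bigr do rewrite mulrBr.
    rewrite sumrB; congr (_ - _).
      by under eq_bigr do rewrite -(mulr1 (_ == _)%:R); rewrite delta mulr1.
    by under eq_bigr do rewrite -(mulr1 (_ == _)%:R); rewrite delta mulr1.
  have s2 u v : \sum_i w i * b i (inr (inl (u, v))) p = w (u, v) * (~~ e u v)%:R.
    by rewrite /b delta.
  have s3 j : \sum_i w i * b i (inr (inr j)) p = \sum_u \sum_v w (u, v) * a j u v p.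
    by rewrite sum_pair.
  split=> [h|[h1 h2 h3] [[u v]|[[u v]|j]]].
  - split=> [u v|u v nuv|j].
    + by apply/eqP; rewrite -subr_eq0 -s1 h.
    + by have := h (inr (inl (u, v))); rewrite s2 nuv mulr1.
    + by rewrite -s3 h.
  - by rewrite s1 h1 subrr.
  - by rewrite s2; case: (boolP (e u v)) => [|/h2 ->]; rewrite ?mulr0 ?mul0r.
  - by rewrite s3 h3.
have equiv p : (forall w, weighting e w ->
      (forall j, \sum_u \sum_v w u v * a j u v p = 0) -> forall u v, w u v = 0) <->
    (forall w : V * V -> R, (forall j, \sum_i w i * b i j p = 0) -> forall i, w i = 0).
  split=> h w.
    by move/sys1 => [h1 h2 h3] [u v]; apply: (h (fun u v => w (u, v))).
  move=> [h1 h2] h3 u v; apply: (h (fun i => w i.1 i.2) _ (u, v)).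
  by apply/sys1.
move=> p0 /equiv hp0 p1; have [P [P0 hP]] := zopen_system hb hp0 p1.
by exists P; split=> // t /hP /equiv.
Qed.

Lemma force_coord p w v k : force p w v 0 k =
  \sum_u \sum_x w u x * (if u == v then (p u - p x) 0 k else 0).
Proof.
rewrite (bigD1 v) //= eqxx [X in _ = _ + X]big1 ?addr0 => [|u /negPf ->].
  by rewrite summxE; apply: eq_bigr => u _; rewrite coordZ.
by rewrite big1 // => x _; rewrite mulr0.
Qed.

Lemma zopen_indep e : zopen (@indep R V e).
Proof.
pose a (j : V * 'I_3) u v (p : conf) := if u == j.1 then (p u - p v) 0 j.2 else 0.
have ha j u v : polyline (a j u v) by apply/polyline_if/polyline_sub.
have E p : indep e p <-> (forall w, weighting e w ->
    (forall j, \sum_u \sum_v w u v * a j u v p = 0) -> forall u v, w u v = 0).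
  split=> [h w hw hj|h w [hw hf]]; first apply: h; last apply: h => //.
    split=> // v; apply/rowP=> k; rewrite force_coord [RHS]mxE.
    by have := hj (v, k).
  by case=> v k; have := force_coord p w v k; rewrite hf mxE => <-.
move=> p0 /E hp0 p1; have [P [P0 hP]] := zopen_weighting ha hp0 p1.
by exists P; split=> // t /hP /E.
Qed.

(** ** Affine independence *)

Definition affindep p (A : {set V}) := forall c : V -> R,
  (forall u, u \notin A -> c u = 0) -> \sum_u c u = 0 -> \sum_u c u *: p u = 0 ->
  forall u, c u = 0.

(** The coefficients of the affine combinations of [A] with value [q] are the solutions
    of a linear system: one equation for their sum, three for the coordinates, and one
    for each vertex outside [A]. *)
Definition affine_row p (A : {set V}) (i : option 'I_3 + {u | u \notin A}) u : R :=
  match i with inl None => 1 | inl (Some k) => p u 0 k | inr z => (u == val z)%:R end.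
Definition affine_rhs (A : {set V}) (s : R) (q : 'rV[R]_3)
    (i : option 'I_3 + {u | u \notin A}) : R :=
  match i with inl None => s | inl (Some k) => q 0 k | inr _ => 0 end.
Arguments affine_row p A i u : clear implicits, simpl nomatch.
Arguments affine_rhs A s q i : clear implicits, simpl nomatch.

Lemma affine_rowP p A (c : V -> R) s q :
  (forall i, \sum_u affine_row p A i u * c u = affine_rhs A s q i) <->
  [/\ forall u, u \notin A -> c u = 0, \sum_u c u = s & \sum_u c u *: p u = q].
Proof.
split=> [h|[h0 h1 hp] [[k|]|z]] /=.
- split=> [u uA||].
  + by have := h (inr (Sub u uA)); rewrite /= sum_deltaM.
  + by rewrite -[RHS](h (inl None)); apply: eq_bigr => u _; rewrite mul1r.
  + apply/rowP=> k; rewrite summxE -[RHS](h (inl (Some k))).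
    by apply: eq_bigr => u _; rewrite mxE mulrC.
- by rewrite -hp summxE; apply: eq_bigr => u _; rewrite mxE mulrC.
- by rewrite -h1; apply: eq_bigr => u _; rewrite mul1r.
- by rewrite sum_deltaM h0 // (valP z).
Qed.

Lemma card_affine_rows (A : {set V}) :
  (#|{: option 'I_3 + {u | u \notin A}}| + #|A| = 4 + #|V|)%N.
Proof.
rewrite card_sum card_option card_ord card_sig -addnA; congr (4 + _)%N.
by rewrite addnC -(cardC (mem A)); congr (_ + _)%N; apply: eq_card.
Qed.

Lemma zopen_affindep A : zopen (affindep^~ A).
Proof.
pose a u j (p : conf) := affine_row p A j u.
have ha u j : polyline (a u j).
  by case: j => [[k|]|z]; [exact: polyline_coord|exact: polyline_const|exact: polyline_const].
have E p : affindep p A <->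
    (forall c : V -> R, (forall j, \sum_i c i * a i j p = 0) -> forall i, c i = 0).
  have F c : (forall j, \sum_i c i * a i j p = 0) <-> [/\ forall u, u \notin A -> c u = 0,
      \sum_u c u = 0 & \sum_u c u *: p u = 0].
    rewrite -affine_rowP; split=> h j; [have := h j|rewrite -[RHS](_ : affine_rhs A 0 0 j = 0)].
    - rewrite /a; under eq_bigr do rewrite mulrC.
      by move=> ->; case: j => [[k|]|z] //=; rewrite mxE.
    - by rewrite -h; apply: eq_bigr => u _; rewrite mulrC.
    - by case: j => [[k|]|z] //=; rewrite mxE.
  by split=> [h c /F[]|h c c0 c1 cp]; [exact: h|apply/h/F].
move=> p0 /E hp0 p1; have [P [P0 hP]] := zopen_system ha hp0 p1.
by exists P; split=> // t /hP /E.
Qed.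

Lemma sub_affindep p (A B : {set V}) : A \subset B -> affindep p B -> affindep p A.
Proof.
move=> /subsetP sAB h c c0; apply: h => u uB; apply: c0.
by apply: contra uB; apply: sAB.
Qed.

(** Force densities at [v] in equilibrium become an affine dependency of [v] and its
    neighbours when minus their sum is taken as the coefficient of [v]. *)
Lemma affindep_force p w v (A : {set V}) : v \notin A -> affindep p (v |: A) ->
  (forall u, u \notin A -> w v u = 0) -> force p w v = 0 -> forall u, w v u = 0.
Proof.
move=> vA ind w0 hf u.
pose c x := w v x - (if x == v then \sum_y w v y else 0).
have wv : w v v = 0 by apply: w0.
have hu x : c x = 0.
  apply: ind x => [x||].
  - by rewrite !inE negb_or /c => /andP[/negPf -> /w0 ->]; rewrite subr0.
  - by rewrite /c sumrB -big_mkcond big_pred1_eq subrr.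
  - rewrite /c; under eq_bigr do rewrite scalerBl.
    rewrite sumrB [X in _ - X](bigD1 v) //= eqxx.
    rewrite [X in _ - (_ + X)]big1 ?addr0 => [|x /negPf ->]; last by rewrite scale0r.
    rewrite scaler_suml -sumrB -[RHS]oppr0 -[in RHS]hf /force -sumrN.
    by apply: eq_bigr => x _; rewrite -scalerBr -scalerN opprB.
have [->//|uv] := eqVneq u v.
by have := hu u; rewrite /c (negPf uv) subr0.
Qed.

(** Barycentric coordinates exist because the system of [affine_row] is square for four
    points. *)
Lemma barycentric p (A : {set V}) q : affindep p A -> #|A| = 4%N ->
  exists c : V -> R, [/\ forall u, u \notin A -> c u = 0, \sum_u c u = 1 &
    \sum_u c u *: p u = q].
Proof.
move=> ind cA; have cV := card_affine_rows A.
have [||c /affine_rowP hc] := @square_solvable R _ _ (affine_row p A) (affine_rhs A 1 q).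
- by move: cV; rewrite cA addnC => /addnI.
- move=> c h; have /affine_rowP[c0 c1 cp] :
      forall i, \sum_u affine_row p A i u * c u = affine_rhs A 0 0 i.
    by move=> i; rewrite h; case: i => [[k|]|z] //=; rewrite mxE.
  exact: ind.
- by exists c.
Qed.

Lemma affine_dependency p (A : {set V}) : (4 < #|A|)%N -> exists c : V -> R,
  [/\ forall u, u \notin A -> c u = 0, \sum_u c u = 0, \sum_u c u *: p u = 0 &
    exists u, c u != 0].
Proof.
move=> cA; have [|c [hc hn]] := @nontrivial_solution R _ _ (affine_row p A).
  by rewrite -(ltn_add2r #|A|) card_affine_rows addnC ltn_add2l.
have /affine_rowP[c0 c1 cp] : forall i, \sum_u affine_row p A i u * c u = affine_rhs A 0 0 i.
  by move=> i; rewrite hc; case: i => [[k|]|z] //=; rewrite mxE.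
by exists c.
Qed.

Lemma orthogonal_spanning p (A : {set V}) a x : affindep p A -> #|A| = 4%N ->
  (forall b, b \in A -> dot (p b - p a) x = 0) -> x = 0.
Proof.
move=> ind cA h; have [c [cA0 c1 cq]] := barycentric (p a + x) ind cA.
apply: dot_eq0.
have {1}-> : x = \sum_u c u *: (p u - p a).
  under eq_bigr do rewrite scalerBr.
  by rewrite sumrB -scaler_suml c1 cq scale1r addrAC subrr add0r.
rewrite dot_suml big1 // => u _; rewrite dotZl.
by have [/h ->|/cA0 ->] := boolP (u \in A); rewrite ?mulr0 ?mul0r.
Qed.

Definition generalpos p := forall A : {set V}, (#|A| <= 4)%N -> affindep p A.

Lemma zopen_generalpos : zopen generalpos.
Proof. by apply: zopen_all => A; apply/zopen_imply/zopen_affindep. Qed.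

(** General position can be reached because it can be reached for each set separately:
    its points are placed at the vertices of a simplex, the first at the origin and the
    next ones at the unit vectors. *)
Lemma generalpos_exists : exists p, generalpos p.
Proof.
apply: zopen_meet_all => A; first by apply/zopen_imply/zopen_affindep.
pose pos v := index v (enum A).
exists (fun v => \row_k (pos v == k.+1)%:R) => cA c c0 c1 cp u.
have [uA|/c0 //] := boolP (u \in A).
have inj x : x \in A -> pos x = pos u -> x = u.
  by move=> xA h; rewrite -[x](nth_index u (s := enum A)) ?mem_enum // -/(pos x) h nth_index ?mem_enum.
have zero x (k : 'I_3) : x \in A -> pos x = k.+1 -> c x = 0.
  move=> xA xk; have /rowP/(_ k) := cp; rewrite summxE mxE (bigD1 x) //= !mxE xk eqxx mulr1.
  rewrite big1 ?addr0 // => y yx; rewrite !mxE; have [yA|/c0 ->] := boolP (y \in A).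
    case: eqP => [yk|_]; last by rewrite mulr0.
    case/eqP: yx; rewrite -[y](nth_index u (s := enum A)) ?mem_enum // -/(pos y) yk -xk.
    by rewrite nth_index ?mem_enum.
  by rewrite mul0r.
have pos4 x : x \in A -> (pos x < 4)%N.
  by move=> xA; apply: leq_trans cA; rewrite cardE index_mem mem_enum.
case E : (pos u) => [|k]; last first.
  by have := pos4 u uA; rewrite E ltnS => k3; apply: (zero u (Ordinal k3)).
move: c1; rewrite (bigD1 u) //= big1 ?addr0 // => x xu.
have [xA|/c0 //] := boolP (x \in A); case E' : (pos x) => [|k].
  by case/eqP: xu; apply: inj; rewrite // E E'.
by have := pos4 x xA; rewrite E' ltnS => k3; apply: (zero x (Ordinal k3)).
Qed.

End OpenFrameworks.

(** * Extensions and rigid bodies *)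

Section GraphOperations.
Variable V : finType.
Implicit Types (e : rel V) (X : {set V}).

Definition delset X e : rel V :=
  fun x y => [&& e x y, x \notin X & y \notin X].
Definition addedge a b e : rel V :=
  fun x y => [|| e x y, (x == a) && (y == b) | (x == b) && (y == a)].
Definition inner X e : rel V := fun x y => [&& e x y, x \in X & y \in X].
Definition bars X e : rel V :=
  fun x y => e x y && ~~ ((x \in X) && (y \in X)).

Definition deledge a b e : rel V :=
  fun x y => e x y && ~~ ((x == a) && (y == b) || (x == b) && (y == a)).

Arguments delset X e x y /.
Arguments deledge a b e x y /.
Arguments addedge a b e x y /.
Arguments inner X e x y /.
Arguments bars X e x y /.

Lemma delset_sym X e : symmetric e -> symmetric (delset X e).
Proof. by move=> h x y /=; rewrite h (andbC (_ \notin _)). Qed.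
Lemma delset_irr X e : irreflexive e -> irreflexive (delset X e).
Proof. by move=> h x /=; rewrite h. Qed.
Lemma addedge_sym a b e : symmetric e -> symmetric (addedge a b e).
Proof. by move=> h x y /=; rewrite h orbC orbC; congr orb; rewrite orbC andbC [X in _ || X]andbC. Qed.
Lemma addedge_irr a b e : a != b -> irreflexive e -> irreflexive (addedge a b e).
Proof.
move=> ab h x /=; rewrite h /=; apply/norP; split; apply: contraNN ab.
  by move=> /andP[/eqP <- /eqP <-].
by move=> /andP[/eqP <- /eqP <-].
Qed.
Lemma inner_sym X e : symmetric e -> symmetric (inner X e).
Proof. by move=> h x y /=; rewrite h (andbC (_ \in _)). Qed.
Lemma inner_irr X e : irreflexive e -> irreflexive (inner X e).
Proof. by move=> h x /=; rewrite h. Qed.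

End GraphOperations.
Arguments delset {V} X e x y /.
Arguments deledge {V} a b e x y /.
Arguments addedge {V} a b e x y /.
Arguments inner {V} X e x y /.
Arguments bars {V} X e x y /.

Section Extensions.
Variables (R : realFieldType) (V : finType).
Local Notation conf := (V -> 'rV[R]_3).
Implicit Types (e : rel V) (p m : V -> 'rV[R]_3) (w : V -> V -> R) (X : {set V}).

Definition update p v x : conf := fun u => if u == v then x else p u.

Lemma indep_delset e p v : symmetric e -> indep (delset [set v] e) p ->
  (forall w, stress e p w -> forall u, w v u = 0) -> indep e p.
Proof.
move=> es ind h w hw u x; have wv := h w hw; case: hw => [[sw w0] hf].
apply: ind; split=> //; split=> // y z; rewrite /= !inE => nyz.
apply/eqP; apply: contraNT nyz => wyz; apply/and3P; split.
- by apply: contraNT wyz => /w0 ->.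
- by apply: contraNneq wyz => ->; rewrite wv.
- by apply: contraNneq wyz => ->; rewrite sw wv.
Qed.

(** A vertex with at most three neighbours, in general position with them, carries no
    stress. *)
Lemma extension0 e v : symmetric e -> irreflexive e ->
  (#|[set u | e v u]| <= 3)%N -> (exists p, @indep R V (delset [set v] e) p) ->
  exists p, @indep R V e p.
Proof.
move=> es eirr hd hex.
have [p [ind gp]] := zopen_meet (@zopen_indep R V _) (@zopen_generalpos R V)
  hex (@generalpos_exists R V).
exists p; apply: indep_delset ind _ => // w [[sw w0] hf].
have vA : v \notin [set u | e v u] by rewrite inE eirr.
apply: (@affindep_force R V p w v _ vA) => //; last by move=> u; rewrite inE => /w0.
by apply: gp; rewrite cardsU1 vA.
Qed.

(** ** Rigid bodies *)

Lemma force_sum p w : (forall u v, w u v = w v u) -> \sum_v force p w v = 0.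
Proof.
move=> sw; suff h : \sum_v force p w v = - \sum_v force p w v.
  apply/rowP=> k; have /rowP/(_ k) := h; rewrite !vecE => ?; lra.
rewrite /force [LHS]exchange_big /= -sumrN; apply: eq_bigr => v _.
rewrite -sumrN; apply: eq_bigr => u _.
by rewrite sw -scalerN opprB.
Qed.

Lemma moment_sum p w : (forall u v, w u v = w v u) ->
  \sum_v cross (p v) (force p w v) = 0.
Proof.
move=> sw; suff h : \sum_v cross (p v) (force p w v) = - \sum_v cross (p v) (force p w v).
  apply/rowP=> k; have /rowP/(_ k) := h; rewrite !vecE => ?; lra.
have E v : cross (p v) (force p w v) = \sum_u w v u *: - cross (p v) (p u).
  rewrite /force cross_sumr; apply: eq_bigr => u _.
  by rewrite crossZr crossBr crossvv sub0r.
under eq_bigr do rewrite E.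
rewrite [LHS]exchange_big /= -sumrN; apply: eq_bigr => v _.
rewrite -sumrN; apply: eq_bigr => u _.
by rewrite sw -scalerN opprK (crossC (p u)) opprK.
Qed.

(** The bars that meet a body [X] or avoid it are independent when [X] is
    replaced by a rigid body: a weighting of these bars vanishes if it is in
    equilibrium at every vertex outside [X] and has zero resultant force and
    moment on [X].  Only the positions of the end points of the bars matter, so
    the points of the body may coincide. *)
Definition bodyindep X e p := forall w, weighting (bars X e) w ->
  (forall y, y \notin X -> force p w y = 0) ->
  \sum_(v in X) force p w v = 0 -> \sum_(v in X) cross (p v) (force p w v) = 0 ->
  forall u v, w u v = 0.

Lemma zopen_bodyindep X e : zopen (bodyindep X e).
Proof.
pose a (j : V * 'I_3 + ('I_3 + 'I_3)) u x (p : conf) : R := match j with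
  | inl (v, k) => if (u == v) && (v \notin X) then (p u - p x) 0 k else 0
  | inr (inl k) => if u \in X then (p u - p x) 0 k else 0
  | inr (inr k) => if u \in X then cross (p u) (p u - p x) 0 k else 0
  end.
have ha j u x : polyline (a j u x).
  case: j => [[v k]|[k|k]]; rewrite /a; apply: polyline_if; try exact: polyline_sub.
  by apply: polyline_cross => l; [exact: polyline_coord|exact: polyline_sub].
have s1 p w v k : \sum_u \sum_x w u x * a (inl (v, k)) u x p =
    if v \notin X then force p w v 0 k else 0.
  rewrite /a; case: ifP => vX; last first.
    by rewrite big1 // => u _; rewrite big1 // => x _; rewrite andbF mulr0.
  by rewrite force_coord; apply: eq_bigr => u _; apply: eq_bigr => x _; rewrite andbT.
have s2 p w k : \sum_u \sum_x w u x * a (inr (inl k)) u x p =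
    (\sum_(v in X) force p w v) 0 k.
  rewrite summxE [in RHS]big_mkcond; apply: eq_bigr => u _; rewrite /a; case: ifP => uX.
    by rewrite summxE; apply: eq_bigr => x _; rewrite coordZ.
  by rewrite big1 // => x _; rewrite mulr0.
have s3 p w k : \sum_u \sum_x w u x * a (inr (inr k)) u x p =
    (\sum_(v in X) cross (p v) (force p w v)) 0 k.
  rewrite summxE [in RHS]big_mkcond; apply: eq_bigr => u _; rewrite /a; case: ifP => uX.
    rewrite cross_sumr summxE; apply: eq_bigr => x _.
    by rewrite crossZr [in RHS]mxE.
  by rewrite big1 // => x _; rewrite mulr0.
have E p : bodyindep X e p <-> (forall w, weighting (bars X e) w ->
    (forall j, \sum_u \sum_v w u v * a j u v p = 0) -> forall u v, w u v = 0).
  split=> [h w hw hj|h w hw h1 h2 h3]; last first.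
    apply: (h _ hw) => -[[v k]|[k|k]]; rewrite ?s1 ?s2 ?s3 ?h2 ?h3 ?mxE //.
    by case: ifP => // /h1 ->; rewrite mxE.
  apply: (h _ hw).
  - by move=> y yX; apply/rowP=> k; rewrite mxE -[RHS](hj (inl (y, k))) s1 yX.
  - by apply/rowP=> k; rewrite mxE -[RHS](hj (inr (inl k))) s2.
  - by apply/rowP=> k; rewrite mxE -[RHS](hj (inr (inr k))) s3.
move=> p0 /E hp0 p1; have [P [P0 hP]] := zopen_weighting ha hp0 p1.
by exists P; split=> // t /hP /E.
Qed.

(** The forces which the inner bars of [X] exert on its vertices have no resultant and
    no moment, so the other bars satisfy the equations of [bodyindep]. *)
Lemma body_glue X e p : bodyindep X e p -> indep (inner X e) p -> indep e p.
Proof.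
move=> hb hi w [[sw w0] hf].
pose wi u v := if (u \in X) && (v \in X) then w u v else 0.
pose wb u v := if (u \in X) && (v \in X) then 0 else w u v.
have wi_sym u v : wi u v = wi v u by rewrite /wi andbC sw.
have wE u v : w u v = wb u v + wi u v.
  by rewrite /wi /wb; case: ifP; rewrite ?add0r ?addr0.
have fE v : force p wb v = - force p wi v.
  apply/eqP; rewrite -addr_eq0 -[X in _ == X](hf v) /force -big_split /=.
  by apply/eqP; apply: eq_bigr => u _; rewrite wE scalerDl.
have fi0 v : v \notin X -> force p wi v = 0.
  by move=> /negPf vX; rewrite /force big1 // => u _; rewrite /wi vX scale0r.
have wb0 : forall u v, wb u v = 0.
  apply: hb.
  - split=> [u v|u v]; first by rewrite /wb andbC sw.
    by rewrite /= /wb negb_and negbK => /orP[/w0 ->|->] //; case: ifP.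
  - by move=> y yX; rewrite fE fi0 ?oppr0.
  - under eq_bigr do rewrite fE.
    rewrite sumrN; apply/eqP; rewrite oppr_eq0; apply/eqP.
    rewrite big_mkcond -[RHS](force_sum p wi_sym).
    by apply: eq_bigr => v _; case: ifP => // /negbT /fi0.
  - under eq_bigr do rewrite fE crossNr.
    rewrite sumrN; apply/eqP; rewrite oppr_eq0; apply/eqP.
    rewrite big_mkcond -[RHS](moment_sum p wi_sym).
    by apply: eq_bigr => v _; case: ifP => // /negbT /fi0 ->; rewrite cross0r.
have wi0 : forall u v, wi u v = 0.
  apply: hi; split; first split=> //.
  - move=> u v; rewrite /= /wi; case: (boolP (e u v)) => /= [_ /negPf -> //|nuv _].
    by case: ifP => // _; apply: w0.
  - move=> v; rewrite -[LHS]opprK -fE /force big1 ?oppr0 // => u _.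
    by rewrite wb0 scale0r.
by move=> u v; rewrite wE wb0 wi0 addr0.
Qed.

Lemma cross_affindep p a b d : affindep p [set a; b; d] ->
  a != b -> a != d -> b != d -> cross (p b - p a) (p d - p a) != 0.
Proof.
move=> ind ab ad bd.
have lin (x y : R) : x *: (p b - p a) + y *: (p d - p a) = 0 -> x = 0 /\ y = 0.
  move=> h.
  pose c u := if u == a then - (x + y) else if u == b then x else if u == d then y else 0.
  have S (W : nmodType) (f : V -> W) : (forall u, u \notin [set a; b; d] -> f u = 0) ->
      \sum_u f u = f a + f b + f d.
    move=> f0; rewrite (bigD1 a) //= (bigD1 b) 1?eq_sym //= (bigD1 d) /=; last first.
      by rewrite !(eq_sym d) ad bd.
    rewrite big1 ?addr0 ?addrA // => u /andP[/andP[ua ub] ud]; apply: f0.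
    by rewrite !inE !negb_or ua ub.
  have cout u : u \notin [set a; b; d] -> c u = 0.
    by rewrite !inE !negb_or /c => /andP[/andP[/negPf -> /negPf ->] /negPf ->].
  have ca : c a = - (x + y) by rewrite /c eqxx.
  have cb : c b = x by rewrite /c eq_sym (negPf ab) eqxx.
  have cd : c d = y by rewrite /c !(eq_sym d) (negPf ad) (negPf bd) eqxx.
  have c0 : forall u, c u = 0.
    apply: ind => //; first by rewrite S // ca cb cd; ring.
    rewrite S => [|u /cout ->]; last by rewrite scale0r.
    rewrite ca cb cd -[RHS]h; apply/rowP=> k; rewrite !vecE; ring.
  by rewrite -cb -cd !c0.
apply/eqP => hc.
have dblcross (u v : 'rV[R]_3) : (dot u v) *: u - (dot u u) *: v = cross u (cross u v).
  by vec3.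
have [|_ /eqP] := lin (dot (p b - p a) (p d - p a)) (- dot (p b - p a) (p b - p a)).
  by rewrite scaleNr dblcross hc cross0r.
rewrite oppr_eq0 => /eqP /dot_eq0 u0.
have [|/eqP] := lin 1 0; first by rewrite u0 scaler0 scale0r addr0.
by rewrite oner_eq0.
Qed.

Lemma rigid_triangle p m a b d : affindep p [set a; b; d] ->
  a != b -> a != d -> b != d ->
  strain p m a b = 0 -> strain p m a d = 0 -> strain p m b d = 0 ->
  exists c t, forall v, v \in [set a; b; d] -> m v = rigid_field c t (p v).
Proof.
move=> ind ab ad bd sab sad sbd.
have [||||t [ta tb]] := @triangle_rigid R (p b - p a) (p d - p a) (m b - m a) (m d - m a).
- exact: cross_affindep.
- by rewrite -/(strain p m b a) strainC.
- by rewrite -/(strain p m d a) strainC.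
- rewrite (_ : p b - p a - _ = p b - p d) 1?(_ : m b - m a - _ = m b - m d) //.
    by rewrite opprB addrA subrK.
  by rewrite opprB addrA subrK.
exists (m a - cross t (p a)), t => v; rewrite !inE /rigid_field => /orP[/orP[]|] /eqP ->.
- by rewrite subrK.
- by rewrite addrAC -addrA -crossBr ta addrC subrK.
- by rewrite addrAC -addrA -crossBr tb addrC subrK.
Qed.

(** The rigid motion of three of the points is also that of the fourth: the difference
    of the two velocities of the fourth point is orthogonal to the three edges there. *)
Lemma rigid_tetrahedron p m (A : {set V}) : affindep p A -> #|A| = 4%N ->
  (forall u v, u \in A -> v \in A -> u != v -> strain p m u v = 0) ->
  exists c t, forall v, v \in A -> m v = rigid_field c t (p v).
Proof.
move=> ind cA h.
have /card_gt0P[f fA] : (0 < #|A|)%N by rewrite cA.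
have cAf : #|A :\ f| = 3%N by move: cA; rewrite (cardsD1 f) fA => -[].
have /card_gt0P[a aA] : (0 < #|A :\ f|)%N by rewrite cAf.
have cAa : #|(A :\ f) :\ a| = 2%N by move: cAf; rewrite (cardsD1 a) aA => -[].
have /cards2P[b [d [bd E]]] := introT eqP cAa.
have bA : b \in (A :\ f) :\ a by rewrite E !inE eqxx.
have dA : d \in (A :\ f) :\ a by rewrite E !inE eqxx orbT.
move: (aA) (bA) (dA); rewrite !inE.
move=> /andP[af aA'] /and3P[ba bf bA'] /and3P[da df dA'].
have Af : A :\ f = [set a; b; d] by rewrite -(setD1K aA) E setUA.
have ab : a != b by rewrite eq_sym.
have ad : a != d by rewrite eq_sym.
have indA : affindep p [set a; b; d].
  by rewrite -Af; apply: sub_affindep ind; apply: subD1set.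
have [c [t ct]] := rigid_triangle indA ab ad bd
  (h a b aA' bA' ab) (h a d aA' dA' ad) (h b d bA' dA' bd).
exists c, t => v vA; have [->|vf] := eqVneq v f; last first.
  by apply: ct; rewrite -Af !inE vf.
apply/eqP; rewrite -subr_eq0; apply/eqP.
apply: (orthogonal_spanning (a := f) ind cA) => x xA.
have [->|xf] := eqVneq x f; first by rewrite subrr dot0l.
have mx : m x = rigid_field c t (p x) by apply: ct; rewrite -Af !inE xf.
have h1 := h x f xA fA xf; have h2 := rigid_strain c t (p x) (p f).
move: h1; rewrite /strain mx => h1.
have -> : m f - rigid_field c t (p f) = (rigid_field c t (p x)
    - rigid_field c t (p f)) - (rigid_field c t (p x) - m f).
  by apply/rowP=> k; rewrite !vecE; ring.
by rewrite dotBr h1 h2 subrr.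
Qed.

(** Replacing the body [X] by a tetrahedron on [A]: the end points of the bars in
    [X] are moved by [phi] to points of [A], where several may come together.
    Independence of the bars with the new body is passed back to the old one:
    bars with densities [w] on the old body are taken as strains of the new framework,
    a motion with these strains moves the tetrahedron rigidly, and for the motion of
    the old framework with the same rigid motion of its body the virtual work is the
    sum of the squares of [w]. *)
Lemma body_substitution X (A : {set V}) (phi : V -> V) e e' p :
  symmetric e -> symmetric e' -> A \subset X -> #|A| = 4%N -> affindep p A ->
  (forall v, v \notin X -> phi v = v) ->
  (forall u v, u \in A -> v \in A -> u != v -> e' u v) ->
  (forall x y, x \notin X -> y \notin X -> e x y -> e' x y) ->
  (forall v y, v \in X -> y \notin X -> e v y -> phi v \in A /\ e' (phi v) y) ->
  (forall v v' y, v \in X -> v' \in X -> y \notin X -> e v y -> e v' y ->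
     phi v = phi v' -> v = v') ->
  indep e' p -> bodyindep X e (fun v => p (phi v)).
Proof.
move=> es es' AX cA indA phiout cliq out barsto inj ind w [sw w0] hout hF hM.
pose q := (fun v => p (phi v)).
have wX u v : u \in X -> v \in X -> w u v = 0.
  by move=> uX vX; rewrite w0 //= uX vX andbF.
have we u v : w u v != 0 -> e u v.
  by move=> wuv; apply: contraNT wuv => nuv; rewrite w0 //= (negPf nuv).
pose up x y := \sum_(v | (v \in X) && (phi v == x)) w v y.
pose c' x y := match x \in X, y \in X with
  | true, true => 0 | true, false => up x y
  | false, true => up y x | false, false => w x y end.
have c'sym x y : c' x y = c' y x.
  by rewrite /c'; case: (x \in X); case: (y \in X).
have [m hm] := indep_strain es' ind c'sym.
have AinX v : v \in A -> v \in X by move=> vA; apply: (subsetP AX).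
have [|c [t mrig]] := rigid_tetrahedron (m := m) indA cA.
  by move=> u v uA vA uv; rewrite hm ?cliq // /c' !AinX.
pose m' v := if v \in X then rigid_field c t (p (phi v)) else m v.
have vw := @virtual_work R V q w m' sw.
have work0 : \sum_v dot (force q w v) (m' v) = 0.
  rewrite (bigID (mem X)) /= [X in _ + X]big1 ?addr0 => [|v vX]; last first.
    by rewrite hout // dot0l.
  transitivity (\sum_(v in X) (dot (force q w v) c + dot t (cross (q v) (force q w v)))).
    apply: eq_bigr => v vX; rewrite /m' vX /rigid_field dotDr; congr (_ + _).
    by rewrite dot_cross_cycle dot_cross_cycle.
  by rewrite big_split /= -dot_suml -dot_sumr hF hM dot0l dot0r addr0.
have term v u : w v u * strain q m' v u = w v u ^+ 2.
  have [->|wvu] := eqVneq (w v u) 0; first by rewrite mul0r expr0n.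
  have evu := we _ _ wvu; rewrite expr2; congr (_ * _).
  have side x y : x \in X -> y \notin X -> w x y != 0 -> strain q m' x y = w x y.
    move=> xX yX wxy; have [pA e'xy] := barsto _ _ xX yX (we _ _ wxy).
    rewrite /strain /m' xX (negPf yX) /q -(mrig _ pA) (phiout y) //.
    rewrite -/(strain p m (phi x) y) (hm _ _ e'xy) /c' (AinX _ pA) (negPf yX) /up.
    rewrite (bigD1 x) ?xX ?eqxx //= big1 ?addr0 // => z /andP[/andP[zX /eqP pz] zx].
    apply/eqP; apply: contraNT zx => wzy; apply/eqP.
    exact: (inj z x y zX xX yX (we _ _ wzy) (we _ _ wxy) pz).
  case: (boolP (v \in X)) => vX; case: (boolP (u \in X)) => uX.
  - by rewrite wX ?eqxx in wvu.
  - exact: side.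
  - by rewrite strainC side // 1?sw // -sw.
  - rewrite /strain /m' (negPf vX) (negPf uX) /q !phiout // -/(strain p m v u).
    by rewrite hm ?out // /c' (negPf vX) (negPf uX).
move: vw; rewrite work0 mulr0 => /esym /psumr_eq0P h v u.
have {}h : forall v, \sum_u w v u ^+ 2 = 0.
  move=> x; have := h _ x isT; under eq_bigr do rewrite term; apply.
  by move=> y _; apply: sumr_ge0 => z _; rewrite term sqr_ge0.
have /psumr_eq0P := h v => /(_ (fun u _ => sqr_ge0 (w v u)) u isT) /eqP.
by rewrite sqrf_eq0 => /eqP.
Qed.

End Extensions.

(** * Stresses at a vertex *)

Section Vertices.
Variables (R : realFieldType) (V : finType).
Local Notation conf := (V -> 'rV[R]_3).
Implicit Types (e : rel V) (p m : V -> 'rV[R]_3) (w : V -> V -> R).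

Lemma zopen_pull (O : conf -> Prop) (g : conf -> conf) :
  (forall p0 p1 t, g (line p0 p1 t) = line (g p0) (g p1) t) -> zopen O ->
  zopen (fun p => O (g p)).
Proof.
move=> hg hO p0 o0 p1; have [P [P0 hP]] := hO _ o0 (g p1).
by exists P; split=> // t; rewrite hg; apply: hP.
Qed.

(** On the line from a point of [O] to [p] the polynomial [f] has infinitely many
    zeros. *)
Lemma zopen_closed (O : conf -> Prop) (f : conf -> R) p0 :
  zopen O -> polyline f -> O p0 -> (forall p, O p -> f p = 0) -> forall p, f p = 0.
Proof.
move=> hO hf o0 h p; have [P [P0 hP]] := hO _ o0 p; have [Q hQ] := hf p0 p.
have : P * Q = 0.
  apply/eqP; apply: contraT => /poly_nonroot[t].
  rewrite hornerM mulf_eq0 negb_or => /andP[Pt].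
  by rewrite -hQ h ?eqxx //; apply: hP.
move/eqP; rewrite mulf_eq0 => /orP[/eqP PE|/eqP QE].
  by rewrite PE horner0 eqxx in P0.
have -> : p = line p0 p 1 by apply: funext => v; rewrite /line scale1r addrC subrK.
by rewrite hQ QE horner0.
Qed.

(** Virtual work in a motion of the rest: only the bars at [v] contribute, and the
    velocity of [v] drops out because the forces at [v] are in equilibrium. *)
Lemma vertex_work e v p q w m : irreflexive e -> stress e (update p v q) w ->
  motion (delset [set v] e) p m -> \sum_u w v u * dot (p u - q) (m u) = 0.
Proof.
move=> ei hw hm; have := virtual_work0 m hw.
have [[sw w0] hf] := hw.
have wvv : w v v = 0 by rewrite w0 ?ei.
have st x y : x != v -> y != v -> w x y * strain (update p v q) m x y = 0.
  move=> xv yv; have [exy|/w0 ->] := boolP (e x y); last by rewrite mul0r.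
  rewrite /strain /update (negPf xv) (negPf yv) -/(strain p m x y) hm ?mulr0 //.
  by rewrite /= exy !inE xv yv.
have sv x : x != v -> strain (update p v q) m v x = dot (q - p x) (m v - m x).
  by move=> xv; rewrite /strain /update eqxx (negPf xv).
rewrite (bigD1 v) //= [X in _ + X = 0](eq_bigr (fun x =>
    w v x * strain (update p v q) m v x)); last first.
  move=> x xv; rewrite (bigD1 v) //= big1 ?addr0 ?(sw x) 1?strainC // => y yv.
  exact: st.
rewrite (bigD1 v) //= wvv mul0r add0r => h2.
have h1 : \sum_(x | x != v) w v x * strain (update p v q) m v x = 0 by lra.
have hfv : \sum_(x | x != v) w v x *: (q - p x) = 0.
  have := hf v; rewrite /force (bigD1 v) //= wvv scale0r add0r => h.
  rewrite -[RHS]h; apply: eq_bigr => x xv.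
  by rewrite /update eqxx (negPf xv).
rewrite (bigD1 v) //= wvv mul0r add0r -[RHS]h1.
have h3 : \sum_(x | x != v) w v x * dot (q - p x) (m v) = 0.
  transitivity (dot (\sum_(x | x != v) w v x *: (q - p x)) (m v)).
    by rewrite dot_suml; apply: eq_bigr => x _; rewrite dotZl.
  by rewrite hfv dot0l.
transitivity (\sum_(x | x != v) w v x * dot (q - p x) (m v) +
    \sum_(x | x != v) w v x * dot (p x - q) (m x)); first by rewrite h3 add0r.
rewrite -big_split; apply: eq_bigr => x xv /=.
by rewrite sv // dotBr mulrBr -(opprB q) dotNl mulrN.
Qed.

Lemma indep_update e p v q :
  indep (delset [set v] e) p -> indep (delset [set v] e) (update p v q).
Proof.
move=> indH w [[sw w0] hf]; have wv x y : x = v \/ y = v -> w x y = 0.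
  by move=> h; apply: w0; rewrite /= !inE; case: h => ->; rewrite eqxx ?andbF.
apply: indH; split=> // y; have [->|yv] := eqVneq y v.
  by rewrite /force big1 // => x _; rewrite wv ?scale0r //; left.
rewrite -[RHS](hf y); apply: eq_bigr => x _; rewrite /update (negPf yv).
by case: eqP => // ->; rewrite wv ?scale0r //; right.
Qed.

(** A stress without bars at [v] would be a stress of the rest. *)
Lemma star_stress e v p q : symmetric e -> indep (delset [set v] e) p ->
  ~ indep e (update p v q) ->
  exists2 w, stress e (update p v q) w & exists x, w v x != 0.
Proof.
move=> es indH dep; apply: contrapT => none; apply: dep.
apply: (indep_delset (v := v) es) => [|w hw x]; first exact: indep_update.
apply/eqP; apply: contra_notT none => wx; exists w => //.
by exists x.
Qed.

(** The bars at [v] load their end points; the rest resolves this load because it does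
    no work in the motions of the rest. *)
Lemma extend_stress e v p q (k : V -> R) : symmetric e -> irreflexive e ->
  (forall u, ~~ e v u -> k u = 0) -> \sum_u k u *: (q - p u) = 0 ->
  (forall m, motion (delset [set v] e) p m -> \sum_u k u * dot (p u - q) (m u) = 0) ->
  exists2 w, stress e (update p v q) w & forall u, w v u = k u.
Proof.
move=> es ei kout kq hwork; set H := delset [set v] e in hwork.
have Hs : symmetric H by apply: delset_sym.
have [|w0 [wsym wsup] hw0] := @resolve_load R V H p (fun u => k u *: (p u - q)) Hs.
  by move=> m /hwork h; rewrite -[RHS]h; apply: eq_bigr => x _; rewrite dotZl.
have kv : k v = 0 by apply: kout; rewrite ei.
pose w x y := if x == v then k y else if y == v then k x else - w0 x y.
have w0v x : w0 x v = 0 by apply: wsup; rewrite /H /= !inE eqxx !andbF.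
exists w; last by move=> u; rewrite /w eqxx.
split; first split.
- move=> x y; rewrite /w; have [xv|xv] := eqVneq x v; have [yv|yv] := eqVneq y v.
  + by rewrite xv yv.
  + by [].
  + by [].
  + by rewrite wsym.
- move=> x y nxy; rewrite /w.
  have [xv|xv] := eqVneq x v; first by rewrite kout // -xv.
  have [yv|yv] := eqVneq y v; first by rewrite kout // -yv es.
  by rewrite wsup ?oppr0 // /H /= (negPf nxy).
- move=> x; have [->|xv] := eqVneq x v.
    rewrite /force /w eqxx -[RHS]kq; apply: eq_bigr => u _.
    by rewrite /update eqxx; case: eqP => // ->; rewrite kv !scale0r.
  rewrite /force (bigD1 v) //= /w (negPf xv) eqxx /update eqxx (negPf xv).
  rewrite -(hw0 x) /force [X in X + _](bigD1 v) //= w0v scale0r add0r.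
  by rewrite -big_split big1 // => y yv; rewrite /= (negPf yv) scaleNr subrr.
Qed.

Lemma update_id p v : update p v (p v) = p.
Proof. by apply: funext => u; rewrite /update; case: eqP => // ->. Qed.

Definition pairing (a b x y : V) : R :=
  ((x == a) && (y == b) || (x == b) && (y == a))%:R.

Lemma pairingxx a b : pairing a b a b = 1.
Proof. by rewrite /pairing !eqxx. Qed.

Lemma unit_strain (H G : rel V) p a b : symmetric H -> symmetric G ->
  (forall x y, H x y -> G x y) -> indep G p -> ~~ H a b ->
  exists2 m, motion H p m & forall x y, G x y -> strain p m x y = pairing a b x y.
Proof.
move=> Hs Gs HG ind nab; have [u v|m hm] := indep_strain (c := pairing a b) Gs ind.
  by rewrite /pairing orbC andbC (andbC (u == a)).
exists m => // x y Hxy; rewrite hm ?HG // /pairing; case: orP => // -[] /andP[/eqP hx /eqP hy].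
  by rewrite -hx -hy Hxy in nab.
by rewrite -hx -hy Hs Hxy in nab.
Qed.

(** ** Vertices with four neighbours *)

(** The vertex [v] is placed at the midpoint of two of its four neighbours, [a] and [b].
    In general position a stress at [v] then has equal densities on [va] and [vb] and
    vanishes on the other bars.  It does work in a motion of the rest that changes only
    the distance of [a] and [b], so that it is zero. *)
Lemma extension1 e v a b : symmetric e -> irreflexive e ->
  (#|[set u | e v u]| <= 4)%N -> e v a -> e v b -> a != b -> ~~ e a b ->
  (exists p, @indep R V (addedge a b (delset [set v] e)) p) ->
  exists p, @indep R V e p.
Proof.
move=> es ei hd eva evb ab neab hex.
have [p [ind gp]] := zopen_meet (@zopen_indep R V _) (@zopen_generalpos R V)
  hex (@generalpos_exists R V).
set H := delset [set v] e in ind; pose q := 2^-1 *: (p a + p b).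
have Hs : symmetric H by apply: delset_sym.
have HG x y : H x y -> addedge a b H x y by move=> Hxy; apply/orP; left.
have indH := sub_indep HG ind.
exists (update p v q); apply: (indep_delset (v := v) es) => [|w hw].
  exact: indep_update.
have [[sw w0] hf] := hw; pose sg := \sum_u w v u.
have wE u : w v u = sg / 2 * ((u == a)%:R + (u == b)%:R).
  apply/eqP; rewrite -subr_eq0; apply/eqP; move: u; apply: (gp _ hd).
  - move=> u; rewrite inE => nvu; rewrite w0 //.
    have -> : (u == a) = false by apply: contraNF nvu => /eqP ->.
    have -> : (u == b) = false by apply: contraNF nvu => /eqP ->.
    by rewrite addr0 mulr0 subr0.
  - by rewrite sumrB -mulr_sumr big_split /= !sum_delta1 -/sg; field.
  - under eq_bigr do rewrite scalerBl -scalerA scalerDl.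
    rewrite sumrB -scaler_sumr big_split /= !sum_delta.
    have : \sum_u w v u *: (q - p u) = 0.
      rewrite -[RHS](hf v); apply: eq_bigr => u _; rewrite /update eqxx.
      by case: eqP => // ->; rewrite w0 ?ei ?scale0r.
    rewrite sum_scaleB -/sg => /eqP; rewrite subr_eq0 => /eqP <-.
    by rewrite scalerA subrr.
have nab : ~~ H a b by apply: contra neab => /andP[].
have [m mH hm] := unit_strain Hs (addedge_sym a b Hs) HG ind nab.
have := vertex_work ei hw mH; under eq_bigr do rewrite wE -mulrA mulrDl.
rewrite -mulr_sumr big_split /= !sum_deltaM.
have -> : dot (p a - q) (m a) + dot (p b - q) (m b) = 2^-1 * strain p m a b.
  by rewrite /strain !dot3 /q !vecE; field.
rewrite hm ?pairingxx /= ?eqxx ?orbT // => h u.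
have sg0 : sg = 0 by lra.
by rewrite wE sg0 !mul0r.
Qed.

(** ** A single coplanar set *)

(** A point [s] of [S] is moved to the centre of mass of the three others.  This depends
    linearly on the configuration, so it is enough to see for each other set of four
    points that it need not become coplanar: if it misses the point [a] of [S], the
    position of [a] can be adapted so that [s] does not move. *)
Lemma only_coplanar (S : {set V}) : #|S| = 4%N ->
  exists p : conf,
    (forall A : {set V}, (#|A| <= 4)%N -> A != S -> affindep p A) /\
    (forall (c : V -> R) y, y \notin S -> (forall u, u \notin y |: S -> c u = 0) ->
       \sum_u c u = 0 -> \sum_u c u *: p u = 0 -> c y = 0).
Proof.
move=> cS; have SE : S = [set y in enum S] by apply/setP=> y; rewrite inE mem_enum.
have := enum_uniq S; move: cS; rewrite cardE; move: SE.
case: (enum S) => [|s [|a [|b [|d []]]]] // SE _; rewrite /= !inE !negb_or.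
move=> /and4P[/and3P[sa sb sd] /andP[ab ad] bd _].
have {}SE : S = [set s; a; b; d] by apply/setP=> y; rewrite SE !inE !orbA.
pose g (p : conf) := update p s (3^-1 *: (p a + p b + p d)).
have gs p : g p s = 3^-1 *: (p a + p b + p d) by rewrite /g /update eqxx.
have go p u : u != s -> g p u = p u by rewrite /g /update => /negPf ->.
have gline p0 p1 t : g (line p0 p1 t) = line (g p0) (g p1) t.
  apply: funext => u; rewrite /line; have [->|us] := eqVneq u s; last by rewrite !go.
  by rewrite !gs; apply/rowP=> k; rewrite !vecE; ring.
have stay (p : conf) x y z : uniq [:: s; x; y; z] -> S = [set s; x; y; z] ->
    (forall q, g q s = 3^-1 *: (q x + q y + q z)) ->
    forall A : {set V}, x \notin A -> affindep p A -> exists p, affindep (g p) A.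
  rewrite /= !inE !negb_or => /and4P[/and3P[sx sy sz] /andP[xy xz] yz _] _ gx A xA ind.
  pose q := update p x (3 *: p s - p y - p z); exists q => c c0 c1 cp; apply: ind => //.
  have qo u : u != x -> q u = p u by rewrite /q /update => /negPf ->.
  rewrite -[RHS]cp; apply: eq_bigr => u _; have [uA|/c0 ->] := boolP (u \in A); last first.
    by rewrite !scale0r.
  congr (_ *: _); have ux : u != x by apply: contraNneq xA => <-.
  have [->|us] := eqVneq u s; last by rewrite go // qo.
  rewrite gx (qo y) 1?eq_sym // (qo z) 1?eq_sym // /q /update eqxx.
  by apply/rowP=> k; rewrite !vecE; field.
have [A|A|p hp] := zopen_meet_all
    (O := fun (A : {set V}) p => (#|A| <= 4)%N -> A != S -> affindep (g p) A).
- apply: zopen_imply; apply: zopen_imply.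
  exact: (zopen_pull gline (@zopen_affindep R V A)).
- have [p gp] := @generalpos_exists R V.
  have [cA|cA] := boolP (#|A| <= 4)%N; last by exists p.
  have [AS|AS] := eqVneq A S; first by exists p.
  have ind := gp A cA.
  suff [p' hp'] : exists p', affindep (g p') A by exists p'.
  have [SA|/subsetPn[x]] := boolP (S \subset A).
    by case/negP: AS; rewrite eq_sym eqEcard SA SE -!setUA !cardsU1 cards1 !inE !negb_or
      sa sb sd ab ad bd.
  rewrite SE !inE -!orbA => /or4P[] /eqP -> xA.
  + exists p => c c0 c1 cp; apply: ind => //; rewrite -[RHS]cp; apply: eq_bigr => u _.
    have [uA|/c0 ->] := boolP (u \in A); last by rewrite !scale0r.
    by rewrite go //; apply: contraNneq xA => <-.
  + by apply: (stay p a b d) => //; rewrite /= ?inE ?negb_or ?sa ?sb ?sd ?ab ?ad ?bd.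
  + apply: (stay p b a d) => //.
    * by rewrite /= !inE !negb_or sa sb sd (eq_sym b) ab bd ad.
    * by rewrite SE; apply/setP=> y; rewrite !inE; do 4!case: (y == _).
    * by move=> p'; rewrite gs (addrC (p' a)).
  + apply: (stay p d a b) => //.
    * by rewrite /= !inE !negb_or sa sb sd !(eq_sym d) ab bd ad.
    * by rewrite SE; apply/setP=> y; rewrite !inE; do 4!case: (y == _).
    * by move=> p'; rewrite gs addrC addrA.
exists (g p); split=> [A|c y yS c0 c1 cp]; first exact: hp.
have ys : y != s by apply: contraNneq yS => ->; rewrite SE !inE eqxx.
pose T := [set y; a; b; d].
have cT : (#|T| <= 4)%N.
  by rewrite /T -!setUA !cardsU1 cards1; do 3!case: (_ \notin _).
have TS : T != S by apply: contraNneq yS => <-; rewrite !inE eqxx.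
pose c' u := (if u == s then 0 else c u) +
  c s / 3 * ((u == a)%:R + (u == b)%:R + (u == d)%:R).
have split1 (W : zmodType) (f : V -> W) : \sum_(u | u != s) f u = \sum_u f u - f s.
  by rewrite [in RHS](bigD1 s) //= addrAC subrr add0r.
have part (W : lmodType R) (f : V -> W) : \sum_u c' u *: f u =
    \sum_u c u *: f u - c s *: f s + (c s / 3) *: (f a + f b + f d).
  rewrite /c'; under eq_bigr do rewrite scalerDl -scalerA !scalerDl.
  rewrite big_split -scaler_sumr !big_split /= !sum_delta -split1; congr (_ + _).
  rewrite (bigD1 s) //= eqxx scale0r add0r.
  by apply: eq_bigr => u /negPf ->.
have c'0 : forall u, c' u = 0.
  apply: (hp T cT TS) => [u uT||].
  - move: uT; rewrite !inE !negb_or /c' => /andP[/andP[/andP[uy ua] ub] ud].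
    rewrite (negPf ua) (negPf ub) (negPf ud) !addr0 mulr0 addr0; case: eqP => // /eqP us.
    by apply: c0; rewrite SE !inE !negb_or uy us ua ub.
  - have := part R^o (fun=> 1); rewrite /GRing.scale /=.
    under eq_bigr do rewrite mulr1.
    under [in RHS]eq_bigr do rewrite mulr1.
    by move=> ->; rewrite c1; field.
  - rewrite part cp sub0r gs !go 1?eq_sym //.
    by apply/rowP=> k; rewrite !vecE; field.
have := c'0 y; rewrite /c' (negPf ys).
have ne z : z \in S -> (y == z) = false by move=> zS; apply: contraNF yS => /eqP ->.
by rewrite !ne ?SE ?inE ?eqxx ?orbT // !addr0 mulr0 addr0.
Qed.

End Vertices.

(** * Vertices with five neighbours *)

Section FiveNeighbours.
Variables (R : realFieldType) (V : finType).
Local Notation conf := (V -> 'rV[R]_3).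
Implicit Types (e : rel V) (p m : V -> 'rV[R]_3) (w : V -> V -> R).

(** The algebra behind [five_neighbours].  Let [Q_f] be the quadratic form with zero
    diagonal and coefficients [E f], and [l_f] the linear form with coefficients [L f];
    the hypotheses on products compare coefficients in [Q_f l_g = Q_g l_f].

    Suppose that [L^~ z] is not zero.  If all the functions [L^~ x] are multiples of it
    then so are all the functions that give a coefficient of [E], whereas those of [a b]
    and [c d] are linearly independent.  Otherwise some [L^~ y] is independent of
    [L^~ z].  If [L^~ w] is not zero for a third point [w] then [E] vanishes on the
    triangle of [z], [y] and [w], else on that of the three remaining points. *)
Lemma proportional_forms (M : Type) (E : M -> V -> V -> R) (L : M -> V -> R) (N : {set V})
  (f g : M) (a b c d : V) :
  #|N| = 5%N -> (forall f x y, E f x y = E f y x) ->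
  (forall f g x y, x \in N -> y \in N -> x != y -> E f x y * L g x = E g x y * L f x) ->
  (forall f g x y z, x \in N -> y \in N -> z \in N -> x != y -> x != z -> y != z ->
     E f x y * L g z + E f x z * L g y + E f y z * L g x =
     E g x y * L f z + E g x z * L f y + E g y z * L f x) ->
  [/\ a \in N, b \in N & a != b] -> [/\ c \in N, d \in N & c != d] ->
  E f a b = 1 -> E f c d = 0 -> E g a b = 0 -> E g c d = 1 ->
  (forall x y z, x \in N -> y \in N -> z \in N -> x != y -> x != z -> y != z ->
     exists f, ~ [/\ E f x y = 0, E f x z = 0 & E f y z = 0]) ->
  forall f x, x \in N -> L f x = 0.
Proof.
move=> cN sE P T [aN bN ab] [cN' dN cd] Eab Ecd E'ab E'cd free f0 z zN.
apply/eqP/negPn/negP => l0.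
pose prop x y := forall f g, L f x * L g y = L g x * L f y.
have rank2 (h : M -> R) x y : ~ prop x y ->
    (forall f g, h f * L g x = h g * L f x) ->
    (forall f g, h f * L g y = h g * L f y) -> forall f, h f = 0.
  move=> npr hx hy; have [f1 [f2 /eqP]] : exists f1 f2, L f1 x * L f2 y <> L f2 x * L f1 y.
    apply: contrapT => h3; apply: npr => f1 f2; apply: contrapT => h4; apply: h3.
    by exists f1, f2.
  rewrite -subr_eq0 => det f3; have E1 : h f1 = 0.
    apply: (mulIf det); rewrite mul0r.
    have := hx f1 f2; have := hy f1 f2 => h2 h1.
    transitivity (L f1 x * (h f1 * L f2 y) - L f1 y * (h f1 * L f2 x)); first by ring.
    by rewrite h1 h2; ring.
  have E2 : h f2 = 0.
    apply: (mulIf det); rewrite mul0r.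
    have := hx f1 f2; have := hy f1 f2 => h2 h1.
    transitivity (L f2 y * (h f2 * L f1 x) - L f2 x * (h f2 * L f1 y)); first by ring.
    by rewrite -h1 -h2; ring.
  have [x0|x0] := eqVneq (L f1 x) 0; last by apply: (mulIf x0); rewrite hx E1 !mul0r.
  have [y0|y0] := eqVneq (L f2 x) 0; last by apply: (mulIf y0); rewrite hx E2 !mul0r.
  by rewrite x0 y0 !mul0r subrr eqxx in det.
have ne f1 x y : L f1 x != 0 -> L f1 y = 0 -> x != y.
  by move=> h h0; apply/eqP=> xy; rewrite xy h0 eqxx in h.
have [[y yN nzy]|allp] := pselect (exists2 y, y \in N & ~ prop z y); last first.
  (* all linear forms are multiples of that of [z], hence so are all coefficients [E] *)
  have {}allp x : x \in N -> prop z x.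
    by move=> xN; apply: contrapT => h; apply: allp; exists x.
  have Ez f1 f2 x y : x \in N -> y \in N -> x != y -> E f1 x y * L f2 z = E f2 x y * L f1 z.
    move=> xN yN xy.
    have half u t : u \in N -> t \in N -> u != t -> L f0 u != 0 ->
        E f1 u t * L f2 z = E f2 u t * L f1 z.
      move=> uN tN ut u0; apply: (mulIf u0).
      have h f3 : L f3 z * L f0 u = L f0 z * L f3 u by apply: allp.
      by rewrite -!mulrA !h !(mulrCA _ (L f0 z)) P.
    have [x0|x0] := eqVneq (L f0 x) 0; last exact: half.
    have [y0|y0] := eqVneq (L f0 y) 0; last by rewrite !(sE _ x y) half // eq_sym.
    have vanish u : u \in N -> L f0 u = 0 -> forall f3, L f3 u = 0.
      move=> uN u0 f3; apply: (mulfI l0); rewrite mulr0.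
      by have := allp u uN f0 f3; rewrite u0 mulr0.
    have zx := ne _ _ _ l0 x0; have zy := ne _ _ _ l0 y0.
    have := T f1 f2 x y z xN yN zN xy; rewrite !(eq_sym _ z) zx zy => /(_ isT isT).
    by rewrite !(vanish x xN x0) !(vanish y yN y0) !mulr0 !addr0.
  have h1 := Ez f g a b aN bN ab; have h2 := Ez f g c d cN' dN cd.
  have h3 := Ez f f0 a b aN bN ab.
  rewrite Ecd E'cd mul0r mul1r in h2; rewrite Eab -h2 mulr0 mul1r in h3.
  by rewrite h3 eqxx in l0.
have zy : z != y by apply: contra_notN nzy => /eqP <- f1 f2; rewrite mulrC.
have flat x t u : x \in N -> t \in N -> u \in N -> x != t -> x != u -> t != u ->
    [/\ forall f, E f x t = 0, forall f, E f x u = 0 & forall f, E f t u = 0] -> False.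
  move=> xN tN uN xt xu tu [h1 h2 h3]; have [f1 []] := free x t u xN tN uN xt xu tu.
  by rewrite h1 h2 h3.
have E0 x t : x \in N -> t \in N -> x != t -> ~ prop x t -> forall f, E f x t = 0.
  move=> xN tN xt npr; apply: rank2 npr _ _ => f1 f2; first exact: P.
  by rewrite !(sE _ x t) P // eq_sym.
have [[w wN [wz wy [f1 lw]]]|dead] := pselect (exists2 w, w \in N &
    [/\ w != z, w != y & exists f, L f w != 0]).
  have zw : z != w by rewrite eq_sym.
  have yw : y != w by rewrite eq_sym.
  have trans : prop w z -> prop w y -> prop z y.
    move=> hz hy f2 f3; apply: (mulfI lw); apply: (mulfI lw).
    transitivity ((L f1 w * L f2 z) * (L f1 w * L f3 y)); first by ring.
    transitivity ((L f1 w * L f3 z) * (L f1 w * L f2 y)); last by ring.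
    by rewrite (hz f1 f2) (hy f1 f3) (hz f1 f3) (hy f1 f2); ring.
  have propC x t : prop x t -> prop t x.
    by move=> h f2 f3; rewrite mulrC (h f3 f2); apply: mulrC.
  have third x t : x \in N -> t \in N -> x != t -> w != x -> w != t -> ~ prop x t -> ~ prop w t -> False.
    move=> xN tN xt wx wt nxt nwt; have h1 := E0 x t xN tN xt nxt.
    have h2 := E0 w t wN tN wt nwt; apply: (flat x t w xN tN wN xt _ _); rewrite 1?eq_sym //.
    split=> // [|f2]; last by rewrite sE.
    apply: rank2 nxt _ _ => f2 f3; first by apply: P; rewrite // eq_sym.
    have xw : x != w by rewrite eq_sym.
    have tw : t != w by rewrite eq_sym.
    have := T f2 f3 x t w xN tN wN xt xw tw.
    by rewrite !h1 !(sE _ t w) !h2 !mul0r !add0r !addr0.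
  have [hz|hz] := pselect (prop w z); last first.
    by apply: (third y z); rewrite // 1?eq_sym // => /propC.
  by apply: (third z y) => // hy; apply: nzy; apply: trans.
(* the linear forms of the other three points vanish *)
have c3 : #|(N :\ z) :\ y| = 3%N.
  move: cN; rewrite (cardsD1 z) zN (cardsD1 y) in_setD1 eq_sym zy yN.
  by rewrite !add1n => -[->].
have := enum_uniq (N :\ z :\ y); move: c3; rewrite cardE.
have mem t : t \in enum (N :\ z :\ y) -> [/\ t \in N, t != z, t != y & forall f, L f t = 0].
  rewrite mem_enum !inE => /and3P[ty tz tN]; split=> // f1; apply/eqP/negPn/negP => lt.
  by apply: dead; exists t => //; split=> //; exists f1.
case: (enum _) mem => [|x [|t [|u []]]] // mem _; rewrite /= !inE !negb_or.
move=> /andP[/andP[xt xu] /andP[tu _]].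
have [xN xz xy lx] := mem x (mem_head _ _).
have [tN tz ty lt] : [/\ t \in N, t != z, t != y & forall f, L f t = 0].
  by apply: mem; rewrite !inE eqxx orbT.
have [uN uz uy lu] : [/\ u \in N, u != z, u != y & forall f, L f u = 0].
  by apply: mem; rewrite !inE eqxx !orbT.
have zero v1 v2 : v1 \in N -> v2 \in N -> v1 != v2 -> v1 != z -> v1 != y -> v2 != z -> v2 != y ->
    (forall f, L f v1 = 0) -> (forall f, L f v2 = 0) -> forall f, E f v1 v2 = 0.
  move=> h1 h2 h12 h1z h1y h2z h2y l1 l2; apply: rank2 nzy _ _ => f1 f2.
    by have := T f1 f2 v1 v2 z h1 h2 zN h12 h1z h2z; rewrite !l1 !l2 !mulr0 !addr0.
  by have := T f1 f2 v1 v2 y h1 h2 yN h12 h1y h2y; rewrite !l1 !l2 !mulr0 !addr0.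
by apply: (flat x t u) => //; split; apply: zero.
Qed.

(** The bilinear extension of the strains to systems of weights.  By [strain_formE] a
    system enters only through its sum and its sums against [p], against [m] and against
    their inner product. *)
Definition strain_form p m (a b : V -> R) := \sum_u \sum_z a u * b z * strain p m u z.

Lemma strain_formE p m a b : strain_form p m a b =
  (\sum_u a u) * (\sum_z b z * dot (p z) (m z)) +
  (\sum_z b z) * (\sum_u a u * dot (p u) (m u)) -
  dot (\sum_u a u *: p u) (\sum_z b z *: m z) -
  dot (\sum_z b z *: p z) (\sum_u a u *: m u).
Proof.
have D (c d : V -> R) (f g : conf) : dot (\sum_u c u *: f u) (\sum_z d z *: g z) =
    \sum_u \sum_z c u * d z * dot (f u) (g z).
  rewrite dot_suml; apply: eq_bigr => u _; rewrite dot_sumr; apply: eq_bigr => z _.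
  by rewrite dotZl dotZr mulrA.
have M (c d : V -> R) : (\sum_u c u) * (\sum_z d z) = \sum_u \sum_z c u * d z.
  by rewrite mulr_suml; apply: eq_bigr => u _; rewrite mulr_sumr.
rewrite (mulrC (\sum_z b z)) !M !D [X in _ - X]exchange_big /=.
rewrite -big_split -!sumrB /=; apply: eq_bigr => u _.
rewrite -big_split -!sumrB /=; apply: eq_bigr => z _.
by rewrite /strain dotBl !dotBr; ring.
Qed.

Lemma strain_form_delta p m b u : strain_form p m (fun x => (x == u)%:R) b =
  \sum_z b z * strain p m u z.
Proof.
rewrite /strain_form -(sum_deltaM u (fun x => \sum_z b z * strain p m x z)).
by apply: eq_bigr => x _; rewrite mulr_sumr; apply: eq_bigr => z _; rewrite mulrA.
Qed.

Lemma strain_formDl p m a a' y b :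
  strain_form p m (fun x => a x + y * a' x) b =
  strain_form p m a b + y * strain_form p m a' b.
Proof.
rewrite /strain_form mulr_sumr -big_split; apply: eq_bigr => u _.
rewrite mulr_sumr -big_split; apply: eq_bigr => z _ /=; ring.
Qed.

Lemma strain_formC p m a b : strain_form p m a b = strain_form p m b a.
Proof.
rewrite /strain_form exchange_big; apply: eq_bigr => u _; apply: eq_bigr => z _.
by rewrite strainC (mulrC (a z)).
Qed.

Lemma strain_diag p m u : strain p m u u = 0.
Proof. by rewrite /strain subrr dot0l. Qed.

Lemma five_points_circuit p (N : {set V}) : generalpos p -> #|N| = 5%N ->
  exists k : V -> R, [/\ forall u, (k u != 0) = (u \in N), \sum_u k u = 0 &
    \sum_u k u *: p u = 0].
Proof.
move=> gp cN; have [|k [k0 k1 k2 [y ky]]] := @affine_dependency R V p N; first by rewrite cN.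
exists k; split=> // u; have [uN|/k0 ->] := boolP (u \in N); last by rewrite eqxx.
apply: contra_neq ky => ku; apply: (gp (N :\ u)) => // [|z].
  by move: cN; rewrite (cardsD1 u) uN add1n => -[->].
by rewrite !inE negb_and negbK => /orP[/eqP -> //|]; apply: k0.
Qed.

(** For weights [mu] on the neighbours the vertex [v] is placed at their centre
    of mass [q].  The force densities of a stress at [v] are combinations of
    [mu] and of the affine dependency [k], so by the principle of virtual work
    the two functionals [strain_form mu mu] and [strain_form mu k] on the motions
    of the rest are proportional.  As [mu] varies this gives the identities of
    [proportional_forms]; hence [k] does no work in the motions of the rest, whatever the
    position of [v], and extends to a stress. *)
Lemma five_neighbours e p v (a b c d : V) : symmetric e -> irreflexive e ->
  #|[set u | e v u]| = 5%N -> generalpos p -> (forall q, ~ indep e (update p v q)) ->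
  uniq [:: a; b; c; d] -> {in [:: a; b; c; d], forall u, e v u} -> ~~ e a b -> ~~ e c d ->
  indep (addedge c d (addedge a b (delset [set v] e))) p ->
  (forall x y z, e v x -> e v y -> e v z -> uniq [:: x; y; z] ->
     exists t u, [/\ t \in [:: x; y; z], u \in [:: x; y; z], t != u &
       ~~ e t u /\ indep (addedge t u (delset [set v] e)) p]) ->
  exists w, [/\ stress e p w, \sum_u w v u = 0 & forall u, e v u -> w v u != 0].
Proof.
move=> es ei; set N := [set _ | _]; move=> cN gp dep un nb nab ncd ind free.
pose H : rel V := delset [set v] e.
have nv u : e v u = (u \in N) by rewrite inE.
have vN : v \notin N by rewrite -nv ei.
have [k [kN k1 kp]] := five_points_circuit gp cN.
have kin x : x \in N -> k x != 0 by rewrite kN.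
have kout x : x \notin N -> k x = 0.
  by move=> xN; apply/eqP; rewrite -[_ == _]negbK kN.
have [aN bN cN' dN] : [/\ a \in N, b \in N, c \in N & d \in N].
  by split; rewrite -nv; apply: nb; rewrite !inE eqxx ?orbT.
have [ab ac ad [bc bd cd]] : [/\ a != b, a != c, a != d & [/\ b != c, b != d & c != d]].
  by move: un; rewrite /= !inE !negb_or andbT => /and3P[/and3P[? ? ?] /andP[? ?] ?].
have c4 : #|N :\ a| = 4%N by move: cN; rewrite (cardsD1 a) aN => -[].
have Hs : symmetric H by apply: delset_sym.
have indH : indep H p by apply: sub_indep ind => x y /=; rewrite /H /= => ->.
have D m x y : strain_form p m (fun z => (z == x)%:R) (fun z => (z == y)%:R) = strain p m x y.
  by rewrite strain_form_delta sum_deltaM.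
(* an identity of cubic forms in [mu], whose coefficients are compared below *)
have cubic m m' (mu : V -> R) : motion H p m -> motion H p m' ->
    (forall x, x \notin N -> mu x = 0) -> \sum_x mu x != 0 ->
    strain_form p m mu mu * strain_form p m' mu k =
    strain_form p m' mu mu * strain_form p m mu k.
  move=> hm hm' mu0; set sg := \sum_x mu x => sg0.
  pose q := sg^-1 *: \sum_x mu x *: p x.
  have sgq : sg *: q = \sum_x mu x *: p x by rewrite scalerA divff // scale1r.
  have [w hw wn0] := star_stress es indH (dep q).
  have [[sw w0] hf] := hw.
  have nu0 x : x \notin N -> w v x = 0 by rewrite -nv => /w0.
  pose tau := \sum_x w v x.
  have fv : tau *: q = \sum_x w v x *: p x.
    have h : \sum_x w v x *: (q - p x) = 0.
      rewrite -[RHS](hf v); apply: eq_bigr => x _; rewrite /update eqxx.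
      by case: eqP => // ->; rewrite nu0 ?scale0r.
    by move/eqP: h; rewrite sum_scaleB subr_eq0 => /eqP.
  pose r x := w v x - tau / sg * mu x.
  have r0 x : x \notin N -> r x = 0 by move=> xN; rewrite /r nu0 ?mu0 ?mulr0 ?subr0.
  have r1 : \sum_x r x = 0.
    have -> : \sum_x r x = tau - tau / sg * sg by rewrite /r sumrB -mulr_sumr.
    by rewrite divfK // subrr.
  have rp : \sum_x r x *: p x = 0.
    rewrite /r; under eq_bigr do rewrite scalerBl -scalerA.
    by rewrite sumrB -scaler_sumr -fv -sgq [X in _ - X]scalerA divfK // subrr.
  pose s := r a / k a.
  have rs x : r x = s * k x.
    apply/eqP; rewrite -subr_eq0; apply/eqP; move: x.
    apply: (gp (N :\ a)) => // [|x||].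
    - by rewrite c4.
    - rewrite in_setD1 negb_and negbK => /orP[/eqP ->|xN].
        by rewrite /s divfK ?subrr // kin.
      by rewrite (r0 _ xN) (kout _ xN) mulr0 subr0.
    - by rewrite sumrB r1 -mulr_sumr k1 mulr0 subr0.
    - under eq_bigr do rewrite scalerBl -scalerA.
      by rewrite sumrB rp -scaler_sumr kp scaler0 subr0.
  pose t := tau / sg.
  have wE x : w v x = t * mu x + s * k x by rewrite -rs /r /t; ring.
  have ts : (t != 0) || (s != 0).
    rewrite -negb_and; apply/negP=> /andP[/eqP t0 /eqP s0].
    by case: wn0 => x; rewrite wE t0 s0 !mul0r addr0 eqxx.
  have lin m0 : motion H p m0 ->
      t * strain_form p m0 mu mu / 2 + s * strain_form p m0 mu k = 0.
    move=> hm0; have := vertex_work ei hw hm0.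
    have E (f : V -> R) : sg * (\sum_x f x * dot (p x - q) (m0 x)) =
        sg * (\sum_x f x * dot (p x) (m0 x)) -
        dot (\sum_x mu x *: p x) (\sum_x f x *: m0 x).
      rewrite -sgq dotZl -mulrBr dot_sumr -sumrB; congr (_ * _).
      by apply: eq_bigr => x _; rewrite dotBl dotZr mulrBr.
    move/(congr1 ( *%R sg)); rewrite mulr0.
    have -> : \sum_x w v x * dot (p x - q) (m0 x) =
        t * (\sum_x mu x * dot (p x - q) (m0 x)) +
        s * (\sum_x k x * dot (p x - q) (m0 x)).
      rewrite !mulr_sumr -big_split; apply: eq_bigr => x _ /=.
      by rewrite wE mulrDl !mulrA.
    rewrite mulrDr !(mulrCA sg) !E !strain_formE k1 kp -/sg dot0l mul0r addr0 subr0.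
    by move=> h; rewrite -[RHS]h; field.
  have := lin _ hm; have := lin _ hm'.
  set A := strain_form p m mu mu; set A' := strain_form p m' mu mu.
  set B := strain_form p m mu k; set B' := strain_form p m' mu k.
  move=> h' h; have [t0|t0] := eqVneq t 0.
    move: ts h h'; rewrite t0 eqxx /= => s0; rewrite !mul0r !add0r => /eqP.
    rewrite mulf_eq0 (negPf s0) => /eqP -> /eqP; rewrite mulf_eq0 (negPf s0).
    by move=> /eqP ->; rewrite !mulr0.
  apply: (mulfI t0); apply: (@mulIf _ (2^-1)); first by rewrite invr_eq0 pnatr_eq0.
  have e1 : t * A / 2 = - s * B by lra.
  have e2 : t * A' / 2 = - s * B' by lra.
  transitivity ((t * A / 2) * B'); first by ring.
  transitivity ((t * A' / 2) * B); last by ring.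
  by rewrite e1 e2; ring.
pose la m x := \sum_z k z * strain p m x z.
(* weights one and [r] on two of the neighbours, for two values of [r] *)
have pairs m m' : motion H p m -> motion H p m' -> forall x y, x \in N -> y \in N ->
    x != y -> strain p m x y * la m' x = strain p m' x y * la m x.
  move=> hm hm' x y xN yN xy.
  have key (r : R) : 0 < r -> strain p m x y * (la m' x + r * la m' y) =
      strain p m' x y * (la m x + r * la m y).
    move=> r0; pose mu z : R := (z == x)%:R + r * (z == y)%:R.
    have form0 m0 : strain_form p m0 mu mu = r * 2 * strain p m0 x y.
      rewrite /mu strain_formDl !(strain_formC _ _ _ (fun z => _ + _)) !strain_formDl.
      by rewrite !D !strain_diag (strainC p m0 y x); ring.
    have formk m0 : strain_form p m0 mu k = la m0 x + r * la m0 y.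
      by rewrite /mu strain_formDl !strain_form_delta.
    have h := cubic m m' mu hm hm'; rewrite !form0 !formk in h.
    have {}h : r * 2 * strain p m x y * (la m' x + r * la m' y) =
        r * 2 * strain p m' x y * (la m x + r * la m y).
      apply: h => [z zN|].
        have zx : z != x by apply: contraNneq zN => ->.
        have zy : z != y by apply: contraNneq zN => ->.
        by rewrite /mu (negPf zx) (negPf zy) mulr0 addr0.
      rewrite /mu big_split /= -mulr_sumr.
      by rewrite !sum_delta1 mulr1 lt0r_neq0 // addr_gt0.
    have r2 : r * 2 != 0 by rewrite mulf_neq0 ?pnatr_eq0 // lt0r_neq0.
    by apply: (mulfI r2); rewrite !mulrA.
  have h1 := key 1 ltr01; have h2 := key 2 (ltr0Sn R 1); lra.
have triples m m' : motion H p m -> motion H p m' -> forall x y z,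
    x \in N -> y \in N -> z \in N -> x != y -> x != z -> y != z ->
    strain p m x y * la m' z + strain p m x z * la m' y + strain p m y z * la m' x =
    strain p m' x y * la m z + strain p m' x z * la m y + strain p m' y z * la m x.
  move=> hm hm' x y z xN yN zN xy xz yz.
  pose mu u : R := (u == x)%:R + 1 * ((u == y)%:R + 1 * (u == z)%:R).
  have form0 m0 : strain_form p m0 mu mu =
      2 * (strain p m0 x y + strain p m0 x z + strain p m0 y z).
    rewrite /mu !strain_formDl !(strain_formC _ _ _ (fun u => _ + _)) !strain_formDl.
    by rewrite !D !strain_diag (strainC p m0 y x) (strainC p m0 z x) (strainC p m0 z y); ring.
  have formk m0 : strain_form p m0 mu k = la m0 x + la m0 y + la m0 z.
    by rewrite /mu !strain_formDl !strain_form_delta !mul1r addrA.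
  have h := cubic m m' mu hm hm'; rewrite !form0 !formk in h.
  have {}h : 2 * (strain p m x y + strain p m x z + strain p m y z) *
      (la m' x + la m' y + la m' z) =
      2 * (strain p m' x y + strain p m' x z + strain p m' y z) *
      (la m x + la m y + la m z).
    apply: h => [u uN|].
      have ux : u != x by apply: contraNneq uN => ->.
      have uy : u != y by apply: contraNneq uN => ->.
      have uz : u != z by apply: contraNneq uN => ->.
      by rewrite /mu (negPf ux) (negPf uy) (negPf uz) !(mulr0, addr0).
    rewrite /mu big_split /= -mulr_sumr big_split /= -mulr_sumr.
    by rewrite !sum_delta1 !mul1r lt0r_neq0 // !addr_gt0.
  have p1 := pairs m m' hm hm' x y xN yN xy.
  have p2 := pairs m m' hm hm' y x yN xN; rewrite eq_sym xy in p2.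
  have p3 := pairs m m' hm hm' x z xN zN xz.
  have p4 := pairs m m' hm hm' z x zN xN; rewrite eq_sym xz in p4.
  have p5 := pairs m m' hm hm' y z yN zN yz.
  have p6 := pairs m m' hm hm' z y zN yN; rewrite eq_sym yz in p6.
  have {}p2 := p2 isT; have {}p4 := p4 isT; have {}p6 := p6 isT.
  move: p2 p4 p6; rewrite !(strainC _ _ y x) !(strainC _ _ z x) !(strainC _ _ z y).
  move=> p2 p4 p6; lra.
have nH x y : ~~ e x y -> ~~ H x y by apply: contra => /andP[].
have acd : symmetric (addedge c d (addedge a b H)) by do 2!apply: addedge_sym.
have HG x y : H x y -> addedge c d (addedge a b H) x y by rewrite /addedge => ->.
have [m mH hm] := unit_strain Hs acd HG ind (nH _ _ nab).
have [m' mH' hm'] := unit_strain Hs acd HG ind (nH _ _ ncd).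
have la0 m3 x : motion H p m3 -> x \in N -> la m3 x = 0.
  move=> mH3; pose M := {m0 | motion H p m0}.
  suff h (m0 : M) y : y \in N -> la (sval m0) y = 0 by apply: (h (exist _ m3 mH3)).
  move: m0 y; apply: (@proportional_forms M (fun m0 : M => strain p (sval m0)) _ N
    (exist _ m mH) (exist _ m' mH') a b c d) => //=.
  - by move=> m0; apply: strainC.
  - by move=> [m1 h1] [m2 h2] /=; apply: pairs.
  - by move=> [m1 h1] [m2 h2] /=; apply: triples.
  - by rewrite hm ?pairingxx /= ?eqxx ?orbT.
  - by rewrite hm /= ?eqxx ?orbT // /pairing !(eq_sym c) (negPf ac) (negPf bc).
  - by rewrite hm' /= ?eqxx ?orbT // /pairing (negPf ac) (negPf ad).
  - by rewrite hm' ?pairingxx /= ?eqxx ?orbT.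
  move=> x1 y z xN yN zN xy xz yz.
  have ev z1 : z1 \in N -> e v z1 by rewrite nv.
  have [|t [u [ht hu tu [ntu itu]]]] := free x1 y z (ev _ xN) (ev _ yN) (ev _ zN).
    by rewrite /= !inE negb_or xy xz yz.
  have HG1 x2 y2 : H x2 y2 -> addedge t u H x2 y2 by rewrite /addedge => ->.
  have [m4 mH4 hm4] := unit_strain Hs (addedge_sym t u Hs) HG1 itu (nH _ _ ntu).
  exists (exist _ m4 mH4) => /= -[s1 s2 s3].
  suff : strain p m4 t u = 0 by apply/eqP; rewrite hm4 ?pairingxx /= ?eqxx ?orbT // oner_eq0.
  by move: ht hu tu; rewrite !inE => /or3P[] /eqP -> /or3P[] /eqP ->;
    rewrite ?eqxx // => _ //; rewrite strainC.
have kwork m3 : motion H p m3 -> \sum_x k x * dot (p x - p v) (m3 x) = 0.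
  move=> mH3; pose K := \sum_x k x *: m3 x; pose C := \sum_x k x * dot (p x) (m3 x).
  have laE x : la m3 x = C - dot (p x) K.
    rewrite /la -(strain_form_delta p m3 k x) strain_formE k1 kp dot0l mul0r addr0 subr0.
    by rewrite sum_delta1 sum_delta mul1r.
  have K0 : K = 0.
    have ai : affindep p (N :\ a) by apply: gp; rewrite c4.
    apply: (orthogonal_spanning (a := b) ai c4) => x; rewrite in_setD1 => /andP[_ xN].
    have h1 := laE x; have h2 := laE b.
    rewrite la0 // in h1; rewrite la0 // in h2.
    by rewrite dotBl; lra.
  transitivity (C - dot (p v) K); last first.
    by have := laE a; rewrite la0 // K0 !dot0r.
  rewrite /C /K dot_sumr -sumrB; apply: eq_bigr => x _.
  by rewrite dotBl mulrBr dotZr.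
have [w hw wk] : exists2 w, stress e (update p v (p v)) w & forall u, w v u = k u.
  apply: extend_stress => //; first by move=> u; rewrite nv; apply: kout.
  by rewrite sum_scaleB k1 scale0r kp subrr.
rewrite update_id in hw; exists w; split=> //; last by move=> u; rewrite nv wk; apply: kin.
by rewrite -[RHS]k1; apply: eq_bigr => x _.
Qed.

End FiveNeighbours.

(** * Tetrahedra *)

Section Tetrahedra.
Variables (R : realFieldType) (V : finType).
Local Notation conf := (V -> 'rV[R]_3).
Implicit Types (e : rel V) (p m : V -> 'rV[R]_3) (w : V -> V -> R).

Lemma det_affindep p a b c d : uniq [:: a; b; c; d] ->
  affindep p [set a; b; c; d] ->
  dot (p b - p a) (cross (p c - p a) (p d - p a)) != 0.
Proof.
rewrite /= !inE !negb_or => /and4P[/and3P[ab ac ad] /andP[bc bd] cd _] ind.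
have n0 : cross (p c - p a) (p d - p a) != 0.
  apply: cross_affindep => //; apply: sub_affindep ind.
  by apply/subsetP=> x; rewrite !inE => /orP[/orP[]|] ->; rewrite ?orbT.
apply: contraNneq n0 => h; apply/eqP.
have c4 : #|[set a; b; c; d]| = 4%N.
  rewrite -!setUA !cardsU1 cards1 !inE !negb_or.
  by rewrite ab ac ad bc bd cd.
apply: (orthogonal_spanning (a := a) ind c4) => y; rewrite !inE -!orbA.
case/or4P => /eqP ->; first by rewrite subrr dot0l.
- exact: h.
- exact: dot_crossl.
- exact: dot_crossr.
Qed.

Lemma affindep_clique p (X : {set V}) e : affindep p X -> irreflexive e -> indep (inner X e) p.
Proof.
move=> ind ei w [[sw w0] hf] v u.
have [vX|vX] := boolP (v \in X); last by rewrite w0 //= (negPf vX) andbF.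
apply: (@affindep_force R V p w v (X :\ v)) => //.
- by rewrite in_setD1 eqxx.
- by rewrite setD1K.
- move=> x; rewrite in_setD1 negb_and negbK => /orP[/eqP ->|xX].
    by rewrite w0 //= ei.
  by rewrite w0 //= (negPf xX) !andbF.
Qed.

Lemma zopen_update (O : conf -> Prop) p v : zopen O ->
  zopen (fun p' : conf => O (update p v (p' v))).
Proof.
apply: zopen_pull => p0 p1 t; apply: funext => u; rewrite /line /update.
by case: eqP => // _; rewrite subrr scaler0 addr0.
Qed.

Lemma polyline_dot (f g : conf -> 'rV[R]_3) :
  (forall k, polyline (fun p => f p 0 k)) -> (forall k, polyline (fun p => g p 0 k)) ->
  polyline (fun p => dot (f p) (g p)).
Proof.
move=> hf hg.
apply: (@polyline_eq _ _ (fun p => f p 0 c0 * g p 0 c0 + f p 0 c1 * g p 0 c1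
   + f p 0 c2 * g p 0 c2)).
  by move=> p; rewrite dot3.
by do 2?[apply: polylineD]; apply: polylineM.
Qed.

Definition midpoint p (x z : V) : 'rV[R]_3 := 2^-1 *: (p x + p z).

Lemma at_midpoint_line v x z (p0 p1 : conf) t :
  update (line p0 p1 t) v (midpoint (line p0 p1 t) x z) =
  line (update p0 v (midpoint p0 x z)) (update p1 v (midpoint p1 x z)) t.
Proof.
apply: funext => u; rewrite /line /update; case: eqP => // _.
by apply/rowP=> k; rewrite /midpoint !vecE; ring.
Qed.

(** The vertex [v] sees the triangle [X] and two other vertices [x], [z].  Let [m]
    run over the motions of the rest that fix the triangle.  A stress at [v],
    placed at [q], makes [dot (p x - q) (m x)] and [dot (p z - q) (m z)]
    proportional to each other, with a factor independent of [m].  Two motions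
    in which these are unrelated exist by assumption, so the polynomial
    identities in [q] force [dot (p z - p x) (m z) = 0] for all [m]: for [v] at the
    midpoint of [x] and [z] the bar [vz] does no work, and
    this gives a stress without the bar [vx]. *)
Lemma midpoint_dependent e p (X : {set V}) v x z a b : symmetric e -> irreflexive e ->
  #|X| = 3%N -> (forall y y', y \in X -> y' \in X -> y != y' -> e y y') ->
  (forall u, e v u = [|| u \in X, u == x | u == z]) -> x != z -> x \notin X -> z \notin X ->
  a \in X -> b \in X -> a != b -> ~~ e a x -> ~~ e b z ->
  (forall q, ~ indep e (update p v q)) ->
  indep (addedge b z (addedge a x (delset [set v] e))) p ->
  affindep p (z |: X) -> affindep (update p v (midpoint p x z)) (v |: X) ->
  ~ indep (deledge v x e) (update p v (midpoint p x z)).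
Proof.
move=> es ei cX cliq nv xz xX zX aX bX ab nax nbz dep ind affz affv.
pose H : rel V := delset [set v] e; pose q0 := midpoint p x z.
have vX : v \notin X by apply/negP => h; have := ei v; rewrite nv h.
have vx : x != v by apply/eqP => h; have := ei v; rewrite nv -h eqxx orbT.
have vz : z != v by apply/eqP => h; have := ei v; rewrite nv -h eqxx !orbT.
have Hs : symmetric H by apply: delset_sym.
have indH : indep H p by apply: sub_indep ind => y y' /=; rewrite /H /= => ->.
have XH y y' : y \in X -> y' \in X -> y != y' -> H y y'.
  move=> yX y'X yy'; rewrite /H /= !inE cliq //=.
  by apply/andP; split; apply: contraNneq vX => <-.
have affX : affindep p X by apply: sub_affindep affz; apply: subsetUr.
have rigid m : motion H p m -> exists c t, forall y, y \in X -> m y = rigid_field c t (p y).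
  move=> hm; have XE : X = [set y in enum X] by apply/setP=> y; rewrite inE mem_enum.
  have := enum_uniq X; have := cX; rewrite cardE; move: XE.
  case: (enum X) => [|y1 [|y2 [|y3 []]]] // XE _; rewrite /= !inE.
  rewrite negb_or => /andP[/andP[d12 d13] /andP[d23 _]].
  have {}XE : X = [set y1; y2; y3] by apply/setP=> y; rewrite XE !inE orbA.
  have h1 : y1 \in X by rewrite XE !inE eqxx.
  have h2 : y2 \in X by rewrite XE !inE eqxx ?orbT.
  have h3 : y3 \in X by rewrite XE !inE eqxx ?orbT.
  rewrite XE; apply: rigid_triangle => //; first by rewrite -XE.
  - by apply: hm; apply: XH.
  - by apply: hm; apply: XH.
  - by apply: hm; apply: XH.
pose fixed m := motion H p m /\ forall y, y \in X -> m y = 0.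
have fixing m : motion H p m -> exists c t, fixed (fun y => m y - rigid_field c t (p y)).
  move=> hm; have [c [t ct]] := rigid m hm; exists c, t; split; last first.
    by move=> y /ct ->; rewrite subrr.
  move=> y y' /hm h; rewrite /strain -[RHS]h -[in RHS](subr0 (strain p m y y')).
  rewrite -(rigid_strain c t (p y) (p y')) /strain -dotBr; congr dot.
  by apply/rowP=> k; rewrite !vecE; ring.
have prop m m' : fixed m -> fixed m' -> forall q,
    dot (p x - q) (m x) * dot (p z - q) (m' z) =
    dot (p x - q) (m' x) * dot (p z - q) (m z).
  move=> [hm m0] [hm' m0'].
  have hO := @zopen_update (fun p1 => affindep p1 (v |: X)) p v (@zopen_affindep R V (v |: X)).
  pose f (p' : conf) := dot (p x - p' v) (m x) * dot (p z - p' v) (m' z)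
      - dot (p x - p' v) (m' x) * dot (p z - p' v) (m z).
  have hf : polyline f.
    have pd y (u : 'rV[R]_3) : polyline (fun p' : conf => dot (p y - p' v) u).
      apply: polyline_dot => k; last exact: polyline_const.
      apply: (@polyline_eq _ _ (fun p' : conf => p y 0 k - p' v 0 k)).
        by move=> p'; rewrite !vecE.
      by apply: polylineB; [exact: polyline_const|exact: polyline_coord].
    by apply: polylineB; apply: polylineM.
  have := @zopen_closed _ _ _ f (fun=> q0) hO hf affv.
  have zero p' : affindep (update p v (p' v)) (v |: X) -> f p' = 0.
    move=> aff; have [w hw wn0] := star_stress es indH (dep (p' v)).
    have work m1 : motion H p m1 -> (forall y, y \in X -> m1 y = 0) ->
        w v x * dot (p x - p' v) (m1 x) + w v z * dot (p z - p' v) (m1 z) = 0.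
      move=> h1 h0; have := vertex_work ei hw h1.
      rewrite (bigD1 x) //= (bigD1 z) 1?eq_sym //= big1 ?addr0 // => y /andP[yx yz].
      have [yX|yX] := boolP (y \in X); first by rewrite h0 // dot0r mulr0.
      by rewrite hw.1.2 ?mul0r // nv (negPf yX) (negPf yx) (negPf yz).
    have := work _ hm m0; have := work _ hm' m0'; rewrite /f.
    set A := dot _ (m x); set B := dot _ (m z); set A' := dot _ (m' x); set B' := dot _ (m' z).
    move=> h' h.
    have : (w v x != 0) || (w v z != 0).
      rewrite -negb_and; apply/negP => /andP[/eqP wx /eqP wz].
      case: wn0 => u; rewrite (@affindep_force _ _ _ _ v _ vX aff) ?eqxx //; last exact: hw.2.
      move=> y yX; have [->//|yx] := eqVneq y x; have [->//|yz] := eqVneq y z.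
      by rewrite hw.1.2 // nv (negPf yX) (negPf yx) (negPf yz).
    case/orP => wn; apply: (mulfI wn).
      transitivity (w v x * A * B' - w v x * A' * B); first by ring.
      have -> : w v x * A = - (w v z * B) by lra.
      have -> : w v x * A' = - (w v z * B') by lra.
      ring.
    transitivity (A * (w v z * B') - A' * (w v z * B)); first by ring.
    have -> : w v z * B = - (w v x * A) by lra.
    have -> : w v z * B' = - (w v x * A') by lra.
    ring.
  by move=> /(_ zero) h q; have := h (fun=> q); rewrite /f => /eqP; rewrite subr_eq0 => /eqP.
pose W m := dot (p z - p x) (m z).
have lin m m' : fixed m -> fixed m' -> forall d,
    dot d (m x) * W m' = dot d (m' x) * W m /\
    dot d (m x) * dot d (m' z) = dot d (m' x) * dot d (m z).
  move=> hm hm' d; have h1 := prop m m' hm hm' (p x - d); have h2 := prop m m' hm hm' (p x + d).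
  move: h1 h2; rewrite !opprB !addrA !opprD !addrA ![p x + d - p x]addrAC !subrr !add0r.
  rewrite ![p z + d - p x]addrAC !dotNl !dotBl !dotDl /W !dotBl !dotNl.
  by move=> h1 h2; split; lra.
have Gs : symmetric (addedge b z (addedge a x H)) by do 2!apply: addedge_sym.
have HG y y' : H y y' -> addedge b z (addedge a x H) y y' by rewrite /addedge => ->.
have nH y y' : ~~ e y y' -> ~~ H y y' by apply: contra => /andP[].
have unit a1 b1 : ~~ e a1 b1 -> exists2 m, fixed m &
    strain p m a x = pairing R a1 b1 a x /\ strain p m b z = pairing R a1 b1 b z.
  move=> n1; have [m mH hm] := unit_strain Hs Gs HG ind (nH _ _ n1).
  have [c [t hf]] := fixing m mH; exists (fun y => m y - rigid_field c t (p y)) => //.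
  have E y y' : strain p (fun y => m y - rigid_field c t (p y)) y y' = strain p m y y'.
    rewrite -[RHS]subr0 -(rigid_strain c t (p y) (p y')) /strain -dotBr; congr dot.
    by apply/rowP=> k; rewrite !vecE; ring.
  by rewrite !E !hm //= ?eqxx ?orbT.
have [m1 f1 [s1 s1']] := unit a x nax; have [m2 f2 [s2 s2']] := unit b z nbz.
have ax : a != x by apply: contraNneq xX => <-.
have az : a != z by apply: contraNneq zX => <-.
have bx : b != x by apply: contraNneq xX => <-.
rewrite /pairing !eqxx /= ?(negPf ab) ?(negPf az) ?(negPf bx) /= in s1 s1' s2 s2'.
rewrite eq_sym (negPf ab) in s1'.
have sx m y y' : fixed m -> y \in X -> dot (p y' - p y) (m y') = strain p m y y'.
  by move=> [_ h] yX; rewrite /strain (h y yX) sub0r dotNr -dotNl opprB.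
have W0 m : fixed m -> W m = 0.
  move=> hm; apply/eqP; apply/negPn/negP => Wm.
  have A1 : dot (p x - p a) (m1 x) = 1 by rewrite sx.
  have A2 : dot (p x - p a) (m2 x) = 0 by rewrite sx.
  have W2 : W m2 = 0.
    by have [h _] := lin _ _ f1 f2 (p x - p a); rewrite A1 A2 mul1r mul0r in h.
  have A0 d : dot d (m2 x) = 0.
    have [h _] := lin _ _ f2 hm d; rewrite W2 mulr0 in h.
    by move/eqP: h; rewrite mulf_eq0 (negPf Wm) orbF => /eqP.
  have AB d : dot d (m1 x) * dot d (m2 z) = 0.
    by have [_ h] := lin _ _ f1 f2 d; rewrite A0 mul0r in h.
  have B2 : dot (p z - p b) (m2 z) = 1 by rewrite sx.
  have h0 := AB (p x - p a); rewrite A1 mul1r in h0.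
  have h1 := AB (p x - p a + (p z - p b)).
  have h2 := AB (p x - p a - (p z - p b)).
  rewrite dotDl A1 [X in _ * X = _]dotDl h0 B2 in h1.
  rewrite dotBl A1 [X in _ * X = _]dotBl h0 B2 in h2.
  have /eqP : (1 : R) = 0 by lra.
  by rewrite oner_eq0.
have cX4 : #|z |: X| = 4%N by rewrite cardsU1 zX cX.
have [k [k0 k1 kq]] := barycentric q0 affz cX4.
have kout u : ~~ e v u -> k u = 0.
  rewrite nv !negb_or => /and3P[uX ux uz]; apply: k0.
  by rewrite in_setU1 negb_or uz.
have kx : k x = 0 by apply: k0; rewrite in_setU1 negb_or xz.
have kb : \sum_u k u *: (q0 - p u) = 0.
  by rewrite sum_scaleB k1 scale1r kq subrr.
have [|w hw wk] := extend_stress es ei kout kb.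
  move=> m hm; have [c [t hf]] := fixing m hm.
  set m' := (fun _ => _) in hf; have hz := W0 _ hf.
  have E y : k y * dot (p y - q0) (m y) =
      k y * dot (p y - q0) (m' y) - dot (k y *: (q0 - p y)) (rigid_field c t q0).
    have h := rigid_strain c t (p y) q0; rewrite dotBr in h.
    rewrite dotZl -mulrBr /m' dotBr -(opprB (p y)) dotNl; congr (_ * _); lra.
  under eq_bigr do rewrite E.
  rewrite sumrB -dot_suml kb dot0l subr0 big1 // => y _.
  have [yX|yX] := boolP (y \in X); first by rewrite hf.2 // dot0r mulr0.
  have [->|yz] := eqVneq y z; last by rewrite k0 ?mul0r // in_setU1 negb_or yz.
  have -> : p z - q0 = 2^-1 *: (p z - p x).
    by apply/rowP=> j; rewrite /q0 /midpoint !vecE; field.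
  by rewrite dotZl -/(W m') hz !mulr0.
move=> hind; have wv : forall u, w v u = 0.
  move=> u; apply: hind; split; last exact: hw.2.
  split; first exact: hw.1.1.
  move=> y y'; rewrite /= negb_and negbK => /orP[/hw.1.2 //|].
  by move=> /orP[] /andP[/eqP -> /eqP ->]; [|rewrite hw.1.1]; rewrite wk.
have : \sum_u k u = 0 by rewrite big1 // => u _; rewrite -wk wv.
by rewrite k1 => /eqP; rewrite oner_eq0.
Qed.

(** Only the outer bars are concerned, so the vertices of the tetrahedron may be placed
    anywhere: [v1] and [v2] go to one point, and [v4] to the midpoint of [x4] and [z4].
    As the bar [v4 x4] is missing, the moments about the
    common point of [v1] and [v2] show that the bars at [v3] and [v4] are unstressed,
    and what remains is a vertex with the four neighbours [x1], [z1], [x2], [z2]. *)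
Lemma tetrahedron_bodyindep e (v1 v2 v3 v4 x1 z1 x2 z2 x3 z3 x4 z4 a b : V) :
  let X := [set v1; v2; v3; v4] in let T := [:: x1; z1; x2; z2] in
  symmetric e -> irreflexive e -> uniq [:: v1; v2; v3; v4] -> uniq T ->
  x3 != z3 -> x4 != z4 ->
  (forall y, y \in [:: x1; z1; x2; z2; x3; z3; x4; z4] -> y \notin X) ->
  (forall y, y \notin X -> e v1 y -> y \in [:: x1; z1]) ->
  (forall y, y \notin X -> e v2 y -> y \in [:: x2; z2]) ->
  (forall y, y \notin X -> e v3 y -> y \in [:: x3; z3]) ->
  (forall y, y \notin X -> e v4 y -> y \in [:: x4; z4]) ->
  a \in T -> b \in T -> a != b -> ~~ e a b ->
  (exists p, @indep R V (addedge a b (delset X e)) p) ->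
  exists p, bodyindep X (deledge v4 x4 e) (update p v4 (@midpoint p x4 z4)).
Proof.
move=> X T es ei uv uT d3 d4 TX o1 o2 o3 o4 aT bT ab nab hex.
pose J : rel V := delset X e.
pose K : rel V := fun x y => [|| J x y, (x == v1) && (y \in T) | (y == v1) && (x \in T)].
have Js : symmetric J by apply: delset_sym.
have := uv; rewrite /= !inE !negb_or => /and4P[/and3P[d12 d13 d14] /andP[d23 d24] d34 _].
have v1X : v1 \in X by rewrite !inE eqxx.
have v2X : v2 \in X by rewrite !inE eqxx ?orbT.
have v3X : v3 \in X by rewrite !inE eqxx ?orbT.
have v4X : v4 \in X by rewrite !inE eqxx ?orbT.
have outT y : y \in T -> y \notin X.
  by move=> yT; apply: TX; rewrite -[[:: _, _, _, _ & _]]/(T ++ _) mem_cat yT.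
have [n3x n3z n4x n4z] : [/\ x3 \notin X, z3 \notin X, x4 \notin X & z4 \notin X].
  by split; apply: TX; rewrite !inE eqxx ?orbT.
have v1T : v1 \notin T by apply/negP => /outT; rewrite v1X.
have Ks : symmetric K by move=> x y; rewrite /K Js [X in _ || X]orbC.
have Ki : irreflexive K.
  move=> x; rewrite /K /J /= ei /= orbb; apply/negP => /andP[/eqP -> ].
  by rewrite (negPf v1T).
have XJ x y : x \in X \/ y \in X -> J x y = false.
  by move=> [] h; rewrite /J /= h ?andbF.
have K1 y : K v1 y = (y \in T).
  rewrite /K XJ; last by left.
  by rewrite eqxx (negPf v1T) andbF orbF.
have [p [indK gp]] : exists p, @indep R V K p /\ generalpos p.
  apply: zopen_meet; [exact: zopen_indep|exact: zopen_generalpos| |exact: generalpos_exists].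
  apply: (@extension1 R V K v1 a b) => //; rewrite ?K1 //.
  - rewrite (_ : [set _ | _] = [set y in T]); last by apply/setP=> y; rewrite !inE K1 !inE.
    by rewrite cardsE (card_uniqP uT).
  - have aX := outT _ aT; have bX := outT _ bT.
    rewrite /K /J /= (negPf nab) /=; apply/norP; split.
      by apply: contra aX => /andP[/eqP ->].
    by apply: contra bX => /andP[/eqP ->].
  - case: hex => p hp; exists p; apply: sub_indep hp => x y.
    case/orP=> [/and3P[Kxy]|h]; last by apply/orP; right.
    rewrite !in_set1 => /negPf xv /negPf yv; apply/orP; left.
    by move: Kxy; rewrite /K xv yv /= orbF.
pose p' := update p v2 (p v1); exists p'.
set q := update p' v4 _; set e1 := deledge v4 x4 e.
have qo y : y \notin X -> q y = p y.
  move=> yX; have /negPf y4 : y != v4 by apply: contraNneq yX => ->.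
  have /negPf y2 : y != v2 by apply: contraNneq yX => ->.
  by rewrite /q /p' /update y4 y2.
have qv1 : q v1 = p v1 by rewrite /q /p' /update (negPf d14) (negPf d12).
have qv2 : q v2 = p v1 by rewrite /q /p' /update (negPf d24) eqxx.
have qv3 : q v3 = p v3 by rewrite /q /p' /update (negPf d34) eq_sym (negPf d23).
have qv4 : q v4 = midpoint p x4 z4.
  have /negPf x42 : x4 != v2 by apply: contraNneq n4x => ->.
  have /negPf z42 : z4 != v2 by apply: contraNneq n4z => ->.
  by rewrite /q {1}/update eqxx /midpoint /p' /update x42 z42.
have sumX (W : nmodType) (f : V -> W) : \sum_(v in X) f v = f v1 + f v2 + f v3 + f v4.
  have -> : \sum_(v in X) f v = \sum_(v in [:: v1; v2; v3; v4]) f v.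
    by apply: eq_bigl => v; rewrite !inE !orbA.
  by rewrite -big_uniq //= !big_cons big_nil addr0 !addrA.
have c4 y1 y2 : y1 != y2 -> y1 \notin X -> y2 \notin X -> uniq [:: v1; v3; y1; y2].
  move=> y12 y1X y2X; rewrite /= !inE !negb_or d13 y12 /= andbT.
  by apply/andP; split; apply/andP; split; [apply: contraNneq y1X|apply: contraNneq y2X|
    apply: contraNneq y1X|apply: contraNneq y2X] => <-.
have det y1 y2 : y1 != y2 -> y1 \notin X -> y2 \notin X ->
    dot (p v3 - p v1) (cross (p y1 - p v1) (p y2 - p v1)) != 0.
  move=> y12 y1X y2X; apply: det_affindep; first exact: c4.
  apply: gp; rewrite -!setUA !cardsU1 cards1.
  by case: (_ \notin _); case: (_ \notin _); case: (_ \notin _).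
move=> w [sw w0] hout hF hM.
have wX x y : x \in X -> y \in X -> w x y = 0 by move=> xX yX; rewrite w0 //= xX yX andbF.
have we x y : ~~ e x y -> w x y = 0 by move=> nxy; rewrite w0 // /e1 /= (negPf nxy).
have w4x : w v4 x4 = 0 by rewrite w0 // /e1 /= !eqxx /= !andbF.
have two v x z : v \in X -> x != z -> (forall y, y \notin X -> e v y -> y \in [:: x; z]) ->
    force q w v = w v x *: (q v - q x) + w v z *: (q v - q z).
  move=> vX xz o; rewrite /force (bigD1 x) //= (bigD1 z) 1?eq_sym //= big1 ?addr0 //.
  move=> y /andP[yx yz]; have [yX|yX] := boolP (y \in X); first by rewrite wX ?scale0r.
  rewrite we ?scale0r //; apply/negP => /(o y yX).
  by rewrite !inE (negPf yx) (negPf yz).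
have f3 := two _ _ _ v3X d3 o3; have f4 := two _ _ _ v4X d4 o4.
rewrite w4x scale0r add0r qv4 qo // in f4; rewrite qv3 !qo // in f3.
have moment : cross (p v3 - p v1) (force q w v3) +
    cross (midpoint p x4 z4 - p v1) (force q w v4) = 0.
  have : \sum_(v in X) cross (q v - p v1) (force q w v) = 0.
    under eq_bigr do rewrite crossBl.
    by rewrite sumrB hM -cross_sumr hF cross0r subrr.
  by rewrite sumX qv1 qv2 qv3 qv4 subrr !cross0l !add0r.
have w4z : w v4 z4 = 0.
  apply/eqP; have := det _ _ d4 n4x n4z; apply: contraNT => wn.
  move/(congr1 (dot (p v3 - p v1))): moment; rewrite dotDr dot_crossl add0r dot0r f4.
  rewrite crossZr dotZr => /eqP; rewrite mulf_eq0 (negPf wn) /= => /eqP h.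
  apply/eqP; rewrite -[RHS](mulr0 (- 2)) -h /midpoint; rewrite !vecE; field.
  by [].
have [w3x w3z] : w v3 x3 = 0 /\ w v3 z3 = 0.
  move: moment; rewrite f4 w4z scale0r cross0r addr0 f3 => h.
  have dn := det _ _ d3 n3x n3z.
  split; apply: (mulIf dn); rewrite mul0r.
    rewrite -[LHS]opprK; apply/eqP; rewrite oppr_eq0; apply/eqP.
    by move/(congr1 (dot (p z3 - p v1))): h; rewrite dot0r => h; rewrite -[RHS]h; vec_ring.
  by move/(congr1 (dot (p x3 - p v1))): h; rewrite dot0r => h; rewrite -[RHS]h; vec_ring.
have w3 y : w v3 y = 0.
  have [->//|y1] := eqVneq y x3; have [->//|y2] := eqVneq y z3.
  have [yX|yX] := boolP (y \in X); first exact: wX.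
  by rewrite we //; apply/negP => /(o3 y yX); rewrite !inE (negPf y1) (negPf y2).
have w4 y : w v4 y = 0.
  have [->//|y1] := eqVneq y x4; have [->//|y2] := eqVneq y z4.
  have [yX|yX] := boolP (y \in X); first exact: wX.
  by rewrite we //; apply/negP => /(o4 y yX); rewrite !inE (negPf y1) (negPf y2).
pose w' x y := if x \in X then (if y \in X then 0 else if x == v1 then w v1 y + w v2 y else 0)
  else if y \in X then (if y == v1 then w v1 x + w v2 x else 0) else w x y.
have w'0 : forall x y, w' x y = 0.
  apply: indK; split; first split.
  - by move=> x y; rewrite /w'; case: (x \in X); case: (y \in X).
  - move=> x y; have side z u : u \notin X -> ~~ K z u -> z == v1 -> w v1 u + w v2 u = 0.
      move=> uX nk /eqP hz; rewrite hz K1 in nk.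
      rewrite !we ?addr0 //; apply: contra nk => /[dup] h.
        by move=> /(o2 _ uX); rewrite !inE => /orP[] ->; rewrite ?orbT.
      by move=> /(o1 _ uX); rewrite !inE => /orP[] ->; rewrite ?orbT.
    rewrite /w'; case: ifP => xX; case: ifP => yX nK //.
    + by case: ifP => // h; apply: (side x y); rewrite ?yX.
    + by case: ifP => // h; apply: (side y x); rewrite ?xX ?h // Ks.
    + by apply: we; move: nK; rewrite /K /J /= xX yX /= andbT => /norP[].
  - move=> x; have [xX|xX] := boolP (x \in X); last first.
      have := hout x xX; rewrite /force (bigID (mem X)) /= sumX => h.
      rewrite (bigID (mem X)) /= sumX -[RHS]h; congr (_ + _); last first.
        by apply: eq_bigr => y yX; rewrite /w' (negPf xX) (negPf yX) !qo.
      rewrite /w' (negPf xX) v1X v2X v3X v4X eqxx !(eq_sym _ v1).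
      rewrite (negPf d12) (negPf d13) (negPf d14) !scale0r !addr0.
      rewrite !(sw x) w3 w4 !scale0r !addr0 qv1 qv2 qo // -scalerDl.
      by [].
    have [->|xv] := eqVneq x v1; last first.
      by rewrite /force big1 // => y _; rewrite /w' xX (negPf xv); case: ifP; rewrite scale0r.
    have : force q w v1 + force q w v2 = 0.
      by have := hF; rewrite sumX f4 w4z scale0r addr0 f3 w3x w3z !scale0r !addr0.
    rewrite /force -big_split /= => h; rewrite -[RHS]h; apply: eq_bigr => y _.
    rewrite qv1 qv2 -scalerDl /w' v1X eqxx; case: ifP => yX.
      by rewrite !wX // addr0 !scale0r.
    by rewrite qo ?yX.
have w1 y : y \notin X -> w v1 y = 0 /\ w v2 y = 0.
  move=> yX; have := w'0 v1 y; rewrite /w' v1X (negPf yX) eqxx => h.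
  have [h1|h1] := boolP (e v1 y); last by rewrite we //; move: h; rewrite we // add0r.
  have h2 : w v2 y = 0.
    rewrite we //; apply/negP => h2; have := o1 _ yX h1; have := o2 _ yX h2.
    move: uT; rewrite /= !inE !negb_or => /and4P[/and3P[_ q1 q2] /andP[q3 q4] _ _].
    by move=> /orP[] /eqP -> /orP[] /eqP E; rewrite E eqxx in q1 q2 q3 q4.
  by rewrite h2 addr0 in h.
have wXo x y : x \in X -> y \notin X -> w x y = 0.
  move=> xX yX; move: xX; rewrite !inE -!orbA => /or4P[] /eqP ->; rewrite ?w3 ?w4 //.
    by case: (w1 _ yX).
  by case: (w1 _ yX).
move=> x y; have [xX|xX] := boolP (x \in X); have [yX|yX] := boolP (y \in X).
- exact: wX.
- exact: wXo.
- by rewrite sw wXo.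
- by have := w'0 x y; rewrite /w' (negPf xX) (negPf yX).
Qed.

(** If the graph were dependent everywhere then [midpoint_dependent] would give a stress
    without the bar [v4 x4] when [v4] lies at the midpoint of [x4] and [z4], but for
    suitable such positions [tetrahedron_bodyindep] leaves only stresses of the
    tetrahedron itself, and an affinely independent one has none. *)
Lemma tetrahedron_indep e (v1 v2 v3 v4 x1 z1 x2 z2 x3 z3 x4 z4 a b a' b' : V) :
  let X := [set v1; v2; v3; v4] in let T := [:: x1; z1; x2; z2] in
  symmetric e -> irreflexive e -> uniq [:: v1; v2; v3; v4] -> uniq T ->
  x3 != z3 -> x4 != z4 ->
  (forall y, y \in [:: x1; z1; x2; z2; x3; z3; x4; z4] -> y \notin X) ->
  (forall y, y \notin X -> e v1 y -> y \in [:: x1; z1]) ->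
  (forall y, y \notin X -> e v2 y -> y \in [:: x2; z2]) ->
  (forall y, y \notin X -> e v3 y -> y \in [:: x3; z3]) ->
  (forall y, y \notin X -> e v4 y = (y \in [:: x4; z4])) ->
  (forall y y', y \in X -> y' \in X -> y != y' -> e y y') ->
  a \in T -> b \in T -> a != b -> ~~ e a b ->
  (exists p, @indep R V (addedge a b (delset X e)) p) ->
  a' \in [:: v1; v2; v3] -> b' \in [:: v1; v2; v3] -> a' != b' -> ~~ e a' x4 -> ~~ e b' z4 ->
  (exists p, @indep R V (addedge b' z4 (addedge a' x4 (delset [set v4] e))) p) ->
  exists p, @indep R V e p.
Proof.
move=> X T es ei uv uT d3 d4 TX o1 o2 o3 o4 cliq aT bT ab nab hJ a'X b'X ab' na' nb' hH.
apply: contrapT => none.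
have dep p : ~ indep e p by move=> h; apply: none; exists p.
have := uv; rewrite /= !inE !negb_or => /and4P[/and3P[d12 d13 d14] /andP[d23 d24] d34 _].
pose Y : {set V} := [set v1; v2; v3].
have XE : X = v4 |: Y.
  by apply/setP=> y; rewrite !inE [RHS]orbC.
have YX y : y \in Y -> y \in X by move=> yY; rewrite XE in_setU1 yY orbT.
have [nx nz] : x4 \notin X /\ z4 \notin X by split; apply: TX; rewrite !inE eqxx ?orbT.
have v4Y : v4 \notin Y by rewrite !inE !negb_or !(eq_sym v4) d14 d24 d34.
have cY : #|Y| = 3%N by rewrite /Y -setUA !cardsU1 cards1 !inE negb_or d12 d13 d23.
have xY : x4 \notin Y by apply: contra nx => /YX.
have zY : z4 \notin Y by apply: contra nz => /YX.
have v4X : v4 \in X by rewrite XE setU11.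
pose g p := update p v4 (midpoint p x4 z4).
have gline p0 p1 t : g (line p0 p1 t) = line (g p0) (g p1) t by apply: at_midpoint_line.
have h1 : exists p, bodyindep X (deledge v4 x4 e) (g p).
  apply: (tetrahedron_bodyindep es ei uv uT d3 d4 TX o1 o2 o3 _ aT bT ab nab hJ).
  by move=> y yX; rewrite o4.
(* [x4] and [z4] are moved to the old position of [v4], so that [g] keeps it there *)
have h2 : exists p : conf, affindep (g p) X.
  have [p gp] := @generalpos_exists R V; exists (update (update p x4 (p v4)) z4 (p v4)).
  have affX : affindep p X by apply: gp; rewrite XE cardsU1 v4Y cY.
  move=> c c0 c1 cp; apply: affX => //; rewrite -[RHS]cp; apply: eq_bigr => u _.
  have [uX|/c0->] := boolP (u \in X); last by rewrite !scale0r.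
  have ux : u != x4 by apply: contraNneq nx => <-.
  have uz : u != z4 by apply: contraNneq nz => <-.
  rewrite /g /update; case: eqP => [->|_]; last by rewrite (negPf ux) (negPf uz).
  rewrite /midpoint /update eqxx (negPf d4) eqxx; congr (_ *: _).
  by apply/rowP=> k; rewrite !vecE; field.
have [p [[b1 b2] [b3 b4]]] : exists p,
    (bodyindep X (deledge v4 x4 e) (g p) /\ affindep (g p) X) /\
    (indep (addedge b' z4 (addedge a' x4 (delset [set v4] e))) p /\ generalpos p).
  have z1' := zopen_pull gline (@zopen_bodyindep R V X (deledge v4 x4 e)).
  have z2' := zopen_pull gline (@zopen_affindep R V X).
  apply: zopen_meet; first exact: zopen_and.
  - by apply: zopen_and; [exact: zopen_indep|exact: zopen_generalpos].
  - exact: zopen_meet.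
  - apply: zopen_meet => //; [exact: zopen_indep|exact: zopen_generalpos|].
    exact: generalpos_exists.
have e1s : irreflexive (deledge v4 x4 e) by move=> y /=; rewrite ei.
apply: (@midpoint_dependent e p Y v4 x4 z4 a' b') => //.
- by move=> y y' yY y'Y; apply: cliq; apply: YX.
- move=> u; have [uX|uX] := boolP (u \in X); last first.
    by rewrite o4 // !inE; move: uX; rewrite XE in_setU1 negb_or => /andP[_ uY]; move: uY;
       rewrite !inE => /negPf ->.
  have -> : (u == x4) = false by apply: contraNF nx => /eqP <-.
  have -> : (u == z4) = false by apply: contraNF nz => /eqP <-.
  rewrite !orbF; move: (uX); rewrite XE in_setU1; case: eqVneq => [-> _|u4 /= uY].
    by rewrite ei (negPf v4Y).
  by rewrite uY cliq // eq_sym.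
- by move: a'X; rewrite !inE orbA.
- by move: b'X; rewrite !inE orbA.
- by apply: b4; rewrite cardsU1 zY cY.
- by rewrite -XE.
- by apply: (body_glue b1); apply: affindep_clique.
Qed.

End Tetrahedra.

Local Close Scope ring_scope.

(** * Sparse graphs *)

Section Counting.
Variable V : finType.
Implicit Types (e : rel V) (X Y Z : {set V}).

Definition dg e X v : nat := \sum_(u in X) e v u.
Definition cnt e X Y : nat := \sum_(v in X) dg e Y v.
(** Ordered pairs of adjacent vertices are counted, so that this is twice the number of
    edges inside [X]. *)
Definition dd e X : nat := cnt e X X.

Lemma dg_card e X v : dg e X v = #|[set u in X | e v u]|.
Proof.
rewrite -sum1_card /dg [LHS]big_mkcond [RHS]big_mkcond; apply: eq_bigr => u _.
by rewrite inE; case: (u \in X); case: (e v u).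
Qed.

Lemma sumU (f : V -> nat) X Y : [disjoint X & Y] ->
  \sum_(v in X :|: Y) f v = \sum_(v in X) f v + \sum_(v in Y) f v.
Proof. by move=> XY; rewrite -bigU //; apply: eq_bigl => v; rewrite !inE. Qed.

Lemma dgU e X Y v : [disjoint X & Y] -> dg e (X :|: Y) v = dg e X v + dg e Y v.
Proof. exact: sumU. Qed.
Lemma cntUl e X Y Z : [disjoint X & Y] -> cnt e (X :|: Y) Z = cnt e X Z + cnt e Y Z.
Proof. exact: sumU. Qed.
Lemma cntUr e X Y Z : [disjoint X & Y] -> cnt e Z (X :|: Y) = cnt e Z X + cnt e Z Y.
Proof. by move=> h; rewrite /cnt -big_split; apply: eq_bigr => v _; exact: dgU. Qed.
Lemma cntC e X Y : symmetric e -> cnt e X Y = cnt e Y X.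
Proof.
move=> es; rewrite /cnt /dg exchange_big; apply: eq_bigr => v _.
by apply: eq_bigr => u _; rewrite es.
Qed.
Lemma cnt1 e X v : cnt e [set v] X = dg e X v.
Proof. by rewrite /cnt big_set1. Qed.
Lemma dg1 e u v : dg e [set u] v = e v u.
Proof. by rewrite /dg big_set1. Qed.
Lemma ddU e X Y : symmetric e -> [disjoint X & Y] ->
  dd e (X :|: Y) = dd e X + dd e Y + 2 * cnt e X Y.
Proof. by move=> es h; rewrite /dd cntUl // !cntUr // (cntC Y) //; lia. Qed.
Lemma dgU1 e X u v : u \notin X -> dg e (u |: X) v = e v u + dg e X v.
Proof. by move=> h; rewrite dgU ?dg1 // disjoints1. Qed.
Lemma ddU1 e X v : symmetric e -> irreflexive e -> v \notin X ->
  dd e (v |: X) = dd e X + 2 * dg e X v.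
Proof.
by move=> es ei h; rewrite ddU ?disjoints1 // /dd !cnt1 dg1 ei add0n.
Qed.
Lemma ddD1 e X v : symmetric e -> irreflexive e -> v \in X ->
  dd e X = dd e (X :\ v) + 2 * dg e X v.
Proof.
move=> es ei h; rewrite -{1}(setD1K h) ddU1 ?in_setD1 ?eqxx //.
by congr (_ + 2 * _); rewrite -[in RHS](setD1K h) dgU1 ?ei ?in_setD1 ?eqxx.
Qed.

Lemma dg_mono e X Y v : X \subset Y -> dg e X v <= dg e Y v.
Proof.
move=> h; rewrite /dg !(big_mkcond (fun u => u \in _)); apply: leq_sum => u _.
by case: ifP => // uX; rewrite (subsetP h).
Qed.
Lemma dg_sub e e' X v : (forall u, e v u -> e' v u) -> dg e X v <= dg e' X v.
Proof. by move=> h; apply: leq_sum => u _; have := h u; case: (e v u) => // ->. Qed.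
Lemma dd_sub e e' X : (forall u v, e u v -> e' u v) -> dd e X <= dd e' X.
Proof. by move=> h; apply: leq_sum => v _; apply: dg_sub => u; apply: h. Qed.
Lemma eq_cnt e e' X Y : {in X & Y, e =2 e'} -> cnt e X Y = cnt e' X Y.
Proof. by move=> h; apply: eq_bigr => v vX; apply: eq_bigr => u uX; rewrite h. Qed.

Lemma dd_le e X : irreflexive e -> dd e X + #|X| <= #|X| * #|X|.
Proof.
move=> ei; rewrite -{1}sum1_card /dd /cnt -big_split /=.
have -> : #|X| * #|X| = \sum_(v in X) #|X| by rewrite sum_nat_const.
apply: leq_sum => v vX; rewrite dg_card (cardsD1 v X) vX addnC leq_add2l.
apply/subset_leq_card/subsetP => u; rewrite !inE => /andP[-> evu]; rewrite andbT.
by apply: contraTneq evu => ->; rewrite ei.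
Qed.
Lemma cnt_cols e X Y n : symmetric e -> {in Y, forall y, dg e X y <= n} -> cnt e X Y <= n * #|Y|.
Proof.
by move=> es h; rewrite cntC // mulnC -sum_nat_const; apply: leq_sum.
Qed.
Lemma cnt_rows e X Y n : {in X, forall y, dg e Y y <= n} -> cnt e X Y <= n * #|X|.
Proof. by move=> h; rewrite mulnC -sum_nat_const; apply: leq_sum. Qed.

Lemma dd_supermodular e X Y : symmetric e ->
  dd e X + dd e Y <= dd e (X :|: Y) + dd e (X :&: Y).
Proof.
move=> es; pose A := X :\: Y; pose B := Y :\: X; pose C := X :&: Y.
have dAC : [disjoint A & C] by rewrite -setI_eq0; apply/eqP/setP=> v; rewrite !inE; do 2!case: (_ \in _).
have dBC : [disjoint B & C] by rewrite -setI_eq0; apply/eqP/setP=> v; rewrite !inE; do 2!case: (_ \in _).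
have dX : [disjoint A & Y] by rewrite -setI_eq0; apply/eqP/setP=> v; rewrite !inE; do 2!case: (_ \in _).
have -> : X :|: Y = A :|: Y by apply/setP=> v; rewrite !inE; do 2!case: (_ \in _).
rewrite ddU // -/C; have EX : X = A :|: C by apply/setP=> v; rewrite !inE; do 2!case: (_ \in _).
have EY : Y = B :|: C by apply/setP=> v; rewrite !inE; do 2!case: (_ \in _).
rewrite {1}EX ddU // [in cnt e A Y]EY cntUr //; lia.
Qed.

Lemma dg_compl e X v : dg e setT v = dg e X v + dg e (~: X) v.
Proof. by rewrite -dgU ?setUCr // -setI_eq0 setICr. Qed.
Lemma cnt_compl e X : \sum_(v in X) dg e setT v = dd e X + cnt e X (~: X).
Proof. by rewrite /dd /cnt -big_split; apply: eq_bigr => v _; exact: dg_compl. Qed.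

Lemma dd_even e X : symmetric e -> irreflexive e -> ~~ odd (dd e X).
Proof.
move=> es ei; have [n] := ubnP #|X|; elim: n X => // n IH X.
have [->|/set0Pn[v vX]] := eqVneq X set0; first by rewrite /dd /cnt big_set0.
rewrite (ddD1 es ei vX) (cardsD1 v) vX add1n ltnS => /IH h.
by rewrite oddD (negPf h) mul2n odd_double.
Qed.

(** Both sides of the count are doubled. *)
Definition sparse e := forall X, 3 <= #|X| -> dd e X + 12 <= 6 * #|X|.
Definition tight e X := 3 <= #|X| /\ dd e X + 12 = 6 * #|X|.
Definition maxdeg5 e := forall v, dg e setT v <= 5.

Lemma sub_sparse e e' : (forall u v, e u v -> e' u v) -> sparse e' -> sparse e.
Proof. by move=> h s X /s; have := dd_sub X h; lia. Qed.
Lemma sub_maxdeg5 e e' : (forall u v, e u v -> e' u v) -> maxdeg5 e' -> maxdeg5 e.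
Proof. by move=> h s v; apply: leq_trans (s v); apply: dg_sub => u; apply: h. Qed.

(** Otherwise removing [v] would leave a set that is not sparse. *)
Lemma tight_dg e X v : symmetric e -> irreflexive e -> sparse e -> tight e X -> 4 <= #|X| ->
  v \in X -> 3 <= dg e X v.
Proof.
move=> es ei sp [_ tX] cX vX; have := ddD1 es ei vX; have := cardsD1 v X; rewrite vX => h h'.
by have := sp (X :\ v); lia.
Qed.

Lemma tightU e X Y : symmetric e -> sparse e -> tight e X -> tight e Y -> 3 <= #|X :&: Y| ->
  tight e (X :|: Y).
Proof.
move=> es sp [cX tX] [cY tY] cI; have := cardsUI X Y; have := dd_supermodular X Y es.
have := sp _ cI; have cU : 3 <= #|X :|: Y|.
  by apply: leq_trans cX _; apply: subset_leq_card; apply: subsetUl.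
by have := sp _ cU; split => //; lia.
Qed.

Lemma dd_pair e X a b : symmetric e -> irreflexive e -> a != b -> ~~ e a b -> a \in X -> b \in X ->
  dd e X + #|X| + 2 <= #|X| * #|X|.
Proof.
move=> es ei ab nab aX bX.
have := dd_le X (addedge_irr ab ei); set e' := addedge a b e.
have : dd e X + 2 <= dd e' X.
  have bXa : b \in X :\ a by rewrite in_setD1 eq_sym ab.
  have es' : symmetric e' by apply: addedge_sym.
  have ei' : irreflexive e' by apply: addedge_irr.
  rewrite (ddD1 es ei aX) (ddD1 es' ei' aX).
  have : dd e (X :\ a) <= dd e' (X :\ a) by apply: dd_sub => u v /=; rewrite /e' /= => ->.
  rewrite -(setD1K bX) !dgU1 ?in_setD1 ?eqxx //.
  have : dg e (X :\ b) a <= dg e' (X :\ b) a by apply: dg_sub => u /=; rewrite /e' /= => ->.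
  rewrite (negPf nab) /e' /= !eqxx orbT; lia.
lia.
Qed.

Lemma tight_nonadj e X a b : symmetric e -> irreflexive e -> tight e X -> a != b -> ~~ e a b ->
  a \in X -> b \in X -> 4 <= #|X|.
Proof.
move=> es ei [cX tX] ab nab aX bX; have := dd_pair es ei ab nab aX bX.
have [//|] := leqP 4 #|X|; move=> h; have -> : #|X| = 3 by lia.
lia.
Qed.

Lemma dd_addedge e a b X : symmetric e -> irreflexive e -> a != b -> ~~ e a b ->
  dd (addedge a b e) X = dd e X + 2 * ((a \in X) && (b \in X)).
Proof.
move=> es ei ab nab; have es' : symmetric (addedge a b e) by apply: addedge_sym.
have ei' : irreflexive (addedge a b e) by apply: addedge_irr.
have out Y c : c \in [:: a; b] -> c \notin Y -> dd (addedge a b e) Y = dd e Y.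
  move=> hc cY; apply: eq_cnt => x y xY yY /=.
  have xc : x != c by apply: contraNneq cY => <-.
  have yc : y != c by apply: contraNneq cY => <-.
  move: hc; rewrite !inE => /orP[] /eqP E; rewrite -E (negPf xc) (negPf yc) /= ?andbF ?orbF //.
have [aX|aX] := boolP (a \in X); last by rewrite (out X a) ?inE ?eqxx //; lia.
have [bX|bX] := boolP (b \in X); last by rewrite (out X b) ?inE ?eqxx ?orbT //; lia.
rewrite (ddD1 es ei aX) (ddD1 es' ei' aX) (out (X :\ a) a) ?in_setD1 ?eqxx ?inE ?eqxx //.
rewrite -(setD1K bX) !dgU1 ?in_setD1 ?eqxx //.
have -> : dg (addedge a b e) (X :\ b) a = dg e (X :\ b) a.
  apply: eq_bigr => u; rewrite in_setD1 => /andP[ub _] /=.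
  by rewrite eqxx (negPf ub) (negPf ab) /= orbF.
by rewrite /= !eqxx (negPf nab) /=; lia.
Qed.

(** A new edge can only violate the count of a set that was tight, since the numbers
    [dd] are even. *)
Lemma addedge_sparse e a b : symmetric e -> irreflexive e -> a != b -> ~~ e a b -> sparse e ->
  (forall X, a \in X -> b \in X -> 4 <= #|X| -> ~ tight e X) -> sparse (addedge a b e).
Proof.
move=> es ei ab nab sp h X cX; rewrite dd_addedge //; have h1 := sp X cX.
case: (boolP (a \in X)) => aX; case: (boolP (b \in X)) => bX; try by rewrite muln0; lia.
have nt : ~ tight e X.
  by move=> tX; apply: (h X aX bX (tight_nonadj es ei tX ab nab aX bX) tX).
have : dd e X + 12 != 6 * #|X| by apply/eqP => E; apply: nt.
have := dd_even X es ei; lia.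
Qed.

End Counting.

(** * Vertices with four neighbours in sparse graphs *)
Section Degrees.
Variable V : finType.
Implicit Types (e : rel V) (X Y Z : {set V}).

Lemma set_maximal (P : {set V} -> Prop) (f : {set V} -> nat) :
  (exists X, P X) -> exists X, P X /\ forall Y, P Y -> f Y <= f X.
Proof.
move=> [X0 P0]; have P0' : `[< P X0 >] by apply/asboolP.
case: (arg_maxnP (P := fun X => `[< P X >]) f P0') => X /asboolP PX h.
by exists X; split=> // Y PY; apply: h; apply/asboolP.
Qed.

Lemma dg_delset e X Y v : dg (delset X e) Y v = if v \in X then 0 else dg e (Y :\: X) v.
Proof.
rewrite /dg [in RHS]big_mkcond [LHS]big_mkcond; case: ifP => vX.
  by rewrite big1 // => u _; rewrite /= vX andbF; case: ifP.
apply: eq_bigr => u _; rewrite /= vX !inE; case: (u \in X); case: (u \in Y) => //=.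
  by rewrite andbF.
by rewrite andbT.
Qed.

Lemma dd_delset e X Y : dd (delset X e) Y = dd e (Y :\: X).
Proof.
rewrite /dd /cnt [in RHS]big_mkcond [LHS]big_mkcond; apply: eq_bigr => v _.
by rewrite dg_delset !inE; case: (v \in X); case: (v \in Y).
Qed.

Lemma delset_sparse e X : sparse e -> sparse (delset X e).
Proof. by apply: sub_sparse => u v /andP[]. Qed.
Lemma delset_maxdeg5 e X : maxdeg5 e -> maxdeg5 (delset X e).
Proof. by apply: sub_maxdeg5 => u v /andP[]. Qed.

Lemma dgUI e X Y v : dg e (X :|: Y) v + dg e (X :&: Y) v = dg e X v + dg e Y v.
Proof.
rewrite /dg !(big_mkcond (fun u => u \in _)) -!big_split; apply: eq_bigr => u _ /=.
by rewrite !inE; case: (u \in X); case: (u \in Y); rewrite /= ?addn0.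
Qed.

Lemma dg_lt e X v : irreflexive e -> v \in X -> dg e X v < #|X|.
Proof.
move=> ei vX; rewrite (cardsD1 v X) vX add1n ltnS dg_card.
apply/subset_leq_card/subsetP => u; rewrite !inE => /andP[-> evu]; rewrite andbT.
by apply: contraTneq evu => ->; rewrite ei.
Qed.

Lemma dg_full e X v : {in X, forall u, e v u} -> dg e X v = #|X|.
Proof. by move=> h; rewrite -sum1_card; apply: eq_bigr => u /h ->. Qed.

Lemma clique_dd e X : irreflexive e -> {in X &, forall u v, u != v -> e u v} ->
  dd e X + #|X| = #|X| * #|X|.
Proof.
move=> ei h; rewrite -{1}sum1_card /dd /cnt -big_split /= -sum_nat_const.
apply: eq_bigr => v vX; rewrite -(setD1K vX) dgU1 ?in_setD1 ?eqxx // ei add0n.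
rewrite dg_full => [|u]; first by rewrite cardsU1 in_setD1 eqxx /= addnC.
by rewrite in_setD1 eq_sym => /andP[uv uX]; apply: h.
Qed.

(** Both tight sets contain at least three neighbours of [a], which has at most four:
    two of these are common, so that with [a] the sets share three vertices. *)
Lemma tight_merge e X Y a : symmetric e -> irreflexive e -> sparse e ->
  tight e X -> tight e Y -> 4 <= #|X| -> 4 <= #|Y| -> a \in X -> a \in Y ->
  dg e setT a <= 4 -> tight e (X :|: Y).
Proof.
move=> es ei sp tX tY cX cY aX aY da; apply: tightU => //.
have h1 := tight_dg es ei sp tX cX aX; have h2 := tight_dg es ei sp tY cY aY.
have h3 := dgUI e X Y a; have h4 : a \in X :&: Y by rewrite inE aX.
have := dg_lt ei h4; have := @dg_mono _ e (X :|: Y) setT a (subsetT _); lia.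
Qed.

Lemma dg_delset1 e v a : irreflexive e -> e a v -> dg (delset [set v] e) setT a + 1 = dg e setT a.
Proof.
move=> ei av; rewrite dg_delset in_set1; case: eqP => [E|_].
  by rewrite E ei in av.
by rewrite -(setD1K (in_setT v)) dgU1 ?in_setD1 ?eqxx // av addnC setD1K.
Qed.

(** Suppose that any two nonadjacent neighbours lie in a tight set of the rest, and let [X]
    be a tight set that meets the neighbourhood as much as possible.  It misses some
    neighbour [y], and [y] is adjacent to all neighbours in [X], since a further tight set
    could be merged with [X].  Now [X] with [v] and [y] has too many edges if [X] contains
    three neighbours; if it contains two then these have degree six. *)
Lemma degree4_pair e v : symmetric e -> irreflexive e -> sparse e -> maxdeg5 e ->
  dg e setT v = 4 ->
  exists a b, [/\ e v a, e v b, a != b, ~~ e a b & sparse (addedge a b (delset [set v] e))].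
Proof.
move=> es ei sp md dv; apply: contrapT => none.
pose H : rel V := delset [set v] e; pose N := [set u | e v u].
have cN : #|N| = 4.
  by rewrite -dv dg_card; apply: eq_card => u; rewrite !inE.
have Hs : symmetric H by apply: delset_sym.
have Hi : irreflexive H by apply: delset_irr.
have Hsp : sparse H by apply: delset_sparse.
have vout X : tight H X -> 4 <= #|X| -> v \notin X.
  move=> tX cX; apply/negP => vX; have := tight_dg Hs Hi Hsp tX cX vX.
  by rewrite dg_delset in_set1 eqxx.
have XD X : v \notin X -> X :\: [set v] = X.
  by move=> vX; apply/setP=> u; rewrite !inE; case: eqP => // ->; rewrite (negPf vX).
have ddH X : v \notin X -> dd H X = dd e X by move=> vX; rewrite dd_delset XD.
have dgH X u : v \notin X -> u \in N -> dg H X u = dg e X u.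
  move=> vX uN; rewrite dg_delset XD // in_set1; case: eqP => // E.
  by move: uN; rewrite E inE ei.
have dgN X : dg e X v = #|X :&: N|.
  by rewrite dg_card; apply: eq_card => u; rewrite !inE.
have blocked a b : a \in N -> b \in N -> a != b -> ~~ e a b ->
    exists X, [/\ a \in X, b \in X, 4 <= #|X| & tight H X].
  rewrite !inE => va vb ab nab; apply: contrapT => h; apply: none; exists a, b; split=> //.
  apply: addedge_sparse => //; first by apply: contra nab => /andP[].
  by move=> X aX bX cX tX; apply: h; exists X.
pose P X := [/\ tight H X, 4 <= #|X| & 2 <= #|X :&: N|].
have [X0 PX0] : exists X, P X.
  have [h|] := pselect ({in N &, forall a b, a != b -> e a b}).
    have := clique_dd ei h; rewrite cN => h1.
    have vN : v \notin N by rewrite inE ei.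
    have := sp (v |: N); rewrite cardsU1 vN cN ddU1 // (dg_full (X := N)) ?cN; last first.
      by move=> u; rewrite inE.
    by move=> /(_ isT); lia.
  move=> h; apply: contrapT => none'; apply: h => a b aN bN ab; apply/negPn/negP => nab.
  have [X [aX bX cX tX]] := blocked a b aN bN ab nab.
  apply: none'; exists X; split=> //; have <- : #|[set a; b]| = 2 by rewrite cards2 ab.
  by apply/subset_leq_card/subsetP=> u; rewrite in_setI !in_set2 => /orP[] /eqP ->; apply/andP.
have [X [[tX cX mX] maxX]] := set_maximal (fun X => #|X :&: N|) (ex_intro _ X0 PX0).
have vX := vout X tX cX; pose M := X :&: N.
have adj y a : y \in N -> y \notin X -> a \in M -> e a y.
  rewrite in_setI => yN yX /andP[aX aN]; apply/negPn/negP => nay.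
  have ya : a != y by apply: contraNneq yX => <-.
  have [Z [aZ yZ cZ tZ]] := blocked a y aN yN ya nay.
  have da : dg H setT a <= 4.
    by have := md a; rewrite -(@dg_delset1 e v a ei) ?addn1 //; rewrite es; rewrite inE in aN.
  have tU := tight_merge Hs Hi Hsp tX tZ cX cZ aX aZ da.
  have MU : y |: M \subset (X :|: Z) :&: N.
    apply/subsetP=> u; rewrite !inE => /orP[/eqP ->|/andP[-> ->] //].
    by rewrite yZ orbT; rewrite inE in yN.
  have cU : #|y |: M| = #|M|.+1 by rewrite cardsU1 inE (negPf yX).
  have := subset_leq_card MU; rewrite cU => h.
  have := maxX (X :|: Z); rewrite -/M => /(_ _) h'.
  have : P (X :|: Z).
    split=> //; last by move: mX h; rewrite -/M; lia.
    by apply: leq_trans cX _; apply: subset_leq_card; apply: subsetUl.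
  by move=> /h'; lia.
have cM : #|M| + #|N :\: X| = 4 by rewrite -cN -(cardsID X N) setIC.
have := sp (v |: X); rewrite cardsU1 vX ddU1 // dgN -/M.
have := tX.2; rewrite ddH // => tXe h3.
have /h3 {}h3 : 3 <= true + #|X| by rewrite add1n; lia.
have {}h3 : #|M| <= 3 by move: h3; rewrite add1n; lia.
have /card_gt0P[y] : 0 < #|N :\: X| by lia.
rewrite in_setD => /andP[yX yN].
have [M3|M2] : #|M| = 3 \/ #|M| = 2 by move: mX; rewrite -/M; lia.
  have dy : 3 <= dg e X y.
    rewrite -M3 dg_card; apply/subset_leq_card/subsetP=> u uM; rewrite inE es adj // andbT.
    by move: uM; rewrite in_setI => /andP[].
  have vyX : v \notin y |: X.
    by rewrite in_setU1 negb_or vX andbT; apply: contraTneq yN => <-; rewrite inE ei.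
  have := sp (v |: (y |: X)); rewrite cardsU1 vyX cardsU1 yX ddU1 // ddU1 // dgU1 //.
  rewrite dgN -/M M3; have -> : e v y by rewrite inE in yN.
  have big : 3 <= true + (true + #|X|) by rewrite !add1n; lia.
  by move=> /(_ big); rewrite !add1n; lia.
have /card_gt0P[a aM] : 0 < #|M| by lia.
have [aX aN] : a \in X /\ a \in N by move: aM; rewrite in_setI => /andP[].
have h5 := md a; rewrite (dg_compl e X) in h5.
have h6 := tight_dg Hs Hi Hsp tX cX aX; rewrite dgH // in h6.
have : #|v |: (N :\: X)| <= dg e (~: X) a.
  rewrite dg_card; apply/subset_leq_card/subsetP=> u; rewrite in_setU1 in_setD => /orP[/eqP ->|].
    by rewrite !inE vX es; rewrite inE in aN.
  by move=> /andP[uX uN]; rewrite !inE uX adj.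
rewrite cardsU1 !inE ei andbF /=; lia.
Qed.

End Degrees.

(** * Minimal counterexamples *)

Section EdgeCounts.
Variable V : finType.
Implicit Types (e : rel V) (X Y Z : {set V}).

Lemma dd_pairs e : dd e setT = #|[set uv : V * V | e uv.1 uv.2]|.
Proof.
rewrite -sum1_card [RHS]big_mkcond /= sum_pair /dd /cnt.
rewrite [LHS]big_mkcond; apply: eq_bigr => u _; rewrite in_setT /dg.
rewrite [LHS]big_mkcond; apply: eq_bigr => v _; rewrite !inE /=.
by case: (e u v).
Qed.

Lemma dd_lt e e' x y : (forall u v, e' u v -> e u v) -> e x y -> ~~ e' x y ->
  dd e' setT < dd e setT.
Proof.
move=> h exy nxy; rewrite !dd_pairs; apply: proper_card; apply/properP; split.
  by apply/subsetP=> -[u v]; rewrite !inE /=; apply: h.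
by exists (x, y); rewrite inE.
Qed.

Lemma dg_gt0 e X x y : y \in X -> e x y -> 0 < dg e X x.
Proof. by move=> yX exy; rewrite dg_card card_gt0; apply/set0Pn; exists y; rewrite inE yX. Qed.

Lemma dg_gt0P e X x : 0 < dg e X x -> exists2 y, y \in X & e x y.
Proof. by rewrite dg_card card_gt0 => /set0Pn[y]; rewrite inE => /andP[]; exists y. Qed.

Lemma dd_compl e X x : symmetric e -> x \in X -> dd e (~: X) + dg e setT x <= dd e setT.
Proof.
move=> es xX; rewrite -{2}(setUCr X) ddU //; last by rewrite -setI_eq0 setICr.
have := cnt_compl e X; rewrite (bigD1 x) //=; lia.
Qed.

Lemma dg_addedge e a b u : dg (addedge a b e) setT u <= dg e setT u + (u == a) + (u == b).
Proof.
have E (c d : V) : \sum_(x in [set: V]) ((u == c) && (x == d)) = (u == c).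
  rewrite (bigD1 d) //= eqxx andbT big1 ?addn0 // => x /andP[_ /negPf ->].
  by rewrite andbF.
rewrite -{1}(E a b) -(E b a) /dg -!big_split; apply: leq_sum => x _ /=.
by case: (e u x); case: (_ && _); case: (_ && _).
Qed.

Lemma dg_delset_lt e X a x : x \in X -> e a x -> dg (delset X e) setT a < dg e setT a.
Proof.
move=> xX ax; rewrite dg_delset (dg_compl e X) setTD; have := dg_gt0 xX ax.
by case: ifP => _; lia.
Qed.

Lemma dg_delset_le e X a : dg (delset X e) setT a <= dg e setT a.
Proof. by apply: dg_sub => u /andP[]. Qed.

Lemma addedge_maxdeg5 e X a b x y : maxdeg5 e -> a != b -> x \in X -> y \in X -> e a x -> e b y ->
  maxdeg5 (addedge a b (delset X e)).
Proof.
move=> md ab xX yX ax byb u; have h := dg_addedge (delset X e) a b u.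
apply: leq_trans h _; have h1 := md u; have h2 := dg_delset_le e X u.
have [ua|ua] := eqVneq u a; have [ub|ub] := eqVneq u b => /=; last by lia.
- by rewrite -ua -ub eqxx in ab.
- by have := dg_delset_lt xX ax; rewrite -ua; lia.
- by have := dg_delset_lt yX byb; rewrite -ub; lia.
Qed.

Lemma addedge2_maxdeg5 e v i j k l : maxdeg5 e -> uniq [:: i; j; k; l] ->
  e i v -> e j v -> e k v -> e l v ->
  maxdeg5 (addedge k l (addedge i j (delset [set v] e))).
Proof.
move=> md un iv jv kv lv u.
have h1 := dg_addedge (addedge i j (delset [set v] e)) k l u.
have h2 := dg_addedge (delset [set v] e) i j u.
have : dg (delset [set v] e) setT u + (u \in [:: i; j; k; l]) <= 5.
  have [h|_] := boolP (u \in _); last by rewrite addn0 (leq_trans (dg_delset_le e _ u)).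
  rewrite addn1; apply: leq_trans (md u); apply: (@dg_delset_lt e [set v] u v).
    by rewrite inE.
  by move: h; rewrite !inE => /or4P[] /eqP ->.
rewrite -(count_uniq_mem u un) /= !(eq_sym _ u) => h3.
apply: leq_trans h1 _; apply: leq_trans h3; rewrite !addnA addn0 !leq_add2r.
by [].
Qed.

End EdgeCounts.

Section Minimal.
Variables (R : realFieldType) (V : finType).
Implicit Types (e : rel V) (X Y Z : {set V}).

Definition realizable e := exists p, @indep R V e p.

(** The graphs are compared by their numbers of edges on a fixed vertex set, so that
    vertices are deleted by making them isolated. *)
Record minimal e : Prop := Minimal {
  msym : symmetric e;
  mirr : irreflexive e;
  msparse : sparse e;
  mdeg5 : maxdeg5 e;
  mnone : ~ realizable e;
  mmin : forall e', symmetric e' -> irreflexive e' -> sparse e' -> maxdeg5 e' ->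
    dd e' setT < dd e setT -> realizable e' }.

Lemma delset_smaller e v : minimal e -> 0 < dg e setT v -> realizable (delset [set v] e).
Proof.
move=> [es ei sp md _ IH] dv; apply: IH.
- exact: delset_sym.
- exact: delset_irr.
- exact: delset_sparse.
- exact: delset_maxdeg5.
- have [y _ vy] := dg_gt0P dv; apply: (@dd_lt _ _ _ v y) => //=; first by move=> x z /andP[].
  by rewrite !inE eqxx andbF.
Qed.

(** The degrees between one and four are excluded by [extension0], and by [extension1]
    with the new edge of [degree4_pair]. *)
Lemma minimal_degree e v : minimal e -> dg e setT v = 0 \/ dg e setT v = 5.
Proof.
move=> me; have [es ei sp md none IH] := me; have h := md v.
have dN : #|[set u | e v u]| = dg e setT v.
  by rewrite dg_card; apply: eq_card => u; rewrite !inE.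
have [d0|d0] := posnP (dg e setT v); [by left|right; apply/eqP/negPn/negP => d5; apply: none].
have [d3|d3] := leqP (dg e setT v) 3.
  by apply: (@extension0 R V e v) => //; [rewrite dN|exact: delset_smaller].
have d4 : dg e setT v = 4 by lia.
have [a [b [va vb ab nab spab]]] := degree4_pair es ei sp md d4.
apply: (@extension1 R V e v a b) => //; first by rewrite dN d4.
have Hs : symmetric (delset [set v] e) by apply: delset_sym.
have Hi : irreflexive (delset [set v] e) by apply: delset_irr.
apply: IH => //.
- exact: addedge_sym.
- exact: addedge_irr.
- by apply: (@addedge_maxdeg5 _ _ _ a b v v) => //; rewrite ?inE // es.
- rewrite dd_addedge //; last by apply: contra nab => /andP[].
  rewrite dd_delset setTD !inE /=; have := @dd_compl _ e [set v] v es (set11 v); lia.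
Qed.

Lemma minimal_degree5 e v u : minimal e -> e v u -> dg e setT v = 5.
Proof. by move=> me vu; have [h|//] := minimal_degree v me; have := dg_gt0 (in_setT u) vu; rewrite h. Qed.

Lemma indep_split e (D : {set V}) p : symmetric e -> (forall u v, u \in D -> e u v -> v \in D) ->
  @indep R V (inner D e) p -> indep (inner (~: D) e) p -> indep e p.
Proof.
move=> es cl i1 i2 w [[sw w0] hf].
have cross0 u v : u \in D -> v \notin D -> w u v = 0%R.
  by move=> uD vD; apply: w0; apply: contra vD; apply: cl.
have part X : (X = D \/ X = ~: D) -> indep (inner X e) p ->
    forall u v, u \in X -> v \in X -> w u v = 0%R.
  move=> hX iX u v uX vX.
  have side x y : x \in X -> y \notin X -> w x y = 0%R.
    case: hX => ->; first exact: cross0.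
    by rewrite !inE negbK => xD yD; rewrite sw cross0.
  pose w' x y := if (x \in X) && (y \in X) then w x y else 0%R.
  have <- : w' u v = w u v by rewrite /w' uX vX.
  apply: iX; split; first split.
  - by move=> x y; rewrite /w' andbC sw.
  - by move=> x y; rewrite /w'; case: ifP => // h; rewrite /= h andbT; apply: w0.
  - move=> x; rewrite /force; have [xX|xX] := boolP (x \in X); last first.
      by rewrite big1 // => y _; rewrite /w' (negPf xX) scale0r.
    rewrite -[RHS](hf x); apply: eq_bigr => y _; rewrite /w' xX /=.
    by case: ifP => // /negbT yX; rewrite side.
move=> u v; have [uD|uD] := boolP (u \in D); have [vD|vD] := boolP (v \in D).
- by apply: (part D) => //; left.
- exact: cross0.
- by rewrite sw cross0.
- by apply: (part (~: D)); rewrite ?inE //; right.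
Qed.

Lemma inner_smaller e X u v : minimal e -> e u v -> ~~ ((u \in X) && (v \in X)) ->
  realizable (inner X e).
Proof.
move=> [es ei sp md _ IH] uv nX; have sub x y : inner X e x y -> e x y by case/andP.
apply: IH.
- exact: inner_sym.
- exact: inner_irr.
- exact: sub_sparse sub sp.
- exact: sub_maxdeg5 sub md.
- by apply: dd_lt sub uv _; rewrite /= negb_and nX orbT.
Qed.

(** A union of components and its complement have independent placements, and both
    conditions can be met at once. *)
Lemma minimal_connected e (D : {set V}) u v x y : minimal e -> (forall u v, u \in D -> e u v -> v \in D) ->
  e u v -> u \in D -> e x y -> x \in D.
Proof.
move=> me cl uv uD xy; apply/negPn/negP => xD; have es := msym me.
have vD := cl _ _ uD uv.
apply: (mnone me); have [||p [h1 h2]] := zopen_meet (@zopen_indep R V (inner D e))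
  (@zopen_indep R V (inner (~: D) e)).
- by apply: (inner_smaller me xy); rewrite negb_and xD.
- by apply: (inner_smaller me uv); rewrite !inE uD.
- by exists p; apply: indep_split h2.
Qed.

End Minimal.

(** * Tight sets *)

Section Grouping.
Variable V : finType.
Implicit Types (e : rel V) (X Y Z A : {set V}) (phi : V -> V).

Lemma subset_between (T : finType) (A X : {set T}) n : A \subset X -> #|A| <= n <= #|X| ->
  exists B : {set T}, [/\ A \subset B, B \subset X & #|B| = n].
Proof.
move=> AX /andP[]; move Ek: (n - #|A|) => k; elim: k A AX Ek => [|k IH] A AX Ek h1 h2.
  by exists A; split=> //; lia.
have /set0Pn[x] : X :\: A != set0.
  by rewrite -card_gt0 cardsD (setIidPr AX); lia.
rewrite inE => /andP[xA xX]; have cA : #|x |: A| = #|A|.+1 by rewrite cardsU1 xA.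
have [||||B [B1 B2 B3]] := IH (x |: A); try by rewrite ?cA; lia.
  by rewrite subUset sub1set xX.
exists B; split=> //; apply: subset_trans B1; exact: subsetUr.
Qed.

Definition barset e X := [set p : V * V | [&& p.1 \in X, p.2 \notin X & e p.1 p.2]].
Definition group e X phi x := [set p in barset e X | phi p.1 == x].
Definition groups e X phi := [set phi p.1 | p in barset e X].

(** The end points identified by [phi] become one vertex of a tetrahedron.  With its three
    edges there it can have two more without exceeding degree five, and [gr_inj] keeps
    these from coinciding. *)
Record grouping e X phi : Prop := Grouping {
  gr_out : forall v, v \notin X -> phi v = v;
  gr_in : forall v, v \in X -> phi v \in X;
  gr_size : forall x, #|group e X phi x| <= 2;
  gr_inj : forall p q, p \in barset e X -> q \in barset e X ->
    phi p.1 = phi q.1 -> p.2 = q.2 -> p = q }.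

Lemma card_barset e X : #|barset e X| = cnt e X (~: X).
Proof.
rewrite -sum1_card [LHS]big_mkcond /= sum_pair /cnt [RHS]big_mkcond /=.
apply: eq_bigr => u _; rewrite /dg [in RHS]big_mkcond; case: ifP => uX; last first.
  by rewrite big1 // => v _; rewrite inE /= uX.
by apply: eq_bigr => v _; rewrite !inE /= uX; case: (v \in X) => //=.
Qed.

Lemma sum_groups e X phi : \sum_(x in groups e X phi) #|group e X phi x| = #|barset e X|.
Proof.
rewrite -sum1_card (partition_big (fun p => phi p.1) (mem (groups e X phi))) /=; last first.
  by move=> p pB; apply/imsetP; exists p.
by apply: eq_bigr => x _; rewrite -sum1_card; apply: eq_bigl => p; rewrite inE.
Qed.

(** Two groups of a single bar each may be merged if the bars end at different points,
    because the new group satisfies [gr_inj]. *)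
Lemma merge_groups e X phi x x' v v' o o' : grouping e X phi -> x \in X -> x' \in X -> x != x' ->
  group e X phi x = [set (v, o)] -> group e X phi x' = [set (v', o')] -> o != o' ->
  let phi' u := if phi u == x then x' else phi u in
  grouping e X phi' /\ #|groups e X phi'| < #|groups e X phi|.
Proof.
move=> [h1 h2 h3 h4] xX x'X xx' gx gx' oo' phi'.
have inG p : p \in barset e X -> p \in group e X phi (phi p.1) by move=> pB; rewrite inE pB /=.
have only p y u w : p \in barset e X -> phi p.1 = y -> group e X phi y = [set (u, w)] -> p = (u, w).
  by move=> pB <- E; have := inG p pB; rewrite E inE => /eqP.
split; first split.
- move=> u uX; rewrite /phi' h1 //; case: eqP => // E; by rewrite E xX in uX.
- by move=> u uX; rewrite /phi'; case: ifP => // _; apply: h2.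
- move=> z; have [->|zx'] := eqVneq z x'.
    apply: (@leq_trans #|group e X phi x :|: group e X phi x'|).
      apply/subset_leq_card/subsetP => p; rewrite !inE => /andP[-> /=].
      by rewrite /phi'; case: ifP.
    by rewrite gx gx'; apply: leq_trans (leq_card_setU _ _) _; rewrite !cards1.
  apply: leq_trans (h3 z); apply/subset_leq_card/subsetP => p; rewrite !inE => /andP[-> /=].
  by rewrite /phi'; case: ifP => // _ /eqP E; rewrite E eqxx in zx'.
- move=> p q pB qB; rewrite /phi'; case: eqP => [px|px]; case: eqP => [qx|qx].
  + by move=> _; apply: h4; rewrite // px qx.
  + move=> /esym qx' E; have Ep := only _ _ _ _ pB px gx; have Eq := only _ _ _ _ qB qx' gx'.
    by rewrite Ep Eq /= in E; rewrite E eqxx in oo'.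
  + move=> px' E; have Ep := only _ _ _ _ pB px' gx'; have Eq := only _ _ _ _ qB qx gx.
    by rewrite Ep Eq /= in E; rewrite E eqxx in oo'.
  + by move=> E; apply: h4.
have in_groups y u w : group e X phi y = [set (u, w)] -> y \in groups e X phi.
  move=> E; have : (u, w) \in group e X phi y by rewrite E inE.
  by rewrite inE => /andP[pB /eqP <-]; apply/imsetP; exists (u, w).
apply: proper_card; apply/properP; split.
  apply/subsetP=> z /imsetP[p pB ->]; rewrite /phi'; case: ifP => _; first exact: in_groups gx'.
  by apply/imsetP; exists p.
exists x; first exact: in_groups gx.
apply/negP => /imsetP[p pB]; rewrite /phi'; case: eqP => [_ E|h E].
  by rewrite E eqxx in xx'.
by apply: h.
Qed.

Lemma grouping_id e X : (forall v, v \in X -> dg e (~: X) v <= 2) -> grouping e X id.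
Proof.
move=> h; split=> // [x|p q _ _]; last by case: p q => [p1 p2] [q1 q2] /= -> ->.
have [xX|xX] := boolP (x \in X); last first.
  rewrite (_ : group _ _ _ _ = set0) ?cards0 //; apply/setP=> p; rewrite !inE.
  by apply/negP => /andP[/and3P[pX _ _] /eqP E]; rewrite E in pX; rewrite pX in xX.
apply: leq_trans (h x xX); rewrite dg_card.
rewrite -(card_in_imset (f := snd) (D := mem (group e X id x))).
  apply/subset_leq_card/subsetP => y /imsetP[p]; rewrite !inE => /andP[/and3P[_ pX ep] /eqP E] ->.
  by rewrite -E pX.
move=> p q; rewrite !inE => /andP[_ /eqP E] /andP[_ /eqP E'].
by case: p q E E' => [p1 p2] [q1 q2] /= -> -> ->.
Qed.

(** As long as there are five groups, at most seven bars leave three groups of a single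
    bar; these three do not all end at the same point outside, so two can be merged. *)
Lemma four_groups e X phi : symmetric e -> grouping e X phi -> #|barset e X| <= 7 ->
  (forall y, y \notin X -> dg e X y <= 2) ->
  exists phi, grouping e X phi /\ #|groups e X phi| <= 4.
Proof.
move=> es gphi cB mu; have [n] := ubnP #|groups e X phi|.
elim: n phi gphi => // n IH phi gphi hn.
have [h|h] := leqP #|groups e X phi| 4; first by exists phi.
pose G1 := [set x in groups e X phi | #|group e X phi x| == 1].
have cG1 : 2 < #|G1|.
  have : 2 * #|groups e X phi| <= #|barset e X| + #|G1|.
    rewrite -(sum_groups e X phi) -[#|G1|]sum1_card mulnC -sum_nat_const.
    rewrite [X in _ <= _ + X](_ : _ = \sum_(x in groups e X phi) (#|group e X phi x| == 1)).
      rewrite -big_split; apply: leq_sum => x /imsetP[p pB E] /=.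
      have : 0 < #|group e X phi x|.
        by rewrite card_gt0; apply/set0Pn; exists p; rewrite inE pB E /=.
      by case: #|_| => [|[|k]].
    rewrite [LHS]big_mkcond [RHS]big_mkcond; apply: eq_bigr => x _.
    by rewrite inE; case: (x \in _); case: (_ == 1).
  by lia.
have single x : x \in G1 -> exists v o, [/\ group e X phi x = [set (v, o)], phi v = x,
    v \in X, o \notin X & e v o].
  rewrite inE => /andP[_ /cards1P[[v o] E]]; exists v, o.
  have : (v, o) \in group e X phi x by rewrite E inE.
  by rewrite !inE => /andP[/and3P[vX oX vo] /eqP].
have pair x x' v v' o o' : x != x' -> group e X phi x = [set (v, o)] ->
    group e X phi x' = [set (v', o')] -> phi v = x -> phi v' = x' -> v \in X -> v' \in X ->
    o != o' -> exists phi, grouping e X phi /\ #|groups e X phi| <= 4.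
  move=> xx' gx gx' vx vx' vX v'X oo'.
  have xX : x \in X by rewrite -vx; apply: (gr_in gphi).
  have x'X : x' \in X by rewrite -vx'; apply: (gr_in gphi).
  have [g' lt] := merge_groups gphi xX x'X xx' gx gx' oo'.
  by apply: IH g' _; apply: leq_trans lt _.
have /card_gt2P[x1 [x2 [x3 [[i1 i2 i3] [n12 n23 n31]]]]] := cG1.
have [v1 [o1 [g1 p1 X1 O1 e1]]] := single _ i1.
have [v2 [o2 [g2 p2 X2 O2 e2]]] := single _ i2.
have [v3 [o3 [g3 p3 X3 O3 e3]]] := single _ i3.
have [o12|o12] := eqVneq o1 o2; last exact: (pair x1 x2 v1 v2 o1 o2).
have [o13|o13] := eqVneq o1 o3; last by apply: (pair x1 x3 v1 v3 o1 o3) => //; rewrite eq_sym.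
have : #|[set v1; v2; v3]| <= dg e X o1.
  rewrite dg_card; apply/subset_leq_card/subsetP => v; rewrite !inE => /orP[/orP[]|] /eqP ->.
  - by rewrite X1 es.
  - by rewrite X2 es o12.
  - by rewrite X3 es o13.
have d12 : v1 != v2 by apply: contraNneq n12 => E; rewrite -p1 -p2 E.
have d23 : v2 != v3 by apply: contraNneq n23 => E; rewrite -p2 -p3 E.
have d31 : v1 != v3 by apply: contraNneq n31 => E; rewrite -p1 -p3 E.
by rewrite -setUA !cardsU1 cards1 !inE negb_or d12 d31 d23 => /leq_trans/(_ (mu _ O1)).
Qed.

(** The graph in which [X] is replaced by a complete graph on [A] and a bar that leaves
    [X] at [v] now starts at [phi v]. *)
Definition contraction e X A phi : rel V := 
  let link x y := [&& x \in A, y \notin X & [exists v, [&& v \in X, phi v == x & e v y]]] in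
  fun x y => [|| [&& x \in A, y \in A & x != y], [&& x \notin X, y \notin X & e x y],
    link x y | link y x].

Section Contraction.
Variables (e : rel V) (X A : {set V}) (phi : V -> V).
Hypotheses (es : symmetric e) (ei : irreflexive e) (AX : A \subset X) (cA : #|A| = 4)
  (gphi : grouping e X phi) (GA : groups e X phi \subset A).
Local Notation e' := (contraction e X A phi).

Lemma contraction_sym : symmetric e'.
Proof.
move=> x y; rewrite /contraction /= es (eq_sym x) orbCA [RHS]orbCA; congr orb.
  by rewrite !andbA (andbC (x \notin X)).
by rewrite !andbA (andbC (x \in A)); congr orb; rewrite orbC.
Qed.

Lemma contraction_irr : irreflexive e'.
Proof.
move=> x; rewrite /contraction /= eqxx ei !andbF /= orbb.
by apply/negP => /and3P[/(subsetP AX) ->].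
Qed.

Lemma contraction_isolated x y : x \in X -> x \notin A -> e' x y = false.
Proof.
by move=> xX /negPf xA; rewrite /contraction /= xX xA /= !andbF.
Qed.

Lemma contraction_bar v y : v \in X -> y \notin X -> e v y -> phi v \in A /\ e' (phi v) y.
Proof.
move=> vX yX vy; have h : phi v \in A.
  by apply: (subsetP GA); apply/imsetP; exists (v, y); rewrite // inE vX yX.
split=> //; rewrite /contraction /= h yX /= orbA; apply/orP; right; apply/orP; left.
by apply/existsP; exists v; rewrite vX eqxx.
Qed.

Lemma contraction_row r : r \in A -> dg e' (~: X) r <= 2.
Proof.
move=> rA; have rX := subsetP AX r rA; apply: leq_trans (gr_size gphi r); rewrite dg_card.
apply: (@leq_trans #|[set p.2 | p in group e X phi r]|); last exact: leq_imset_card.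
apply/subset_leq_card/subsetP => y; rewrite !inE /contraction /= => /andP[yX].
have yA : y \notin A by apply: contra yX; apply: (subsetP AX).
rewrite rX (negPf yA) /= andbF /= orbF => /and3P[_ _ /existsP[v /and3P[vX /eqP pv vy]]].
by apply/imsetP; exists (v, y); rewrite // !inE /= vX yX vy pv eqxx.
Qed.

Lemma contraction_col y : y \notin X -> dg e' X y <= dg e X y.
Proof.
move=> yX; have yA : y \notin A by apply: contra yX; apply: (subsetP AX).
rewrite !dg_card.
apply: (@leq_trans #|[set phi v | v in [set u in X | e y u]]|); last exact: leq_imset_card.
apply/subset_leq_card/subsetP => x; rewrite !inE /contraction /= => /andP[xX].
rewrite xX (negPf yA) /= andbF /= => /and3P[_ _ /existsP[v /and3P[vX /eqP pv vy]]].
by apply/imsetP; exists v; rewrite // inE vX es.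
Qed.

Lemma contraction_out (O : {set V}) : O \subset ~: X -> dd e' O = dd e O.
Proof.
move=> OX; apply: eq_cnt => x y xO yO.
have xX : x \notin X by have := subsetP OX x xO; rewrite inE.
have yX : y \notin X by have := subsetP OX y yO; rewrite inE.
have xA : x \notin A by apply: contra xX; apply: (subsetP AX).
have yA : y \notin A by apply: contra yX; apply: (subsetP AX).
by rewrite /contraction /= (negPf xA) (negPf yA) xX yX /= orbF.
Qed.

Lemma contraction_core (Z : {set V}) : dd e' Z = dd e' (Z :\: (X :\: A)).
Proof.
rewrite -dd_delset; apply: eq_cnt => x y _ _ /=; rewrite !inE.
have [/andP[xA xX]|_] := boolP ((x \notin A) && (x \in X)).
  by rewrite contraction_isolated // andbF.
have [/andP[yA yX]|_] := boolP ((y \notin A) && (y \in X)).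
  by rewrite contraction_sym contraction_isolated // andbF.
by rewrite !andbT.
Qed.

Lemma contraction_maxdeg5 : maxdeg5 e -> maxdeg5 e'.
Proof.
move=> md x; have [xA|xA] := boolP (x \in A).
  rewrite (dg_compl _ X); have h := contraction_row xA.
  have : dg e' X x <= 3; last by lia.
  have <- : #|A :\ x| = 3 by have := cardsD1 x A; rewrite xA cA; lia.
  rewrite dg_card; apply/subset_leq_card/subsetP => y; rewrite !inE => /andP[yX].
  have xX := subsetP AX x xA.
  by rewrite /contraction /= xX yX xA /= andbF /= !orbF => /andP[-> ]; rewrite andbT eq_sym.
have [xX|xX] := boolP (x \in X).
  by rewrite /dg big1 // => y _; rewrite contraction_isolated.
apply: leq_trans (md x); rewrite !(dg_compl _ X); apply: leq_add; first exact: contraction_col.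
rewrite -!cnt1 (@eq_cnt _ e' e) // => u y; rewrite !inE => /eqP -> yX.
have yA : y \notin A by apply: contra yX; apply: (subsetP AX).
by rewrite /contraction /= (negPf xA) (negPf yA) xX yX /= orbF.
Qed.

(** A set [Z] meets the new graph in vertices [C] of [A] and [O] outside [X].  The count
    follows from that of [O] and that of [X :|: O] in the old graph, in which [X] is
    tight, together with the trivial bounds for edges inside small sets and the bound of
    two edges between [C] and [O] at each of their vertices. *)
Lemma contraction_sparse : sparse e -> tight e X -> (forall y, y \notin X -> dg e X y <= 2) ->
  sparse e'.
Proof.
move=> sp [cX tX] mu Z cZ; rewrite contraction_core.
pose C := Z :&: A; pose O := Z :\: X.
have E : Z :\: (X :\: A) = C :|: O.
  apply/setP=> x; rewrite !inE; have := subsetP AX x.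
  case: (x \in Z); case: (x \in A); case: (x \in X) => //= h; by have := h isT.
have dCO : [disjoint C & O].
  rewrite -setI_eq0; apply/eqP/setP=> x; rewrite !inE; have := subsetP AX x.
  case: (x \in Z); case: (x \in A); case: (x \in X) => //= h; by have := h isT.
have cn : #|C| + #|O| <= #|Z|.
  rewrite -cardsUI (disjoint_setI0 dCO) cards0 addn0 -E.
  by apply/subset_leq_card/subsetP => x; rewrite inE => /andP[].
have OX : O \subset ~: X by apply/subsetP=> x; rewrite !inE => /andP[].
have dXO : [disjoint X & O].
  by rewrite -setI_eq0; apply/eqP/setP=> x; rewrite !inE; case: (x \in X).
have es' := contraction_sym; have ei' := contraction_irr.
have h0 : dd e' (C :|: O) + (#|C| + #|O|) <= (#|C| + #|O|) * (#|C| + #|O|).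
  have <- : #|C :|: O| = #|C| + #|O| by rewrite cardsU (disjoint_setI0 dCO) cards0 subn0.
  exact: dd_le.
move: h0; rewrite E ddU // (@contraction_out O) // => h0.
have h1 : dd e' C + #|C| <= #|C| * #|C| by apply: dd_le.
have h2 : cnt e' C O <= 2 * #|C|.
  apply: cnt_rows => x; rewrite inE => /andP[_ xA].
  by apply: leq_trans (contraction_row xA); apply: dg_mono.
have colO y : y \in O -> dg e' C y <= dg e X y.
  move=> yO; have yX : y \notin X by have := subsetP OX y yO; rewrite inE.
  apply: leq_trans (contraction_col yX); apply: dg_mono.
  by apply: subset_trans AX; apply: subsetIr.
have h3 : cnt e' C O <= 2 * #|O|.
  apply: cnt_cols => // y yO; apply: leq_trans (colO y yO) (mu _ _).
  by have := subsetP OX y yO; rewrite inE.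
have h4 : cnt e' C O <= cnt e X O.
  by rewrite cntC // (cntC X) //; apply: leq_sum => y; apply: colO.
have h5 : dd e X + dd e O + 2 * cnt e X O + 12 <= 6 * (#|X| + #|O|).
  rewrite -ddU // -[#|X| + _]cardsUI (disjoint_setI0 dXO) cards0 addn0; apply: sp.
  by apply: leq_trans cX _; apply: subset_leq_card; apply: subsetUl.
have h6 : 3 <= #|O| -> dd e O + 12 <= 6 * #|O| by apply: sp.
have h7 : dd e O + #|O| <= #|O| * #|O| by apply: dd_le.
have h8 : #|C| <= 4 by rewrite -cA; apply: subset_leq_card; apply: subsetIr.
move: h0 h1 h2 h3 h4 h5 h6 h7 h8 cn tX cZ.
move: (dd e' C) (cnt e' C O) (dd e O) (cnt e X O) (dd e X) #|X| #|O| #|C| #|Z|.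
move=> a b c d k x o r z h0 h1 h2 h3 h4 h5 h6 h7 h8 cn tX cZ.
have [o3|o3] := leqP 3 o.
  have {}h6 := h6 o3; move: h0 h1 h2 h8 cn.
  by case: r => [|[|[|[|[|r]]]]] // h0 h1 h2 h8 cn; lia.
move: h0 h1 h2 h3 h7 h8 cn h5 h6; case: o o3 => [|[|[|o]]] // _.
  by case: r => [|[|[|[|[|r]]]]] // *; lia.
  by case: r => [|[|[|[|[|r]]]]] // *; lia.
by case: r => [|[|[|[|[|r]]]]] // *; lia.
Qed.

Lemma contraction_smaller : tight e X -> 5 <= #|X| -> dd e' setT < dd e setT.
Proof.
move=> [_ tX] cX; have dX : [disjoint X & ~: X] by rewrite -setI_eq0 setICr.
rewrite -(setUCr X) !ddU //; last exact: contraction_sym.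
rewrite (contraction_out (O := ~: X)) // contraction_core.
have -> : X :\: (X :\: A) = A by rewrite setDDr setDv set0U (setIidPr AX).
have h : dd e' A + #|A| <= #|A| * #|A| by apply: dd_le; exact: contraction_irr.
rewrite cA in h; have : cnt e' X (~: X) <= cnt e X (~: X); last by lia.
rewrite cntC; last exact: contraction_sym.
rewrite (cntC X) //; apply: leq_sum => y; rewrite inE; exact: contraction_col.
Qed.

End Contraction.
End Grouping.

(** * Tight sets in minimal counterexamples *)

Section TightSets.
Variables (R : realFieldType) (V : finType).
Implicit Types (e : rel V) (X Y Z : {set V}).
Local Notation minimal e := (@minimal R V e).

Lemma tight_degree5 e X v : minimal e -> tight e X -> 4 <= #|X| -> v \in X -> dg e setT v = 5.
Proof.
move=> me tX cX vX; have [es ei sp _ _ _] := me.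
have h := tight_dg es ei sp tX cX vX; have [h0|//] := minimal_degree v me.
by have := dg_mono e v (subsetT X); rewrite h0; lia.
Qed.

(** All degrees in [X] are five, so the edges that leave [X] number
    [5 |X| - (6 |X| - 12)]. *)
Lemma tight_boundary e X : minimal e -> tight e X -> 4 <= #|X| -> cnt e X (~: X) + #|X| = 12.
Proof.
move=> me tX cX; have := cnt_compl e X.
rewrite (eq_bigr (fun=> 5)) => [|v vX]; last exact: tight_degree5 tX cX vX.
by rewrite sum_nat_const; have := tX.2; lia.
Qed.

(** Exchange a largest tight set [X] with five to eleven vertices for a tetrahedron.  At
    most seven edges leave [X], at most two from each of its vertices, and by maximality
    at most two end at the same vertex outside; so [four_groups] gives a smaller graph,
    which is realizable.  Its realization makes the bars outside [X] independent with
    [X] as a rigid body, and the graph inside [X] is smaller as well. *)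
Lemma minimal_no_tight e Y : minimal e -> tight e Y -> 5 <= #|Y| <= 11 -> False.
Proof.
move=> me tX0 cX0; have [es ei sp md none IH] := me.
pose P X := tight e X /\ 5 <= #|X| <= 11.
have [X [[tX cX] maxX]] := set_maximal (P := P) (fun X => #|X|) (ex_intro _ Y (conj tX0 cX0)).
have /andP[c5 c11] := cX.
have c4 : 4 <= #|X| by exact: ltnW.
have cB := tight_boundary me tX c4.
have inn v : v \in X -> dg e (~: X) v <= 2.
  move=> vX; have h := tight_dg es ei sp tX c4 vX; have := dg_compl e X v.
  by rewrite (tight_degree5 me tX c4 vX) => h'; lia.
have outer y : y \notin X -> dg e X y <= 2.
  move=> yX; rewrite leqNgt; apply/negP => h3.
  have h : dg e X y <= cnt e X (~: X).
    by rewrite cntC // /cnt (bigD1 y) ?inE //= leq_addr.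
  have c10 : #|X| <= 9 by lia.
  have cU : #|y |: X| = #|X|.+1 by rewrite cardsU1 yX.
  have : P (y |: X).
    have h1 : dd e (y |: X) = dd e X + 2 * dg e X y by rewrite ddU1.
    have h2 : 3 <= #|y |: X| by rewrite cU; lia.
    have h5 := sp _ h2; split; last by rewrite cU; lia.
    by split=> //; have := tX.2; rewrite cU in h5 *; lia.
  by move/maxX; rewrite cU ltnn.
have gid : grouping e X id by apply: grouping_id.
have cB7 : #|barset e X| <= 7 by rewrite card_barset; lia.
have [phi [gphi g4]] := four_groups es gid cB7 outer.
have GX : groups e X phi \subset X.
  apply/subsetP=> x /imsetP[p]; rewrite inE => /andP[pX _] ->; exact: (gr_in gphi).
have [|A [GA AX cA]] := subset_between (n := 4) GX; first by rewrite g4.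
pose e' := contraction e X A phi.
have es' : symmetric e' by apply: contraction_sym.
have ei' : irreflexive e' by apply: contraction_irr.
have [p [indp gp]] : exists p, @indep R V e' p /\ generalpos p.
  apply: zopen_meet; [exact: zopen_indep|exact: zopen_generalpos| |exact: generalpos_exists].
  apply: IH => //.
  - exact: contraction_sparse.
  - exact: contraction_maxdeg5.
  - exact: contraction_smaller.
have body : bodyindep X e (fun v => p (phi v)).
  apply: (body_substitution (A := A) (e' := e')) => //.
  - by apply: gp; rewrite cA.
  - exact: (gr_out gphi).
  - by move=> u v uA vA uv; rewrite /e' /contraction uA vA uv.
  - by move=> x y xX yX xy; rewrite /e' /contraction xX yX xy orbT.
  - by move=> v y vX yX vy; apply: contraction_bar.
  - move=> v v' y vX v'X yX vy v'y E.
    have := gr_inj gphi (p := (v, y)) (q := (v', y)).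
    by rewrite !inE /= vX v'X yX vy v'y => /(_ isT isT E erefl) [].
have [x xX xb] : exists2 x, x \in X & 0 < dg e (~: X) x.
  apply/exists_inP; apply: contraT; rewrite negb_exists_in => /forall_inP h.
  have : cnt e X (~: X) = 0.
    by rewrite /cnt big1 // => x xX; apply/eqP; rewrite -leqn0 leqNgt h.
  by lia.
have [y yX xy] := dg_gt0P xb; rewrite inE in yX.
have hin : realizable R (inner X e) by apply: (inner_smaller me xy); rewrite negb_and yX orbT.
apply: none; have [p' [h1 h2]] := zopen_meet (@zopen_bodyindep R V X e)
  (@zopen_indep R V (inner X e)) (ex_intro _ _ body) hin.
by exists p'; apply: body_glue h2.
Qed.

(** An edge leaves the tight set [X], so by [tight_boundary] it has at most eleven
    vertices, hence four by [minimal_no_tight]; six edges on four vertices form a complete graph. *)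
Lemma tight_clique e X x y : minimal e -> tight e X -> 4 <= #|X| -> x \in X -> y \notin X ->
  e x y -> #|X| = 4 /\ {in X &, forall u v, u != v -> e u v}.
Proof.
move=> me tX cX xX yX xy; have [es ei sp _ _ _] := me.
have h : 0 < cnt e X (~: X).
  by rewrite /cnt (bigD1 x) //= addn_gt0 (@dg_gt0 _ e _ x y) // inE.
have hB := tight_boundary me tX cX.
have c4 : #|X| = 4.
  apply/eqP; rewrite eqn_leq cX andbT leqNgt; apply/negP => c5.
  by apply: (minimal_no_tight me tX); lia.
split=> // u v uX vX uv; apply/negPn/negP => nuv.
by have := dd_pair es ei uv nuv uX vX; have := tX.2; rewrite c4; lia.
Qed.

(** The vertices of a tight set have degree at least three in it, but those of [X] have
    become isolated. *)
Lemma tight_delset e X Z : symmetric e -> irreflexive e -> sparse e -> 4 <= #|Z| ->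
  tight (delset X e) Z -> Z :\: X = Z /\ tight e Z.
Proof.
move=> es ei sp cZ tZ; have E : Z :\: X = Z.
  apply/setP=> z; rewrite inE; have [zX|//] := boolP (z \in X); apply/esym.
  apply/negP => zZ.
  have := tight_dg (delset_sym X es) (delset_irr X ei) (delset_sparse X sp) tZ cZ zZ.
  by rewrite dg_delset zX.
by split=> //; case: tZ => c t; split=> //; rewrite -t dd_delset E.
Qed.

(** A tight set that blocks the new edge [a b] would be tight in the old graph and have
    an edge from [a] to [x] leaving it.  Then it is a complete graph, although [a] and
    [b] are not adjacent. *)
Lemma add_one_sparse e X a b x : minimal e -> a != b -> ~~ e a b -> e a x -> x \in X ->
  sparse (addedge a b (delset X e)).
Proof.
move=> me ab nab ax xX; have [es ei sp _ _ _] := me.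
apply: addedge_sparse => //.
- exact: delset_sym.
- exact: delset_irr.
- by apply: contra nab => /andP[].
- exact: delset_sparse.
move=> Z aZ bZ cZ tZ; have [E t] := tight_delset es ei sp cZ tZ.
have xZ : x \notin Z by rewrite -E inE xX.
have [_ /(_ a b aZ bZ ab)] := tight_clique me t cZ aZ xZ ax.
by rewrite (negPf nab).
Qed.

(** A tight set [Z] blocking the second edge [k l] is treated as in [add_one_sparse] unless
    it contains the first one.  Then it contains four neighbours of [v], so that adding
    [v] gives a tight set of the old graph with at least five vertices, which the fifth
    edge at [v] leaves. *)
Lemma add_two_sparse e v i j k l : minimal e -> uniq [:: i; j; k; l] ->
  e i v -> e j v -> e k v -> e l v -> ~~ e i j -> ~~ e k l ->
  sparse (addedge k l (addedge i j (delset [set v] e))).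
Proof.
move=> me; rewrite /= !inE !negb_or => /and4P[/and3P[ij ik il] /andP[jk jl] kl _].
move=> iv jv kv lv nij nkl; have [es ei sp _ _ _] := me.
set H : rel V := delset [set v] e; set H1 := addedge i j H.
have Hs : symmetric H by apply: delset_sym.
have Hi : irreflexive H by apply: delset_irr.
have vv : v \in [set v] by rewrite inE.
have H1s : symmetric H1 by apply: addedge_sym.
have H1i : irreflexive H1 by apply: addedge_irr.
have H1sp : sparse H1 by apply: add_one_sparse iv vv.
have nHij : ~~ H i j by apply: contra nij => /andP[].
have nH1 : ~~ H1 k l.
  rewrite /H1 /= !(eq_sym k) (negPf ik) (negPf jk) /= orbF.
  by apply: contra nkl => /and3P[].
apply: addedge_sparse => // Z kZ lZ cZ tZ.
have vZ : v \notin Z.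
  apply/negP => vZ; have := tight_dg H1s H1i H1sp tZ cZ vZ.
  have : dg H1 Z v = 0; last by move->.
  rewrite /dg big1 // => u _; rewrite /H1 /H /= !inE eqxx andbF /=.
  have -> : (v == i) = false by apply: contraTF iv => /eqP <-; rewrite ei.
  by have -> : (v == j) = false by apply: contraTF jv => /eqP <-; rewrite ei.
have ZE : Z :\: [set v] = Z.
  by apply/setP=> z; rewrite !inE; case: eqP => // ->; rewrite (negPf vZ).
have := tZ.2; rewrite dd_addedge // dd_delset ZE.
have [/andP[iZ jZ]|nZ] := boolP ((i \in Z) && (j \in Z)); last first.
  rewrite muln0 addn0 => t; have tZ' : tight e Z by split=> //; exact: tZ.1.
  have [_ /(_ k l kZ lZ kl)] := tight_clique me tZ' cZ kZ vZ kv.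
  by rewrite (negPf nkl).
rewrite muln1 => t; have cU : #|v |: Z| = #|Z|.+1 by rewrite cardsU1 vZ.
have d4 : 4 <= dg e Z v.
  have <- : #|[set i; j; k; l]| = 4.
    by rewrite -!setUA !cardsU1 cards1 !inE !negb_or ij ik il jk jl kl.
  rewrite dg_card; apply/subset_leq_card/subsetP => u; rewrite !inE -!orbA.
  by case/or4P => /eqP ->; rewrite ?iZ ?jZ ?kZ ?lZ es.
have c3 : 3 <= #|v |: Z| by rewrite cU; move: cZ; clear; lia.
have := sp _ c3; rewrite ddU1 // cU => h.
have d4' : dg e Z v = 4 by move: h t d4; clear; lia.
have tU : tight e (v |: Z) by split=> //; rewrite ddU1 // cU; move: t d4'; clear; lia.
have [y yZ vy] : exists2 y, y \in ~: Z & e v y.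
  apply: dg_gt0P; have := dg_compl e Z v; rewrite (minimal_degree5 me (_ : e v i)) ?d4'; first by clear; lia.
  by rewrite es.
have yvZ : y \notin v |: Z.
  by move: yZ; rewrite !inE negb_or => ->; rewrite andbT; apply: contraTneq vy => ->; rewrite ei.
have [|//] := tight_clique me tU _ (setU11 v Z) yvZ vy; first by rewrite cU; move: cZ; clear; lia.
by rewrite cU => -[c3']; move: cZ; rewrite c3'.
Qed.

Lemma add_one_realizable e X a b x y : minimal e -> a != b -> ~~ e a b -> e a x -> e b y ->
  x \in X -> y \in X -> realizable R (addedge a b (delset X e)).
Proof.
move=> me ab nab ax byb xX yX; have [es ei sp md _ IH] := me.
have nab' : ~~ delset X e a b by apply: contra nab => /andP[].
apply: IH.
- by apply: addedge_sym; apply: delset_sym.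
- by apply: addedge_irr => //; apply: delset_irr.
- exact: add_one_sparse ax xX.
- exact: addedge_maxdeg5 ax byb.
- rewrite dd_addedge //; [|exact: delset_sym|exact: delset_irr].
  rewrite dd_delset setTD !inE; have := dd_compl es xX.
  by rewrite (minimal_degree5 me (_ : e x a)) 1?es //; clear; lia.
Qed.

Lemma add_two_realizable e v i j k l : minimal e -> uniq [:: i; j; k; l] ->
  e i v -> e j v -> e k v -> e l v -> ~~ e i j -> ~~ e k l ->
  realizable R (addedge k l (addedge i j (delset [set v] e))).
Proof.
move=> me un iv jv kv lv nij nkl; have [es ei sp md _ IH] := me.
have := un; rewrite /= !inE !negb_or => /and4P[/and3P[ij ik il] /andP[jk jl] kl _].
have Hs : symmetric (delset [set v] e) by apply: delset_sym.
have Hi : irreflexive (delset [set v] e) by apply: delset_irr.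
have n1 : ~~ delset [set v] e i j by apply: contra nij => /andP[].
have n2 : ~~ addedge i j (delset [set v] e) k l.
  rewrite /= !(eq_sym k) (negPf ik) (negPf jk) /= orbF.
  by apply: contra nkl => /andP[].
apply: IH.
- by do 2!apply: addedge_sym.
- by do 2!apply: addedge_irr => //.
- exact: add_two_sparse.
- exact: addedge2_maxdeg5.
- rewrite dd_addedge //; [|exact: addedge_sym|exact: addedge_irr].
  rewrite dd_addedge // dd_delset setTD !inE; have := @dd_compl _ e [set v] v es (set11 v).
  by rewrite (minimal_degree5 me (_ : e v i)) 1?es //; clear; lia.
Qed.

End TightSets.

(** * Tetrahedra in minimal counterexamples *)

Section NoTetrahedron.
Variables (R : realFieldType) (V : finType).
Implicit Types (e : rel V) (X Y Z : {set V}).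
Local Notation minimal e := (@minimal R V e).
Definition outs e X v := [set y | (y \notin X) && e v y].

Lemma dgD1 e X u v : u \in X -> dg e X v = e v u + dg e (X :\ u) v.
Proof. by move=> uX; rewrite -{1}(setD1K uX) dgU1 ?setD11. Qed.

Lemma card_outs e X v : #|outs e X v| = dg e (~: X) v.
Proof. by rewrite dg_card; apply: eq_card => y; rewrite !inE. Qed.

(** Each vertex of the tetrahedron [X] has two outer neighbours, and each of these has at
    most one further neighbour in [X], so for every [v] some [u] has other outer
    neighbours than [v].  Suppose that the four outer neighbours [Q] of [v] and [u] are
    pairwise adjacent.  There are at most five edges between [X] and [Q], since otherwise
    their union were tight with eight vertices.  Four of them start at [v] and [u], so a
    third vertex [x] of [X] has its outer neighbours outside [Q].  The pair of
    [v] and [x] is as desired, because an outer neighbour [s] of [v] adjacent to both of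
    those of [x] would have degree six. *)
Lemma tetrahedron_pair e X : minimal e -> #|X| = 4 -> {in X &, forall u v, u != v -> e u v} ->
  (forall y, y \notin X -> dg e X y <= 2) -> (forall v, v \in X -> #|outs e X v| = 2) ->
  exists v1 v2, [/\ v1 \in X, v2 \in X, v1 != v2, [disjoint outs e X v1 & outs e X v2] &
    exists a b, [/\ a \in outs e X v1 :|: outs e X v2, b \in outs e X v1 :|: outs e X v2,
      a != b & ~~ e a b]].
Proof.
move=> me cX cl mu co; have [es ei sp md _ _] := me; pose S := outs e X.
have [v vX] : exists v, v \in X by apply/set0Pn; rewrite -card_gt0 cX.
have few s : s \in S v -> #|[set u in X :\ v | e u s]| <= 1.
  rewrite inE => /andP[sX vs]; have := mu s sX; rewrite (dgD1 _ _ vX) es vs.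
  have -> : #|[set u in X :\ v | e u s]| = dg e (X :\ v) s.
    by rewrite dg_card; apply: eq_card => u; rewrite !inE es.
  by rewrite add1n.
have [u [uX uv Suv]] : exists u, [/\ u \in X, u != v & [disjoint S v & S u]].
  have /eqP/cards2P[s [s' [_ ES]]] := co v vX; rewrite -/(S v) in ES.
  have sS : s \in S v by rewrite ES !inE eqxx.
  have s'S : s' \in S v by rewrite ES !inE eqxx orbT.
  have : exists2 u, u \in X :\ v & u \notin [set u in X :\ v | e u s] :|: [set u in X :\ v | e u s'].
    apply/subsetPn; apply/negP => /subset_leq_card.
    have c3 : #|X :\ v| = 3 by have := cardsD1 v X; rewrite vX cX => -[->].
    by have := few s sS; have := few s' s'S; rewrite c3 cardsU; clear; lia.
  move=> [u]; rewrite !inE => /andP[uv uX]; rewrite uv uX /= negb_or => /andP[us us'].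
  exists u; split=> //.
  rewrite -setI_eq0; apply/eqP/setP=> y; rewrite inE ES [RHS]inE !inE.
  by apply/negP => /andP[/orP[]/eqP -> /andP[_ h]]; rewrite h in us us'.
pose Q := S v :|: S u.
have QX y : y \in Q -> y \notin X by rewrite !inE => /orP[] /andP[].
have cQ : #|Q| = 4 by rewrite /Q cardsU (disjoint_setI0 Suv) cards0 !co.
have [clQ|] := pselect ({in Q &, forall a b, a != b -> e a b}); last first.
  move=> h; exists v, u; split=> //; first by rewrite eq_sym.
  apply: contrapT => none; apply: h => a b aQ bQ ab; apply/negPn/negP => nab.
  by apply: none; exists a, b.
have dX := clique_dd ei cl; have dQ := clique_dd ei clQ; rewrite cX in dX; rewrite cQ in dQ.
have dXQ : [disjoint X & Q].
  by rewrite disjoint_sym disjoint_subset; apply/subsetP=> y /QX.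
have cXQ : #|X :|: Q| = 8 by rewrite cardsU (disjoint_setI0 dXQ) cards0 cX cQ.
have hd := ddU es dXQ.
have c5 : cnt e X Q <= 5.
  have := sp (X :|: Q); rewrite cXQ hd => /(_ isT) h.
  rewrite leqNgt; apply/negP => h6; apply: (minimal_no_tight me (Y := X :|: Q)); last by rewrite cXQ.
  by split; rewrite cXQ // hd; move: h h6 dX dQ; clear; lia.
have Qv x : x \in X -> S x \subset Q -> 2 <= dg e Q x.
  move=> xX sub; rewrite -(co x xX) dg_card; apply/subset_leq_card/subsetP => y yS.
  by rewrite inE (subsetP sub) //; move: yS; rewrite inE => /andP[].
have uXv : u \in X :\ v by rewrite !inE uv.
have := c5; rewrite /cnt (big_setD1 v) //= (big_setD1 u) //=.
have := Qv v vX (subsetUl _ _); have := Qv u uX (subsetUr _ _).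
have c2 : #|(X :\ v) :\ u| = 2.
  by have := cardsD1 u (X :\ v); have := cardsD1 v X; rewrite uXv vX cX; clear; lia.
have /eqP/cards2P[k [l [kl E]]] := c2.
rewrite E big_setU1 ?inE //= big_set1 => q1 q2 q3.
have {q1 q2 q3} : dg e Q k = 0 \/ dg e Q l = 0 by move: q1 q2 q3; clear; lia.
have kin : k \in X :\ v :\ u by rewrite E !inE eqxx.
have lin : l \in X :\ v :\ u by rewrite E !inE eqxx orbT.
suff main x : x \in X :\ v :\ u -> dg e Q x = 0 -> exists v1 v2, [/\ v1 \in X, v2 \in X, v1 != v2, [disjoint S v1 & S v2] &
    exists a b, [/\ a \in S v1 :|: S v2, b \in S v1 :|: S v2, a != b & ~~ e a b]].
  by case; apply: main.
rewrite !inE => /and3P[xu xv xX] d0.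
have nQ y : y \in S x -> y \notin Q.
  rewrite inE => /andP[_ xy]; apply/negP => yQ; have := dg_gt0 yQ xy; by rewrite d0.
exists v, x; split=> //; first by rewrite eq_sym.
  rewrite disjoint_sym disjoint_subset; apply/subsetP=> y /nQ yQ; rewrite inE.
  by apply: contra yQ => h; rewrite inE h.
have [s sS] : exists s, s \in S v by apply/set0Pn; rewrite -card_gt0 co.
have sQ : s \in Q by rewrite inE sS.
have [t tS nst] : exists2 t, t \in S x & ~~ e s t.
  apply: contrapT => none.
  have all t : t \in S x -> e s t.
    by move=> tS; apply/negPn/negP => nst; apply: none; exists t.
  have : 6 <= dg e setT s; last by have := md s; move=> h /leq_trans/(_ h).
  have d1 : dg e Q s = 3.
    rewrite (dgD1 _ _ sQ) ei dg_full.
      by have := cardsD1 s Q; rewrite sQ cQ => -[<-].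
    by move=> y; rewrite in_setD1 eq_sym => /andP[ys yQ]; apply: clQ.
  have d2 : dg e (S x) s = 2 by rewrite dg_full // co.
  have dQS : [disjoint Q & S x].
    by rewrite disjoint_sym disjoint_subset; apply/subsetP=> y /nQ.
  have vU : v \notin Q :|: S x by rewrite !inE vX.
  have sv : e s v by move: sS; rewrite inE es => /andP[].
  have := dgU1 e s vU; rewrite sv (dgU _ _ dQS) d1 d2 => d6.
  by rewrite -[6]/(true + (3 + 2)) -d6; apply: dg_mono (subsetT _).
exists s, t; split=> //; first by rewrite in_setU sS.
  by rewrite in_setU tS orbT.
by apply: contraNneq (nQ t tS) => <-.
Qed.

(** The hypotheses of [tetrahedron_indep] hold: an outer neighbour of [v4] is adjacent to
    at most one of the other vertices of the tetrahedron, which leaves different ones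
    [a'] and [b'] not adjacent to [x4] and [z4]. *)
Lemma minimal_no_tetrahedron e X : minimal e -> #|X| = 4 ->
  {in X &, forall u v, u != v -> e u v} -> False.
Proof.
move=> me cX cl; have [es ei sp md none _] := me.
have dX := clique_dd ei cl; rewrite cX in dX.
have tX : tight e X by split; rewrite cX //; move: dX; clear; lia.
have mu y : y \notin X -> dg e X y <= 2.
  move=> yX; rewrite leqNgt; apply/negP => h3.
  have cU : #|y |: X| = 5 by rewrite cardsU1 yX cX.
  have := sp (y |: X); rewrite cU ddU1 // => /(_ isT) h.
  apply: (minimal_no_tight me (Y := y |: X)); last by rewrite cU.
  by split; rewrite cU // ddU1 //; move: h h3 dX; clear; lia.
have co v : v \in X -> #|outs e X v| = 2.
  move=> vX; rewrite card_outs; have := dg_compl e X v.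
  rewrite (tight_degree5 me tX) // ?cX //.
  rewrite (dgD1 _ _ vX) ei dg_full.
    by have := cardsD1 v X; rewrite vX cX => -[<-]; clear; lia.
  by move=> u; rewrite in_setD1 eq_sym => /andP[uv uX]; apply: cl.
have [v1 [v2 [v1X v2X d12 dS [a [b [aT bT ab nab]]]]]] := tetrahedron_pair me cX cl mu co.
have v2X1 : v2 \in X :\ v1 by rewrite !inE eq_sym d12.
have c2 : #|(X :\ v1) :\ v2| = 2.
  by have := cardsD1 v2 (X :\ v1); have := cardsD1 v1 X; rewrite v2X1 v1X cX; clear; lia.
have /eqP/cards2P[v3 [v4 [d34 E]]] := c2.
have XE : X = [set v1; v2; v3; v4] by rewrite -!setUA -E !setD1K.
have : v3 \in X :\ v1 :\ v2 by rewrite E !inE eqxx.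
rewrite !inE => /and3P[d32 d31 v3X].
have : v4 \in X :\ v1 :\ v2 by rewrite E !inE eqxx orbT.
rewrite !inE => /and3P[d42 d41 v4X].
have /eqP/cards2P[x1 [z1 [n1 S1]]] := co _ v1X.
have /eqP/cards2P[x2 [z2 [n2 S2]]] := co _ v2X.
have /eqP/cards2P[x3 [z3 [n3 S3]]] := co _ v3X.
have /eqP/cards2P[x4 [z4 [n4 S4]]] := co _ v4X.
have out v x z : outs e X v = [set x; z] -> [/\ x \notin X, z \notin X, e v x & e v z].
  move=> h; have : x \in outs e X v by rewrite h !inE eqxx.
  have : z \in outs e X v by rewrite h !inE eqxx orbT.
  by rewrite !inE => /andP[-> ->] /andP[-> ->].
have [x1X z1X vx1 vz1] := out _ _ _ S1; have [x2X z2X vx2 vz2] := out _ _ _ S2.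
have [x3X z3X vx3 vz3] := out _ _ _ S3; have [x4X z4X vx4 vz4] := out _ _ _ S4.
have mem v x z y : outs e X v = [set x; z] -> y \notin X -> e v y = (y \in [:: x; z]).
  by move=> h yX; have := congr1 (fun A : {set V} => y \in A) h; rewrite !inE yX.
have TE y : (y \in outs e X v1 :|: outs e X v2) = (y \in [:: x1; z1; x2; z2]).
  by rewrite S1 S2 !inE !orbA.
have uT : uniq [:: x1; z1; x2; z2].
  move: dS; rewrite S1 S2 => dS.
  have h y : y \in [set x1; z1] -> y \notin [set x2; z2] by move=> yS; rewrite (disjointFr dS).
  have := h x1; have := h z1; rewrite !inE !eqxx orbT => /(_ isT) h1 /(_ isT) h2.
  by rewrite /= !inE negb_or n1 h1 h2 n2.
pose Y := [set v1; v2; v3].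
have YX : Y = X :\ v4.
  apply/setP=> y; rewrite XE !inE; case: (eqVneq y v4) => [->|_]; last by rewrite orbF.
  by rewrite (negPf d41) (negPf d42) eq_sym (negPf d34).
have cY : #|Y| = 3 by rewrite YX; have := cardsD1 v4 X; rewrite v4X cX => -[->].
have free x : x \notin X -> e v4 x -> 2 <= #|[set u in Y | ~~ e u x]|.
  move=> xX vx; have h1 : dg e Y x <= 1.
    have := mu x xX; rewrite (dgD1 _ _ v4X) es vx YX; clear; lia.
  have h2 : #|[set u in Y | ~~ e u x]| + dg e Y x = 3.
    rewrite -cY -(cardsID [set u | e x u] Y) addnC dg_card; congr (_ + _).
      by apply: eq_card => u; rewrite !inE.
    by apply: eq_card => u; rewrite !inE es andbC.
  by move: h1 h2; clear; lia.
have [a' a'A] : exists a', a' \in [set u in Y | ~~ e u x4].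
  by apply/set0Pn; rewrite -card_gt0; apply: leq_trans (free x4 x4X vx4).
have [b' b'B] : exists b', b' \in [set u in Y | ~~ e u z4] :\ a'.
  apply/set0Pn; rewrite -card_gt0; have := free z4 z4X vz4; rewrite (cardsD1 a').
  by case: (_ \in _); [|move/ltnW].
have [a'Y na'] : a' \in Y /\ ~~ e a' x4 by move: a'A; rewrite in_set => /andP.
have [ba' b'Y nb'] : [/\ b' != a', b' \in Y & ~~ e b' z4].
  by move: b'B; rewrite in_setD1 in_set => /and3P.
have adjX y : y \in [:: x1; z1; x2; z2] -> exists2 x, x \in X & e y x.
  by rewrite !inE => /or4P[] /eqP ->; [exists v1|exists v1|exists v2|exists v2]; rewrite // es.
have [a'X b'X] : a' \in X :\ v4 /\ b' \in X :\ v4 by rewrite -YX.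
have [] : realizable R e; last by move=> p hp; apply: none; exists p.
rewrite TE in aT; rewrite TE in bT.
have [xa xaX axa] := adjX _ aT; have [xb xbX bxb] := adjX _ bT.
have hJ := add_one_realizable me ab nab axa bxb xaX xbX.
have [a'4 {}a'X] : a' != v4 /\ a' \in X by move: a'X; rewrite in_setD1 => /andP.
have [b'4 {}b'X] : b' != v4 /\ b' \in X by move: b'X; rewrite in_setD1 => /andP.
have hH : realizable R (addedge b' z4 (addedge a' x4 (delset [set v4] e))).
  apply: add_two_realizable => //; rewrite 1?[e x4 _]es 1?[e z4 _]es //; try exact: cl.
  have ne u x : u \in X -> x \notin X -> u != x by move=> uX; apply: contraNneq => <-.
  rewrite /= !inE !negb_or n4 (eq_sym a' b') ba' (eq_sym x4 b').
  by rewrite !ne.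
rewrite XE in hJ.
apply: (@tetrahedron_indep R V e v1 v2 v3 v4 x1 z1 x2 z2 x3 z3 x4 z4 a b a' b') => //;
  rewrite -?XE //.
- rewrite /= !inE !negb_or d12 d34 !(eq_sym v1) !(eq_sym v2) d31 d41 d32 d42 //.
- by move=> y; rewrite !inE => /orP[|/orP[|/orP[|/orP[|/orP[|/orP[|/orP[]]]]]]] /eqP ->.
- by move=> y yX; rewrite (mem v1 x1 z1).
- by move=> y yX; rewrite (mem v2 x2 z2).
- by move=> y yX; rewrite (mem v3 x3 z3).
- by move=> y yX; rewrite (mem v4 x4 z4).
- by move: a'Y; rewrite !inE orbA.
- by move: b'Y; rewrite !inE orbA.
- by rewrite eq_sym.
Qed.

End NoTetrahedron.

(** * Affine stresses *)

Section AffineStress.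
Variables (R : realFieldType) (V : finType).
Implicit Types (e : rel V) (X Y Z : {set V}).
Local Notation minimal e := (@minimal R V e).
Local Notation conf := (V -> 'rV[R]_3).
Local Open Scope ring_scope.

(** The force densities at a vertex form an affine dependency of its neighbours, and the
    position of the vertex itself does not occur. *)
Definition astress e (p : conf) (w : V -> V -> R) := weighting e w /\
  forall v, \sum_u w v u = 0 /\ \sum_u w v u *: p u = 0.

Lemma zopen_family (I : finType) (C : I -> Prop) (G : I -> rel V) :
  zopen (fun p : conf => forall i, C i -> indep (G i) p).
Proof. by apply: zopen_all => i; apply: zopen_imply; exact: zopen_indep. Qed.

Lemma realizable_family (I : finType) (C : I -> Prop) (G : I -> rel V) :
  (forall i, C i -> realizable R (G i)) -> exists p : conf, forall i, C i -> indep (G i) p.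
Proof.
move=> h; apply: zopen_meet_all => i; first by apply: zopen_imply; exact: zopen_indep.
by have [/h[p hp]|nC] := pselect (C i); [exists p|exists (fun=> 0)].
Qed.

Lemma deledge_realizable e u v : minimal e -> e u v -> realizable R (deledge u v e).
Proof.
move=> [es ei sp md _ IH] uv; have sub x y : deledge u v e x y -> e x y by case/andP.
apply: IH.
- by move=> x y; rewrite /deledge es orbC (andbC (x == v)) (andbC (x == u)).
- by move=> x; rewrite /deledge ei.
- exact: sub_sparse sub sp.
- exact: sub_maxdeg5 sub md.
- by apply: dd_lt sub uv _; rewrite /deledge !eqxx andbF.
Qed.

(** Three adjacent neighbours of [v] would form a tetrahedron with it. *)
Lemma nonadjacent_pair e v s : minimal e -> uniq s -> size s = 3%N ->
  {in s, forall u, e v u} -> exists a b, [/\ a \in s, b \in s, a != b & ~~ e a b].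
Proof.
move=> me un s3 nb; apply: contrapT => none; have [es ei _ _ _ _] := me.
apply: (minimal_no_tetrahedron me (X := v |: [set x in s])) => [|x y].
  rewrite cardsU1 cardsE (card_uniqP un) s3 inE.
  by rewrite (contraNN (nb v)) ?ei.
rewrite !inE => /orP[/eqP -> /orP[/eqP ->|ys]|xs /orP[/eqP -> _|ys xy]].
- by rewrite eqxx.
- by move=> _; apply: nb.
- by rewrite es nb.
by apply: contrapT => nxy; apply: none; exists x, y; split=> //; apply/negP.
Qed.

Lemma two_pairs e v : minimal e -> dg e setT v = 5%N ->
  exists a b c d, [/\ uniq [:: a; b; c; d], {in [:: a; b; c; d], forall u, e v u},
    ~~ e a b & ~~ e c d].
Proof.
move=> me d5; pose N := [set u | e v u].
have cN : #|N| = 5%N by rewrite -d5 dg_card; apply: eq_card => u; rewrite !inE.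
have triple (X : {set V}) : X \subset N -> (2 < #|X|)%N ->
    exists a b, [/\ a \in X, b \in X, a != b & ~~ e a b].
  move=> XN; rewrite cardE; have := enum_uniq X.
  have mem u : u \in enum X -> u \in X by rewrite mem_enum.
  case: (enum X) mem => [|x [|y [|z s]]] // mem un _.
  have sub u : u \in [:: x; y; z] -> u \in X.
    by move=> h; apply: mem; rewrite -[[:: x, y, z & s]]/([:: x; y; z] ++ s) mem_cat h.
  have u3 : uniq [:: x; y; z].
    by move: un; rewrite -[[:: x, y, z & s]]/([:: x; y; z] ++ s) cat_uniq => /and3P[].
  have n3 : {in [:: x; y; z], forall u, e v u}.
    by move=> u /sub /(subsetP XN); rewrite inE.
  have [a [b [aX bX ab nab]]] := nonadjacent_pair me u3 erefl n3.
  by exists a, b; split=> //; apply: sub.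
have [|a [b [aN bN ab nab]]] := triple N (subxx N); first by rewrite cN.
have c3 : #|N :\ a :\ b| = 3%N.
  move: cN; rewrite (cardsD1 a) aN (cardsD1 b) in_setD1 eq_sym ab bN.
  by rewrite !add1n => -[->].
have [||c [d [cN' dN cd ncd]]] := triple (N :\ a :\ b).
- by apply: subset_trans (subsetDl _ _); exact: subsetDl.
- by rewrite c3.
exists a, b, c, d; move: cN' dN aN bN; rewrite !inE.
move=> /and3P[cb ca vc] /and3P[db da vd] va vb; split=> //.
  by rewrite /= !inE !negb_or ab !(eq_sym _ c) !(eq_sym _ d) ca cb da db eq_sym cd.
by move=> u; rewrite !inE => /or4P[] /eqP ->.
Qed.

Definition single_bars e (i : V * V * V) :=
  let: (v, a, b) := i in [&& e v a, e v b, a != b & ~~ e a b].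
Definition single_graph e (i : V * V * V) : rel V :=
  let: (v, a, b) := i in addedge a b (delset [set v] e).
Definition double_bars e (i : V * V * V * V * V) := let: (v, a, b, c, d) := i in
  [&& uniq [:: a; b; c; d], e a v, e b v, e c v, e d v, ~~ e a b & ~~ e c d].

Definition double_graph e (i : V * V * V * V * V) : rel V :=
  let: (v, a, b, c, d) := i in addedge c d (addedge a b (delset [set v] e)).

(** The reduced graphs are indexed by tuples of vertices, so that there are finitely many
    conditions. *)
Record good e (p : conf) : Prop := Good {
  good_gp : generalpos p;
  good_one : forall i, single_bars e i -> indep (single_graph e i) p;
  good_two : forall i, double_bars e i -> indep (double_graph e i) p;
  good_del : forall i : V * V, e i.1 i.2 -> indep (deledge i.1 i.2 e) p }.

(** The reduced graphs have fewer edges and are sparse, so each is realizable; there are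
    finitely many, and independence and general position are open conditions. *)
Lemma meet_good e (O : conf -> Prop) : minimal e -> zopen O -> (exists p, O p) ->
  exists p, good e p /\ O p.
Proof.
move=> me zO hO; have [es _ _ _ _ _] := me.
have [|p1 h1] := realizable_family (C := fun i => is_true (single_bars e i)) (G := single_graph e).
  move=> [[v a] b] /and4P[va vb ab nab].
  by apply: (add_one_realizable me ab nab (x := v) (y := v)); rewrite ?inE // es.
have [|p2 h2] := realizable_family (C := fun i => is_true (double_bars e i)) (G := double_graph e).
  move=> [[[[v a] b] c] d] /and5P[un av bv cv /and3P[dv nab ncd]].
  exact: add_two_realizable.
have [|p3 h3] := realizable_family (C := fun i : V * V => is_true (e i.1 i.2))
    (G := fun i : V * V => deledge i.1 i.2 e).
  by move=> [u v] /=; apply: deledge_realizable.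
have z1 := @zopen_generalpos R V.
have z2 := @zopen_family _ (fun i => is_true (single_bars e i)) (single_graph e).
have z3 := @zopen_family _ (fun i => is_true (double_bars e i)) (double_graph e).
have z4 := @zopen_family _ (fun i : V * V => is_true (e i.1 i.2)) (fun i : V * V => deledge i.1 i.2 e).
have [p [[[[g1 g2] g3] g4] g5]] := zopen_meet (zopen_and (zopen_and (zopen_and z1 z2) z3) z4) zO
  (zopen_meet (zopen_and (zopen_and z1 z2) z3) z4
    (zopen_meet (zopen_and z1 z2) z3
      (zopen_meet z1 z2 (@generalpos_exists R V) (ex_intro _ _ h1)) (ex_intro _ _ h2))
    (ex_intro _ _ h3)) hO.
by exists p; split.
Qed.

Lemma stress_unique e p w u v : good e p -> stress e p w -> e u v -> w u v = 0 ->
  forall x y, w x y = 0.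
Proof.
move=> gp [[sw w0] hf] uv wuv; apply: (good_del gp (i := (u, v)) uv); split=> //; split=> // x y.
rewrite negb_and negbK => /orP[/w0 //|] /=.
by move=> /orP[] /andP[/eqP -> /eqP ->] //; rewrite sw.
Qed.

(** A stress of the dependent graph is unique up to a factor, since deleting any edge
    makes the graph independent.  At each vertex it therefore agrees, up to a factor,
    with the stress found by [five_neighbours]. *)
Lemma good_astress e p : minimal e -> good e p ->
  exists w, astress e p w /\ forall u v, e u v -> w u v != 0.
Proof.
move=> me gp; have [es ei _ _ none _] := me.
have [w [hw [x [y wxy]]]] : exists w, stress e p w /\ exists x y, w x y != 0.
  apply: contrapT => h; apply: none; exists p => w hw u v.
  by apply/eqP/negPn/negP => wuv; apply: h; exists w; split=> //; exists u, v.
have [[sw w0] hf] := hw; exists w.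
have nz u v : e u v -> w u v != 0.
  by move=> uv; apply: contra_neq wxy => h; exact: stress_unique gp hw uv h x y.
split=> //; have sum0 v : \sum_u w v u = 0.
  have [d0|d5] := minimal_degree v me.
    rewrite big1 // => u _; apply: w0; apply/negP => vu.
    by have := dg_gt0 (in_setT u) vu; rewrite d0.
  have [a [b [c [d [un nb nab ncd]]]]] := two_pairs me d5.
  have [va vb vc vd] : [/\ e v a, e v b, e v c & e v d].
    by split; apply: nb; rewrite !inE eqxx ?orbT.
  have dep q : ~ indep e (update p v q) by move=> hq; apply: none; exists (update p v q).
  have ind : indep (addedge c d (addedge a b (delset [set v] e))) p.
    apply: (good_two gp (i := (v, a, b, c, d))).
    by rewrite /double_bars un !(es _ v) va vb vc vd nab.
  have cN : #|[set u | e v u]| = 5%N by rewrite -d5 dg_card; apply: eq_card => u; rewrite !inE.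
  have [x1 y1 z1 vx vy vz un3|w1 [hw1 s1 wn]] :=
    five_neighbours es ei cN (good_gp gp) dep un nb nab ncd ind.
    have n3 : {in [:: x1; y1; z1], forall u, e v u}.
      by move=> u; rewrite !inE => /or3P[] /eqP ->.
    have [t [u [ht hu tu ntu]]] := nonadjacent_pair me un3 erefl n3.
    exists t, u; split=> //; split=> //; apply: (good_one gp (i := (v, t, u))).
    by rewrite /single_bars !n3 // tu.
  pose s := w v a / w1 v a.
  have [[sw1 w10] hf1] := hw1.
  have hd : forall x y, w x y - s * w1 x y = 0.
    apply: (@stress_unique e p (fun x y => w x y - s * w1 x y) v a) => //.
    - split; first split.
      + by move=> x1 y1; rewrite sw sw1.
      + by move=> x1 y1 n1; rewrite w0 // w10 // mulr0 subr0.
      + move=> x1; rewrite /force; under eq_bigr do rewrite scalerBl -scalerA.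
        by rewrite sumrB -scaler_sumr -/(force p w x1) -/(force p w1 x1) hf hf1 scaler0 subrr.
    - by rewrite /s divfK ?subrr // wn.
  transitivity (\sum_u s * w1 v u); last by rewrite -mulr_sumr s1 mulr0.
  by apply: eq_bigr => u _; apply/eqP; rewrite -subr_eq0 hd.
split=> // v; split=> //.
by have := hf v; rewrite /force sum_scaleB sum0 scale0r sub0r => /eqP; rewrite oppr_eq0 => /eqP.
Qed.

(** Affine stresses are the solutions of a system that depends polynomially on the
    positions; having only the zero solution is an open condition, so it would occur at
    a good configuration. *)
Lemma minimal_astress e p : minimal e ->
  exists w, astress e p w /\ exists u v, w u v != 0.
Proof.
move=> me.
pose a (j : V + V * 'I_3) u x (p : conf) : R := match j with
  | inl v => if u == v then 1 else 0
  | inr (v, k) => if u == v then p x 0 k else 0 end.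
have ha j u x : polyline (a j u x).
  case: j => [v|[v k]]; apply: polyline_if; [exact: polyline_const|exact: polyline_coord].
have sumE (w f : V -> V -> R) v : \sum_u \sum_x w u x * (if u == v then f u x else 0) =
    \sum_x w v x * f v x.
  rewrite (bigD1 v) //= eqxx [X in _ + X]big1 ?addr0 // => u /negPf ->.
  by rewrite big1 // => x _; rewrite mulr0.
have zO := zopen_weighting (e := e) ha.
apply: contrapT => none.
have Op : forall w, weighting e w -> (forall j, \sum_u \sum_v w u v * a j u v p = 0) ->
    forall u v, w u v = 0.
  move=> w hw hj u v; apply/eqP/negPn/negP => wuv; apply: none; exists w.
  split; last by exists u, v.
  split=> // x; split.
    rewrite -[RHS](hj (inl x)) (sumE w (fun _ _ => 1)).
    by apply: eq_bigr => y _; rewrite mulr1.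
  apply/rowP=> k; rewrite summxE mxE -[RHS](hj (inr (x, k))) (sumE w (fun _ y => p y 0 k)).
  by apply: eq_bigr => y _; rewrite mxE.
have [q [gq hq]] := meet_good me zO (ex_intro _ p Op).
have [w [[hw h1] nz]] := good_astress me gq.
have w0 : forall u v, w u v = 0.
  apply: hq => // -[v|[v k]].
    rewrite (sumE w (fun _ _ => 1)) -[RHS](h1 v).1.
    by apply: eq_bigr => y _; rewrite mulr1.
  rewrite (sumE w (fun _ y => q y 0 k)).
  have := congr1 (fun r : 'rV[R]_3 => r 0 k) (h1 v).2; rewrite summxE mxE => {2}<-.
  by apply: eq_bigr => y _; rewrite mxE.
apply: (mnone me); exists p => w' [[_ w0'] _] u v.
by apply: w0'; apply/negP => uv; have := nz u v uv; rewrite w0 eqxx.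
Qed.

End AffineStress.

(** * The contradiction from coplanar neighbours *)

Section Contradiction.
Variables (R : realFieldType) (V : finType).
Implicit Types (e : rel V) (X Y Z S D : {set V}).
Local Notation minimal e := (@minimal R V e).
Local Notation conf := (V -> 'rV[R]_3).
Local Open Scope ring_scope.

Lemma card_nbrs e v : minimal e -> forall u, e v u -> #|[set x | e v x]| = 5%N.
Proof.
move=> me u vu; rewrite -(minimal_degree5 me vu) dg_card.
by apply: eq_card => x; rewrite !inE.
Qed.

(** Place the vertices so that [S] is the only coplanar set of four.  A nonzero affine
    stress exists there too; call a vertex dead if all its edges are unstressed, and let
    [D] be the set of dead vertices.  If one edge at a vertex is unstressed then the
    other four neighbours are affinely dependent, so the vertex is dead or these four
    neighbours are [S].  Hence an edge from a live to a dead vertex has its live end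
    adjacent to all of [S], and its dead end is the fifth neighbour there.  The edge [y t] is
    unstressed, because [t] lies outside the plane of [S]; so [t] is dead, since it is not
    adjacent to all of [S], and by connectedness there is an edge from a live to a dead
    vertex. *)
Lemma coplanar_cut e S y t : minimal e -> #|S| = 4%N -> {in S, forall s, e y s} ->
  e y t -> t \notin S -> ~ {in S, forall s, e t s} ->
  exists D, (exists v u, [/\ v \notin D, u \in D & e v u]) /\
    forall v u, v \notin D -> u \in D -> e v u -> {in S, forall s, e v s} /\ u \notin S.
Proof.
move=> me cS yS yt tS nt; have [es ei _ _ _ _] := me.
have [p [aff cop]] := @only_coplanar R V S cS.
have [w [[[sw w0] wa] [a [b wab]]]] := minimal_astress p me.
pose D := [set x | [forall z, w x z == 0]].
have DP x : reflect (forall z, w x z = 0) (x \in D).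
  by rewrite inE; apply: (iffP forallP) => h z; apply/eqP; apply: h.
have dead v u : e v u -> w v u = 0 -> v \in D \/ {in S, forall s, e v s} /\ u \notin S.
  move=> vu wvu; pose A := [set x | e v x] :\ u.
  have cA : #|A| = 4%N.
    by have := cardsD1 u [set x | e v x]; rewrite (card_nbrs me vu) inE vu => -[->].
  have [AS|AS] := eqVneq A S.
    right; split; last by rewrite -AS !inE eqxx.
    by move=> s; rewrite -AS !inE => /andP[].
  left; apply/DP; apply: (aff A) => //; first by rewrite cA.
  - by move=> x; rewrite !inE negb_and negbK => /orP[/eqP -> //|/w0].
  - exact: (wa v).1.
  - exact: (wa v).2.
have flat v u : {in S, forall s, e v s} -> u \notin S -> e v u -> w v u = 0.
  move=> vS uS vu; apply: (cop (w v)) => //; [|exact: (wa v).1|exact: (wa v).2].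
  move=> x xuS; apply: w0; apply: contra xuS => vx.
  have sub : u |: S \subset [set x | e v x].
    by apply/subsetP=> z; rewrite !inE => /orP[/eqP ->|/vS].
  have /eqP -> : u |: S == [set x | e v x].
    by rewrite eqEcard sub (card_nbrs me vu) cardsU1 uS cS.
  by rewrite inE.
have bd v u : v \notin D -> u \in D -> e v u -> {in S, forall s, e v s} /\ u \notin S.
  move=> vD /DP uD vu; have wvu : w v u = 0 by rewrite sw uD.
  by case: (dead v u vu wvu) => // vD'; rewrite vD' in vD.
exists D; split=> //; apply: contrapT => none.
have tD : t \in D.
  have ty : e t y by rewrite es.
  have wty : w t y = 0 by rewrite sw flat.
  by have [//|[/nt]] := dead t y ty wty.
have aD : a \in ~: D by rewrite in_setC; apply/negP => /DP /(_ b) wab0; rewrite wab0 eqxx in wab.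
have ab : e a b by apply: contraNT wab => /w0 ->.
have cl u v : u \in ~: D -> e u v -> v \in ~: D.
  rewrite !in_setC => uD uv; apply/negP => vD; apply: none; exists u, v; split=> //.
have ty : e t y by rewrite es.
by have := minimal_connected me cl ab aD ty; rewrite in_setC tD.
Qed.

(** Let [S] consist of four neighbours of a vertex [v], one of which is not adjacent to
    the fifth neighbour [x].  [coplanar_cut] gives an edge [y t] with [S] adjacent to
    [y] and [t] in [D].  Exchanging [t] with the element [s'] of [S] gives another
    set [S'] of neighbours of [y], and all vertices adjacent to all of [S'] have the same
    neighbours as [y].  A second application yields a set [D'] that can be entered
    only at [s'].  In a good configuration a stress splits at [s'] into the part
    inside [D'] and the rest, each in equilibrium.  One of the parts has at most three
    edges at [s'], which is impossible in general position unless it has none.  So all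
    neighbours of [s'] lie outside [D'] and have the same neighbours as [y].  This is a complete
    bipartite graph on ten vertices with 25 edges, one too many. *)
Lemma minimal_false e : ~ minimal e.
Proof.
move=> me; have [es ei sp _ _ _] := me.
have [w0 [[[_ w00] _] [v [x0 wv]]]] := minimal_astress (fun=> 0) me.
have vx0 : e v x0 by apply: contraNT wv => /w00 ->.
have [x [s' [? [? [un nb nx _]]]]] := two_pairs me (minimal_degree5 me vx0).
pose S := [set u | e v u] :\ x.
have [vx vs'] : e v x /\ e v s' by split; apply: nb; rewrite !inE eqxx ?orbT.
have cS : #|S| = 4%N.
  by have := cardsD1 x [set u | e v u]; rewrite (card_nbrs me vx) inE vx => -[->].
have vS : {in S, forall s, e v s} by move=> s; rewrite !inE => /andP[].
have s'S : s' \in S.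
  rewrite !inE vs' andbT eq_sym.
  by move: un; rewrite /= !inE !negb_or => /andP[/andP[]].
have [||D [[y [t [yD tD yt]]] bd]] := coplanar_cut me cS vS vx.
- by rewrite !inE eqxx.
- by move=> /(_ s' s'S); rewrite (negPf nx).
have [yS tS] := bd _ _ yD tD yt.
have SD s : s \in S -> s \notin D.
  by move=> sS; apply/negP => sD; have [_] := bd _ _ yD sD (yS s sS); rewrite sS.
pose S' := t |: (S :\ s').
have cSs : #|S :\ s'| = 3%N by have := cardsD1 s' S; rewrite s'S cS => -[->].
have cS' : #|S'| = 4%N by rewrite cardsU1 in_setD1 (negPf tS) andbF cSs.
have yS' : {in S', forall s, e y s}.
  by move=> s; rewrite in_setU1 in_setD1 => /orP[/eqP -> //|/andP[_ /yS]].
have ts' : t != s' by apply: contraNneq tS => ->.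
have s'S' : s' \notin S' by rewrite in_setU1 in_setD1 eqxx eq_sym (negPf ts').
have twin u : {in S', forall s, e u s} -> forall z, e y z -> e u z.
  move=> uS'; have ut : e u t by apply: uS'; rewrite in_setU1 eqxx.
  have uD : u \notin D.
    apply/negP => uD; have [s sS] : exists s, s \in S :\ s' by apply/set0Pn; rewrite -card_gt0 cSs.
    have us : e u s by apply: uS'; rewrite in_setU1 sS orbT.
    have {}sS : s \in S by move: sS; rewrite in_setD1 => /andP[].
    have su : e s u by rewrite es.
    by have [/(_ s sS)] := bd _ _ (SD s sS) uD su; rewrite ei.
  have [uS _] := bd _ _ uD tD ut.
  have sub : t |: S \subset [set z | e y z].
    by apply/subsetP=> z /setU1P[->|/yS h]; rewrite inE.
  have E : t |: S = [set z | e y z].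
    by apply/eqP; rewrite eqEcard sub (card_nbrs me yt) cardsU1 tS cS.
  move=> z yz; have : z \in t |: S by rewrite E inE.
  by case/setU1P=> [->|/uS].
have [|D' [[b [b' [bD b'D bb']]] bd']] := coplanar_cut me cS' yS' (yS s' s'S) s'S'.
  by move=> /twin /(_ s' (yS s' s'S)); rewrite ei.
(* every edge that enters [D'] ends at [s'] *)
have cut u z : u \notin D' -> z \in D' -> e u z -> z = s' /\ (forall x, e y x -> e u x).
  move=> uD zD uz; have [/twin tw zS'] := bd' _ _ uD zD uz; split=> //.
  have E : [set x | e y x] = [set x | e u x].
    apply/eqP; rewrite eqEcard (card_nbrs me uz) (card_nbrs me yt) leqnn andbT.
    by apply/subsetP=> q; rewrite !inE; apply: tw.
  have sub : s' |: S' \subset [set x | e y x].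
    by apply/subsetP=> q /setU1P[->|/yS' h]; rewrite inE //; apply: yS.
  have E' : s' |: S' = [set x | e y x].
    by apply/eqP; rewrite eqEcard sub (card_nbrs me yt) cardsU1 s'S' cS'.
  have : z \in s' |: S' by rewrite E' E inE.
  by rewrite in_setU1 (negPf zS') orbF => /eqP.
have [bs' _] := cut _ _ bD b'D bb'; rewrite bs' in b'D bb'.
have s'b : e s' b by rewrite es.
pose N := [set u | e s' u]; pose B := N :\: D'; pose C := N :&: D'.
have cN : #|N| = 5%N by apply: card_nbrs s'b.
have cBC : (#|B| + #|C| = 5)%N by rewrite addnC -cN cardsID.
have bB : b \in B by rewrite !inE s'b bD.
have [p [gp _]] := meet_good me (@zopen_true R V) (ex_intro _ (fun=> 0) I).
have [w [[[sw wz] wa] nz]] := good_astress me gp.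
have hf u : force p w u = 0.
  by rewrite /force sum_scaleB (wa u).1 (wa u).2 scale0r subrr.
pose w1 (u z : V) := if (u \in D') && (z \in D') then w u z else 0.
have f1 : force p w1 s' = 0.
  have sw1 u z : w1 u z = w1 z u by rewrite /w1 andbC sw.
  have := force_sum p sw1; rewrite (bigD1 s') //= big1 ?addr0 // => u us'.
  rewrite /force; have [uD|uD] := boolP (u \in D'); last first.
    by rewrite big1 // => z _; rewrite /w1 (negPf uD) scale0r.
  rewrite -[RHS](hf u); apply: eq_bigr => z _; rewrite /w1 uD /=; case: ifP => // /negbT zD.
  have -> : w u z = 0; last by [].
  apply: wz; apply/negP => uz; have zu : e z u by rewrite es.
  by have [E _] := cut _ _ zD uD zu; rewrite E eqxx in us'.
pose w2 (u z : V) := w u z - w1 u z.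
have f2 : force p w2 s' = 0.
  rewrite /force; under eq_bigr do rewrite scalerBl.
  by rewrite sumrB -/(force p w s') -/(force p w1 s') hf f1 subrr.
have s'N : s' \notin N by rewrite inE ei.
have few (A : {set V}) (w' : V -> V -> R) : A \subset N -> (#|A| <= 3)%N -> force p w' s' = 0 ->
    (forall u, u \notin A -> w' s' u = 0) -> forall u, w' s' u = 0.
  move=> AN cA f' out; have s'A : s' \notin A by apply: contra s'N; apply: (subsetP AN).
  apply: (@affindep_force R V p w' s' A s'A) => //; apply: (good_gp gp).
  by rewrite cardsU1 s'A.
have [B3|B4] := leqP #|B| 3.
  have := few B w2 (subsetDl _ _) B3 f2 _ b; rewrite /w2 /w1 (negPf bD) andbF subr0.
  move=> h; have := nz _ _ s'b; rewrite h ?eqxx // => u uB; rewrite b'D /=.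
  have [uD|uD] := boolP (u \in D'); first by rewrite subrr.
  by rewrite subr0 wz //; move: uB; rewrite !inE uD.
have [C0|/set0Pn[c cC]] := eqVneq C set0; last first.
  have C3 : (#|C| <= 3)%N by move: cBC B4; clear; lia.
  have [s'c cD] : e s' c /\ c \in D' by move: cC; rewrite !inE => /andP[].
  have := few C w1 (subsetIl _ _) C3 f1 _ c; rewrite /w1 b'D cD /= => h.
  have := nz _ _ s'c; rewrite h ?eqxx // => u uC.
  by case: ifP => // uD; apply: wz; move: uC; rewrite !inE uD andbT.
(* all neighbours of [s'] are twins of [y]: a complete bipartite graph *)
have tw u z : u \in N -> e y z -> e u z.
  rewrite inE => s'u; have uD : u \notin D'.
    apply/negP => uD; have : u \in C by rewrite !inE s'u.
    by rewrite C0 inE.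
  have us' : e u s' by rewrite es.
  by have [_] := cut _ _ uD b'D us'; apply.
pose M := [set z | e y z].
have cM : #|M| = 5%N by apply: card_nbrs yt.
have dNM : [disjoint N & M].
  rewrite -setI_eq0; apply/eqP/setP=> z; rewrite !inE; apply/negP => /andP[s'z yz].
  by have := tw z z _ yz; rewrite inE ei => /(_ s'z).
have cNM : cnt e N M = 25%N.
  rewrite /cnt (eq_bigr (fun=> 5%N)) ?sum_nat_const ?cN // => u uN.
  by rewrite dg_full // => z; rewrite inE; apply: tw.
have := sp (N :|: M); rewrite cardsU (disjoint_setI0 dNM) cards0 cN cM => /(_ isT).
by rewrite ddU // cNM; clear; lia.
Qed.

Lemma sparse_realizable e : symmetric e -> irreflexive e -> sparse e -> maxdeg5 e ->
  realizable R e.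
Proof.
have [n] := ubnP (dd e setT); elim: n e => // n IH e hn es ei sp md.
apply: contrapT => none; apply: (@minimal_false e); split=> // e' es' ei' sp' md' lt.
by apply: IH => //; apply: leq_trans lt _.
Qed.

End Contradiction.

Local Open Scope ring_scope.

(** * The rigidity matrix *)

Section Edges.
Variable V : finType.
Implicit Types (e : rel V) (X : {set V}).

Lemma edgeP e a : reflect (exists u v, e u v /\ a = [set u; v]) (a \in edges e).
Proof.
apply: (iffP imsetP) => [[[u v]]|[u [v [uv ->]]]]; first by rewrite inE => uv ->; exists u, v.
by exists (u, v); rewrite ?inE.
Qed.

Lemma set2_inj (u v x y : V) : [set u; v] = [set x; y] -> (u = x /\ v = y) \/ (u = y /\ v = x).
Proof.
move=> E; have hu : u \in [set x; y] by rewrite -E set21.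
have hv : v \in [set x; y] by rewrite -E set22.
have hx : x \in [set u; v] by rewrite E set21.
have hy : y \in [set u; v] by rewrite E set22.
clear E; move: hu hv hx hy; rewrite !inE.
by move=> /orP[]/eqP hu /orP[]/eqP hv /orP[]/eqP hx /orP[]/eqP hy; subst; auto.
Qed.

Lemma in_edges e u v : symmetric e -> ([set u; v] \in edges e) = e u v.
Proof.
move=> es; apply/edgeP/idP => [[x [y [xy /set2_inj[[-> ->]|[-> ->]]]]]|uv] //; first by rewrite es.
by exists u, v.
Qed.

Lemma edges_inner e X : edges (inner X e) = [set a in edges e | a \subset X].
Proof.
apply/setP=> a; rewrite inE; apply/edgeP/andP => [[u [v [/and3P[uv uX vX] ->]]]|[/edgeP[u [v [uv ->]]]]].
  by split; [apply/edgeP; exists u, v|rewrite subUset !sub1set uX].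
by rewrite subUset !sub1set => /andP[uX vX]; exists u, v; split=> //=; rewrite uv uX.
Qed.

Lemma card_ordered_edges e : symmetric e -> irreflexive e -> dd e setT = (2 * #|edges e|)%N.
Proof.
move=> es ei; rewrite dd_pairs -sum1_card.
rewrite (partition_big_imset (fun p : V * V => [set p.1; p.2])) /= -/(edges e).
rewrite mulnC -sum_nat_const; apply: eq_bigr => a /edgeP[u [v [uv ->]]].
have nuv : (u, v) != (v, u) by apply: contraTneq uv => -[-> _]; rewrite ei.
have <- : #|[set (u, v); (v, u)]| = 2%N by rewrite cards2 nuv.
rewrite sum1dep_card; apply: eq_card => -[x y]; rewrite !inE /=.
apply/andP/orP => [[xy /eqP/set2_inj[[-> ->]|[-> ->]]]|[] /eqP[-> ->]].
- by left.
- by right.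
- by rewrite uv eqxx.
- by rewrite es uv setUC eqxx.
Qed.

Lemma dd_inner e X : dd (inner X e) setT = dd e X.
Proof.
rewrite /dd /cnt [RHS]big_mkcond [LHS]big_mkcond; apply: eq_bigr => v _; rewrite in_setT.
rewrite /dg [LHS]big_mkcond [in RHS]big_mkcond; case: ifP => vX; last first.
  by rewrite big1 // => u _; rewrite /= vX andbF in_setT.
by apply: eq_bigr => u _; rewrite /= vX in_setT; case: (u \in X); rewrite ?andbT ?andbF.
Qed.

Lemma dd_induced e X : symmetric e -> irreflexive e -> dd e X = (2 * induced_edges e X)%N.
Proof.
move=> es ei; rewrite -dd_inner card_ordered_edges; [|exact: inner_sym|exact: inner_irr].
by rewrite edges_inner.
Qed.

Lemma sparse_three_sparse e : symmetric e -> irreflexive e -> (sparse e <-> three_sparse e).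
Proof.
by move=> es ei; split=> h X cX; have := h X cX; rewrite dd_induced //; move: cX; clear; lia.
Qed.

End Edges.

Section RowSpace.
Variables (F : ringType) (V : finType).
Implicit Types (e : rel V) (x : {set V} -> F).

(** The rows of the rigidity matrix are indexed by edges, which are sets; the coefficients
    of a combination of rows become a symmetric weighting of pairs. *)
Definition density e x (u v : V) : F := if e u v then x [set u; v] else 0.

Lemma sum_edges e x w (g : V -> F) : symmetric e -> irreflexive e ->
  \sum_(a in edges e) x a * (if w \in a then \sum_(u in a :\ w) g u else 0) =
  \sum_u density e x w u * g u.
Proof.
move=> es ei.
transitivity (\sum_(a in edges e) \sum_(u | (w \in a) && (u \in a :\ w)) x a * g u).
  apply: eq_bigr => a _; case: ifP => wa; last by rewrite mulr0 big_pred0.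
  by rewrite mulr_sumr.
rewrite (exchange_big_dep predT) //=; apply: eq_bigr => u _; rewrite /density.
have [wu|nwu] := boolP (e w u).
  rewrite (big_pred1 [set w; u]) // => a; apply/and3P/eqP => [[/edgeP[x1 [y1 [xy ->]]]]|->].
    rewrite !inE => /orP[] /eqP -> /andP[uw /orP[] /eqP E]; rewrite E ?eqxx // in uw *.
    by rewrite setUC.
  rewrite in_edges // wu !inE !eqxx orbT andbT; split=> //.
  by apply: contraTneq wu => ->; rewrite ei.
rewrite mul0r big_pred0 // => a; apply/negbTE; apply: contra nwu.
move=> /and3P[/edgeP[x1 [y1 [xy ->]]]].
rewrite !inE => /orP[] /eqP -> /andP[uw /orP[] /eqP E]; rewrite E ?eqxx // in uw *.
by rewrite es.
Qed.

End RowSpace.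

Section Rigidity.
Variables (R : realType) (V : finType).
Implicit Types (e : rel V) (X : {set V}).
Local Notation conf := (V -> 'rV[R]_3).

Lemma density_weighting e (x : {set V} -> R) : symmetric e -> weighting e (density e x).
Proof.
move=> es; split=> u v; rewrite /density; first by rewrite es setUC.
by move/negPf ->.
Qed.

Lemma force_density e (p : conf) (x : {set V} -> R) w k : symmetric e -> irreflexive e ->
  force p (density e x) w 0 k =
  \sum_(a in edges e) x a * (if w \in a then \sum_(u in a :\ w) (p w 0 k - p u 0 k) else 0).
Proof.
move=> es ei; rewrite (sum_edges _ _ (fun u => p w 0 k - p u 0 k)) // summxE.
by apply: eq_bigr => u _; rewrite !mxE.
Qed.

Lemma rigidity_row e (p : conf) (x : {set V} -> R) (j : 'I_#|{: V * 'I_3}|) :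
  symmetric e -> irreflexive e ->
  ((\row_i x (enum_val i)) *m rigidity_matrix e p) 0 j =
  force p (density e x) (enum_val j).1 0 (enum_val j).2.
Proof.
move=> es ei; rewrite mxE force_density // [RHS]big_enum_val; apply: eq_bigr => i _.
by rewrite !mxE; case: (enum_val j).
Qed.

Lemma row_free_indep e (p : conf) : symmetric e -> irreflexive e ->
  (row_free (rigidity_matrix e p) <-> indep e p).
Proof.
move=> es ei; split=> [rf w hw|ind].
  have [[sw w0] hf] := hw.
  have half u v : e u v -> 2^-1 * (\sum_(x in [set u; v]) \sum_(y in [set u; v]) w x y) = w u v.
    move=> uv; have nuv : u != v by apply: contraTneq uv => ->; rewrite ei.
    have wd x : w x x = 0 by rewrite w0 ?ei.
    have big2 (f : V -> R) : \sum_(x in [set u; v]) f x = f u + f v.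
      by rewrite big_setU1 ?inE //= big_set1.
    by rewrite !big2 !wd (sw v u); field.
  pose x (a : {set V}) : R := 2^-1 * \sum_(y in a) \sum_(z in a) w y z.
  have wE : density e x = w.
    apply: funext => u; apply: funext => v; rewrite /density.
    by case: ifP => [/half //|/negbT /w0 ->].
  have x0 : \row_(i < #|edges e|) x (enum_val i) = 0.
    apply: (row_free_inj rf); rewrite mul0mx; apply/rowP=> j.
    by rewrite rigidity_row // wE hf !mxE.
  move=> u v; have [uv|/w0 //] := boolP (e u v).
  have aE : [set u; v] \in edges e by rewrite in_edges.
  have := congr1 (fun r : 'rV[R]_#|edges e| => r 0 (enum_rank_in aE [set u; v])) x0.
  by rewrite !mxE enum_rankK_in // -wE /density uv.
apply: inj_row_free => r; have [x ->] : exists x : {set V} -> R, r = \row_(i < #|edges e|) x (enum_val i).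
  exists (fun a => \sum_i r 0 i *+ (enum_val i == a)); apply/rowP=> i.
  rewrite mxE (bigD1 i) //= eqxx big1 ?addr0 // => j ji.
  by rewrite (inj_eq enum_val_inj) (negPf ji).
move=> h; have w0 : forall u v, density e x u v = 0.
  apply: ind; split; first exact: density_weighting.
  move=> v; apply/rowP=> k; rewrite [RHS]mxE.
  have := congr1 (fun r : 'rV[R]_(#|{: V * 'I_3}|) => r 0 (enum_rank (v, k))) h.
  by rewrite rigidity_row // !mxE enum_rankK.
apply/rowP=> i; rewrite !mxE; have /edgeP[u [v [uv E]]] := enum_valP i.
by have := w0 u v; rewrite /density uv E.
Qed.

(** The moment makes [Fd] orthogonal to the normal of the triangle, so that [Fd] vanishes
    by the equations along [b] and [d]; then [Fb] is parallel to [b]. *)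
Lemma triangle_forces (b d Fa Fb Fd : 'rV[R]_3) : cross b d != 0 ->
  Fa + Fb + Fd = 0 -> cross b Fb + cross d Fd = 0 ->
  dot Fd b = 0 -> dot Fd d = 0 -> dot Fb b = 0 -> [/\ Fa = 0, Fb = 0 & Fd = 0].
Proof.
move=> n0 sF sM hdb hdd hbb.
have dn : dot Fd (cross b d) = 0.
  move/(congr1 (dot b)): sM; rewrite dotDr dot_crossl add0r dot0r => h.
  by rewrite -[RHS]h; vec_ring.
have Fd0 : Fd = 0.
  pose n := cross b d; have nn : dot n n != 0 by apply: contra_neq n0 => /dot_eq0.
  have E : dot n n *: Fd = dot Fd b *: cross d n - dot Fd d *: cross b n + dot Fd n *: n.
    rewrite /n; vec3.
  apply/eqP; move/eqP: E; rewrite hdb hdd dn !scale0r subrr addr0 scaler_eq0.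
  by rewrite (negPf nn).
have Fb0 : Fb = 0.
  have bb : dot b b != 0.
    by apply: contra_neq n0 => /dot_eq0 ->; rewrite cross0l.
  have E : dot b b *: Fb = dot Fb b *: b - cross b (cross b Fb) by vec3.
  move: sM; rewrite Fd0 cross0r addr0 => h; apply/eqP; move/eqP: E.
  by rewrite h hbb cross0r scale0r subrr scaler_eq0 (negPf bb).
by split=> //; move: sF; rewrite Fb0 Fd0 !addr0.
Qed.

(** Maxwell's count.  It suffices to impose the equilibrium equations at the vertices of
    [X] other than [a], [b] and [d] and three further ones; the remaining six follow by
    [triangle_forces], because forces of bars have no resultant and no moment.  If [X]
    has more than [3 |X| - 6] edges then these equations have a nonzero solution. *)
Lemma indep_three_sparse e (p : conf) : symmetric e -> irreflexive e -> indep e p ->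
  three_sparse e.
Proof.
move=> es ei hind X cX; rewrite leqNgt; apply/negP => big.
have [q [ind gp]] := zopen_meet (@zopen_indep R V e) (@zopen_generalpos R V)
  (ex_intro _ p hind) (@generalpos_exists R V).
pose f : rel V := inner X e.
have fs : symmetric f by apply: inner_sym.
have fi : irreflexive f by apply: inner_irr.
have {}ind : indep f q by apply: sub_indep ind => u v /and3P[].
have [a [b [d [[aX bX dX] [ab bd da]]]]] := card_gt2P cX.
have ad : a != d by rewrite eq_sym.
pose T := X :\ a :\ b :\ d.
have cT : #|X| = (3 + #|T|)%N.
  by rewrite (cardsD1 a X) aX (cardsD1 b) !inE eq_sym ab bX (cardsD1 d) !inE eq_sym bd da dX.
pose dirs (i : 'I_3) : V * 'rV[R]_3 := if i == c0 then (d, q b - q a)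
  else if i == c1 then (d, q d - q a) else (b, q b - q a).
pose entry (s : {set V}) w k := if w \in s then \sum_(u in s :\ w) (q w 0 k - q u 0 k) else 0.
pose sys (i : {v | v \in T} * 'I_3 + 'I_3) (j : 'I_#|edges f|) : R := match i with
  | inl (v, k) => entry (enum_val j) (val v) k
  | inr i => \sum_k entry (enum_val j) (dirs i).1 k * (dirs i).2 0 k end.
have [|y [hy [j0 yj0]]] := nontrivial_solution sys.
  rewrite card_sum card_prod !card_ord card_sig edges_inner -/(induced_edges e X).
  have -> : #|[pred v | v \in T]| = #|T| by apply: eq_card.
  by move: big cT cX; clear; lia.
pose x (s : {set V}) := \sum_j y j *+ (enum_val j == s).
have xE j : x (enum_val j) = y j.
  rewrite /x (bigD1 j) //= eqxx big1 ?addr0 // => i ij.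
  by rewrite (inj_eq enum_val_inj) (negPf ij).
pose w := density f x; have hw : weighting f w by apply: density_weighting.
have fE v k : force q w v 0 k = \sum_j entry (enum_val j) v k * y j.
  rewrite force_density // big_enum_val; apply: eq_bigr => j _.
  by rewrite xE mulrC.
have hT v : v \in T -> force q w v = 0.
  move=> vT; apply/rowP=> k; rewrite fE mxE.
  exact: (hy (inl (Sub v vT, k))).
have hdir i : dot (force q w (dirs i).1) (dirs i).2 = 0.
  rewrite -[RHS](hy (inr i)) /dot /sys; under eq_bigr do rewrite fE mulr_suml.
  rewrite exchange_big; apply: eq_bigr => j _; rewrite mulr_suml; apply: eq_bigr => k _.
  by rewrite mulrAC.
have hX v : v \notin X -> force q w v = 0.
  move=> vX; rewrite /force big1 // => u _; rewrite /w /density /f /= (negPf vX) andbF.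
  by rewrite scale0r.
have rest v : v != a -> v != b -> v != d -> force q w v = 0.
  move=> va vb vd; have [vX|/hX //] := boolP (v \in X).
  by apply: hT; rewrite !inE vd vb va.
have sum3v (g : V -> 'rV[R]_3) : (forall v, v != a -> v != b -> v != d -> g v = 0) ->
    \sum_v g v = g a + g b + g d.
  move=> g0; rewrite (bigD1 a) //= (bigD1 b) 1?eq_sym //= (bigD1 d) /=; last first.
    by rewrite !(eq_sym d) ad bd.
  by rewrite big1 ?addr0 ?addrA // => u /andP[/andP[ua ub] ud]; apply: g0.
have sF := force_sum q hw.1; rewrite sum3v // in sF.
have sM := moment_sum q hw.1.
rewrite sum3v in sM; last by move=> v va vb vd; rewrite rest // cross0r.
have n0 : cross (q b - q a) (q d - q a) != 0.
  apply: cross_affindep => //; apply: gp; rewrite -!setUA !cardsU1 cards1.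
  by case: (_ \notin _); case: (_ \notin _).
have [||||Fa0 Fb0 Fd0] := triangle_forces n0 sF.
- rewrite !crossBl -[RHS]sM.
  have -> : force q w a = - (force q w b + force q w d).
    by apply/eqP; rewrite -addr_eq0 addrA; apply/eqP.
  vec3.
- exact: (hdir c0).
- exact: (hdir c1).
- exact: (hdir c2).
have w0 : forall u v, w u v = 0.
  apply: ind; split=> // v.
  have [->//|va] := eqVneq v a; have [->//|vb] := eqVneq v b.
  by have [->//|vd] := eqVneq v d; apply: rest.
have /edgeP[u [v [uv E]]] := enum_valP j0.
by have := w0 u v; rewrite /w /density uv -E xE => y0; rewrite y0 eqxx in yj0.
Qed.

End Rigidity.

(** * Generic points *)

Section Avoidance.
Import classical_sets functions cardinality constructive_ereal ereal lebesgue_measure.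
Local Open Scope classical_set_scope.
Variable R : realType.

Lemma countable_avoid (A : set R) : countable A -> exists t, ~ A t.
Proof.
move=> cA; apply: contrapT => none.
have I0 : (lebesgue_measure [set` Interval (BLeft (0%R : R)) (BRight 1%R)] = 0)%E.
  apply: countable_lebesgue_measure0; apply: sub_countable cA.
  by apply: subset_card_le => t _; apply: contrapT => At; apply: none; exists t.
move: I0; rewrite lebesgue_measure_itv /= lte_fin ltr01 -EFinB subr0 => -[].
by move/eqP; rewrite oner_eq0.
Qed.

Lemma finite_roots (P : {poly R}) : P != 0 -> finite_set [set t | root P t].
Proof.
move=> P0; have [rs hrs] : exists rs : seq R, forall t, root P t -> t \in rs.
  apply: contrapT => none.
  have [rs [urs rrs crs]] : exists rs, [/\ uniq rs, all (root P) rs & size rs = size P].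
    elim: (size P) => [|n [rs [urs rrs crs]]]; first by exists [::].
    have [t [rt trs]] : exists t, root P t /\ t \notin rs.
      apply: contrapT => h; apply: none; exists rs => t rt.
      by apply/negPn/negP => trs; apply: h; exists t.
    by exists (t :: rs); rewrite /= trs urs rt rrs crs.
  by have := max_poly_roots P0 rrs urs; rewrite crs ltnn.
by apply: sub_finite_set (finite_seq rs) => t /hrs.
Qed.

(** Countably many polynomials have countably many roots. *)
Lemma avoid_roots (T : countType) (P : T -> {poly R}) :
  exists t, forall q, P q != 0 -> ~~ root (P q) t.
Proof.
have [|t ht] := @countable_avoid (\bigcup_q [set t | P q != 0 /\ root (P q) t]).
  apply: bigcup_countable; first exact: countableP.
  move=> q _; have [->|Pq] := eqVneq (P q) 0.
    by rewrite (_ : [set _ | _] = set0) //; apply/seteqP; split=> // t [].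
  apply: finite_set_countable; apply: sub_finite_set (finite_roots Pq).
  by move=> t [].
by exists t => q Pq; apply/negP => rt; apply: ht; exists q.
Qed.

End Avoidance.

Section GenericPoints.
Variable R : realType.
Import -(notations) mpoly.

Definition lastvar n (m : multinom n.+1) : nat := m ord_max.
Definition narrow n (m : multinom n.+1) : multinom n :=
  Multinom (mktuple (fun i => m (lift ord_max i))).
Definition extend n (x : 'I_n -> R) (t : R) (i : 'I_n.+1) : R :=
  if unlift ord_max i is Some j then x j else t.

Lemma narrow_inj n (m m' : multinom n.+1) : narrow m = narrow m' -> lastvar m = lastvar m' -> m = m'.
Proof.
move=> /mnmP h hl; apply/mnmP => i; have [j ->|->] := unliftP ord_max i; last exact: hl.
by have := h j; rewrite !mnmE.
Qed.

Lemma mmap1_extend n (x : 'I_n -> R) t m :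
  mmap1 (extend x t) m = mmap1 x (narrow m) * t ^+ lastvar m.
Proof.
rewrite /mmap1 big_ord_recr /= /extend unlift_none; congr (_ * _).
apply: eq_bigr => i _; rewrite mnmE (_ : widen_ord _ i = lift ord_max i); last first.
  by apply: val_inj; rewrite /= /bump leqNgt ltn_ord.
by rewrite liftK.
Qed.

(** All variables but the last one are evaluated, at [x]. *)
Definition lastpoly n (x : 'I_n -> R) (q : mpoly n.+1 rat) : {poly R} :=
  \sum_(m <- msupp q) (ratr (mcoeff m q) * mmap1 x (narrow m)) *: 'X^(lastvar m).

Lemma horner_lastpoly n (x : 'I_n -> R) q t :
  (lastpoly x q).[t] = mmap ratr (extend x t) q.
Proof.
rewrite /lastpoly horner_sum; apply: eq_bigr => m _.
by rewrite hornerZ hornerXn mmap1_extend mulrA.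
Qed.

(** The monomials of [q] with the highest-numbered variable to a power [k] that occurs
    form a nonzero polynomial [qk] in the other variables; its value at [x] is a
    coefficient of [lastpoly]. *)
Lemma lastpoly_neq0 n (x : 'I_n -> R) q :
  (forall q : mpoly n rat, q != 0 -> mmap ratr x q != 0) -> q != 0 -> lastpoly x q != 0.
Proof.
move=> hx; rewrite -msupp_eq0; case E: (msupp q) => [|m0 s] // _.
have m0q : m0 \in msupp q by rewrite E mem_head.
pose k := lastvar m0.
pose qk : mpoly n rat :=
  \sum_(m <- msupp q | lastvar m == k) mcoeff m q *: mpolyX rat (narrow m).
have qk0 : qk != 0.
  apply: contraTneq m0q => qk0; rewrite mcoeff_msupp negbK.
  have := congr1 (mcoeff (narrow m0)) qk0; rewrite mcoeff0 /qk raddf_sum /= => h.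
  apply/eqP; rewrite -[RHS]h big_mkcond (bigD1_seq m0) ?msupp_uniq ?E ?mem_head //= eqxx.
  rewrite mcoeffZ mcoeffX eqxx mulr1 big1 ?addr0 // => m mm0; case: eqP => // mk.
  rewrite mcoeffZ mcoeffX; case: eqP => [E'|_]; last by rewrite mulr0.
  by case/eqP: mm0; apply: narrow_inj.
apply: contra_neq (hx qk qk0) => lp0.
have -> : mmap ratr x qk = (lastpoly x q)`_k; last by rewrite lp0 coef0.
rewrite /qk /lastpoly coef_sum raddf_sum big_mkcond /=; apply: eq_bigr => m _.
rewrite coefZ coefXn (eq_sym k); case: eqP => _; last by rewrite mulr0.
by rewrite mmapZ mmapX mulr1.
Qed.

(** One coordinate after the other is chosen outside the roots of countably many
    polynomials. *)
Lemma alg_indep_tuple n : exists x : 'I_n -> R,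
  forall q : mpoly n rat, q != 0 -> mmap ratr x q != 0.
Proof.
elim: n => [|n [x hx]].
  exists (fun=> 0) => q; have m0 (m : multinom 0) : m = mnm0 by apply/mnmP => -[].
  rewrite -msupp_eq0 /mmap; have := msupp_uniq q; have := mcoeff_msupp q.
  case: (msupp q) => [|m [|m' s]] // h; last by rewrite (m0 m) (m0 m') /= inE eqxx.
  move=> _ _; rewrite big_seq1 /mmap1 big_ord0 mulr1 fmorph_eq0.
  by rewrite -h mem_head.
pose dec (s : seq (multinom n.+1 * rat)) : mpoly n.+1 rat :=
  \sum_(mc <- s) mc.2 *: mpolyX rat mc.1.
have [t ht] := avoid_roots (fun s => lastpoly x (dec s)).
exists (extend x t) => q q0; rewrite -horner_lastpoly.
have E : dec [seq (m, mcoeff m q) | m <- msupp q] = q.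
  by rewrite [RHS]mpolyE /dec big_map.
have := ht [seq (m, mcoeff m q) | m <- msupp q]; rewrite E => /(_ (lastpoly_neq0 hx q0)).
by [].
Qed.

Lemma generic_exists (V : finType) d : exists p : V -> 'rV[R]_d, generic p.
Proof.
have [x hx] := alg_indep_tuple #|{: V * 'I_d}|.
exists (fun v => \row_k x (enum_rank (v, k))) => q /hx.
rewrite (_ : (fun i => _) = x) //; apply: funext => i.
by rewrite mxE -surjective_pairing enum_valK.
Qed.

(** If [v A A^T = 0] then [v A] is orthogonal to itself. *)
Lemma row_free_gram m n (A : 'M[R]_(m, n)) : row_free A = (\det (A *m A^T) != 0).
Proof.
rewrite -unitfE -[RHS]/(A *m A^T \in unitmx) -row_free_unit; apply/idP/idP => rf.
  apply: inj_row_free => v h; apply/eqP; rewrite -(mulmx_free_eq0 _ rf); apply/eqP.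
  have : (v *m A) *m (v *m A)^T = 0 by rewrite trmx_mul !mulmxA -(mulmxA v) h mul0mx.
  move/(congr1 (fun M : 'M_1 => M 0 0)); rewrite !mxE => /psumr_eq0P h0.
  apply/rowP=> j; rewrite [RHS]mxE; have := h0 _ j isT; rewrite !mxE => /(_ _)/eqP.
  by rewrite mulf_eq0 orbb => h1; apply/eqP/h1 => i _; rewrite !mxE -expr2 sqr_ge0.
apply: inj_row_free => v h; apply/eqP; rewrite -(mulmx_free_eq0 _ rf); apply/eqP.
by rewrite mulmxA h mul0mx.
Qed.

(** Independence at one placement gives it at all generic ones, because the Gram
    determinant is a polynomial with rational coefficients in the coordinates. *)
Lemma generic_row_free (V : finType) (e : rel V) d (p0 p : V -> 'rV[R]_d) :
  row_free (rigidity_matrix e p0) -> generic p -> row_free (rigidity_matrix e p).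
Proof.
pose N := #|{: V * 'I_d}|; pose X v k : mpoly N rat := mpolyX rat (mnm1 (enum_rank (v, k))).
pose M : 'M[mpoly N rat]_(#|edges e|, N) := \matrix_(i, j)
  let a : {set V} := enum_val i in let: (w, k) := (enum_val j : V * 'I_d) in
  if w \in a then \sum_(u in a :\ w) (X w k - X u k) else 0.
pose D := \det (M *m M^T).
have ev (q : V -> 'rV[R]_d) : mmap ratr (fun i => q (enum_val i).1 0 (enum_val i).2) D =
    \det (rigidity_matrix e q *m (rigidity_matrix e q)^T).
  rewrite /D -det_map_mx map_mxM -map_trmx.
  suff -> : map_mx (mmap ratr (fun i => q (enum_val i).1 0 (enum_val i).2)) M = rigidity_matrix e q by [].
  apply/matrixP=> i j; rewrite !mxE; case: (enum_val j) => w k /=.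
  case: (w \in enum_val i); last by rewrite raddf0.
  by rewrite raddf_sum; apply: eq_bigr => u _; rewrite raddfB /= /X !mmapX !mmap1U !enum_rankK.
rewrite !row_free_gram -!ev => h gp; apply: gp; apply: contra_neq h => ->.
by rewrite rmorph0.
Qed.

End GenericPoints.

Theorem theorem1p3 (R : realType) (V : finType) (e : rel V)
    (esym : symmetric e) (eirr : irreflexive e) (ereg : regular e 5) :
  rigidity_independent e R 3 <-> three_sparse e.
Proof.
split=> [[p _ /(row_free_indep _ esym eirr)]|/(sparse_three_sparse esym eirr) sp].
  exact: indep_three_sparse.
have md : maxdeg5 e.
  by move=> v; rewrite -(ereg v) dg_card; apply/subset_leq_card/subsetP=> u; rewrite !inE.
have [p0 /(row_free_indep _ esym eirr) rf] := sparse_realizable R esym eirr sp md.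
have [p gp] := generic_exists R V 3.
by exists p => //; apply: generic_row_free rf gp.
Qed.
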